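(* Let $p\ge 2$ be an integer, let $\tilde Q_{\mathbb{Z}}$ be a non-deterministic Extended Ergodic CP Distribution on $\mathcal{M}^*\times\Lambda_p^{\mathbb{Z}}$, and let $\hat\nu\tilde Q_{\mathbb{Z}}$ be its pushforward by $\hat\nu(\nu,\boldsymbol{i})=\nu$. For every bounded measurable $f:\mathcal{M}^*\to\mathbb{C}$ define $F^f(\nu)=\int_0^1 f(t_x^*\nu)\,d\nu(x)$. Then for $\hat\nu\tilde Q_{\mathbb{Z}}$-almost every $\nu$, $$\lim_{T\to\infty}\frac{1}{\nu[0,T)}\int_0^T f(t_x^*\nu)\,d\nu(x)=\mathbb{E}_{\hat\nu\tilde Q_{\mathbb{Z}}}(F^f\mid\mathbb{J})(\nu),$$ where $T$ ranges over positive reals and $\mathbb{J}$ is the $\sigma$-algebra of sets invariant under the map $t(\nu)=t^*_{\tau(\nu)}\nu$, with $\tau(\nu)=\min\{n\in\mathbb{N}: t_n\nu[0,1)>0\}$.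
   Context: All spaces are separable metric spaces with their Borel $\sigma$-algebras. $\mathcal{M}(\mathbb{R})$ is the space of positive Radon measures on $\mathbb{R}$ (including $0$) with the weak topology ($\nu_n\to\nu$ iff $\int f\,d\nu_n\to\int f\,d\nu$ for all $f\in C_c(\mathbb{R})$). For a measurable map $\rho$, $\rho\nu$ denotes the pushforward of $\nu$ by $\rho$. $\mathbb{N}=\{1,2,\ldots\}$. Integrals $\int_a^b\cdots d\nu(x)$ are over the half-open interval $[a,b)$. Normalization: for $0\ne\nu\in\mathcal{M}(\mathbb{R})$ put $\psi(\nu)=\min\{n\in\mathbb{N}:\nu[-(n-1),n)>0\}$ and $N\nu=\nu/\nu[-(\psi(\nu)-1),\psi(\nu))$; put $N0=0$. $\mathcal{M}^*=N(\mathcal{M}(\mathbb{R}))$ is the space of normalized measures. Fix an integer $p\ge2$, $\Lambda_p=\{0,\ldots,p-1\}$. For $j\in\Lambda_p$: $[j)_p=[\frac jp,\frac{j+1}p)$ and $\rho_j(x)=px-j$. On $\mathcal{M}^*\times\Lambda_p^{\mathbb{Z}}$, with points $(\nu,\boldsymbol{i})$, $\boldsymbol{i}=(i_n)_{n\in\mathbb{Z}}$, let $\hat\nu(\nu,\boldsymbol{i})=\nu$, $\hat i_n(\nu,\boldsymbol{i})=i_n$, and $M_p(\nu,\boldsymbol{i})=(N\rho_{i_1}\nu,\boldsymbol{\sigma}(\boldsymbol{i}))$, where $(\boldsymbol{\sigma}(\boldsymbol{i}))_n=i_{n+1}$. A Borel probability measure $\tilde Q_{\mathbb{Z}}$ on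 $\mathcal{M}^*\times\Lambda_p^{\mathbb{Z}}$ is adapted if for every $j\in\Lambda_p$ and almost every $(\nu,\boldsymbol{i})$, $\mathbb{P}_{\tilde Q_{\mathbb{Z}}}(\hat i_1=j\mid\hat\nu,(\hat i_n)_{n\le0})(\nu,\boldsymbol{i})=\nu[j)_p$. It is an Extended Ergodic CP Distribution (Extended ECPD) if it is adapted and is invariant and ergodic under $M_p$. It is deterministic if for almost every $(\nu,\boldsymbol{i})$, $\mathbb{P}_{\tilde Q_{\mathbb{Z}}}(\hat i_1=i_1\mid\hat\nu,(\hat i_n)_{n\le0})(\nu,\boldsymbol{i})=1$, and non-deterministic otherwise. Translations: $t_x(y)=y-x$ on $\mathbb{R}$, $t_x\nu$ is the pushforward, $t_x^*\nu=Nt_x\nu$. The map $t$ is defined where $\tau(\nu)<\infty$, which for a non-deterministic Extended ECPD is a set of full $\hat\nu\tilde Q_{\mathbb{Z}}$-measure; accordingly $\mathbb{J}$ consists of the Borel sets $A\subseteq\mathcal{M}^*$ with $t^{-1}A=A$ up to $\hat\nu\tilde Q_{\mathbb{Z}}$-null sets. *)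

(* Defs.v *)
From HB Require Import structures.
From mathcomp Require Import all_boot all_order all_algebra.
From mathcomp Require Import complex.
From mathcomp Require Import all_classical all_reals all_analysis.

Set Implicit Arguments.
Unset Strict Implicit.
Unset Printing Implicit Defensive.

Import Order.TTheory GRing.Theory Num.Theory.
Import numFieldNormedType.Exports.

Local Open Scope classical_set_scope.
Local Open Scope ring_scope.

Definition borel (T : topologicalType) : Type := g_sigma_algebraType (@open T).

HB.instance Definition _ (T : ptopologicalType) :=
  Measurable.copy (borel T) (g_sigma_algebraType (@open T)).

Lemma continuous_measurable_borel (T U : ptopologicalType) (f : T -> U) :
  continuous f -> measurable_fun [set: borel T] (f : borel T -> borel U).
Proof.
move=> /continuousP cf; apply: (@measurability _ _ (borel T) (borel U) _ f open).
  by [].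
move=> _ [B oB <-]; rewrite setTI; apply: sub_sigma_algebra; exact: cf.
Qed.

Definition least (P : set nat) : option nat :=
  match pselect (exists n, `[< P n >]) with
  | left ex => Some (ex_minn ex)
  | right _ => None
  end.

Section radon.
Context (R : realType).
Local Open Scope ereal_scope.

(* A library measure assigns junk values to non-measurable sets; these are
   fixed to 0, so that equality of radon measures is equality on Borel sets
   (radon_ext). On the real line every locally finite Borel measure is
   regular. *)
Record radon := MkRadon {
  radon_measure :> {measure set R -> \bar R} ;
  radon_compact : forall K, compact K -> radon_measure K < +oo ;
  radon_off : forall A, ~ measurable A -> radon_measure A = 0 }.

HB.instance Definition _ := gen_eqMixin radon.
HB.instance Definition _ := gen_choiceMixin radon.

Lemma radon_ext (mu nu : radon) :
  (forall A, measurable A -> mu A = nu A) -> mu = nu.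
Proof.
case: mu nu => [mu cmu omu] [nu cnu onu] /= munu.
have E : mu = nu.
  apply/eq_measure/funext => A.
  have [/munu//|nA] := pselect (measurable A).
  by rewrite omu// onu.
by move: cmu omu; rewrite E => cmu omu; congr MkRadon; exact: Prop_irrelevance.
Qed.

Section clip.
Variable mu : {measure set R -> \bar R}.

Definition clip (A : set R) : \bar R := if `[< measurable A >] then mu A else 0.

Let clipE A : measurable A -> clip A = mu A.
Proof. by move=> mA; rewrite /clip asboolT. Qed.

Let clip0 : clip set0 = 0. Proof. by rewrite clipE// measure0. Qed.

Let clip_ge0 A : 0 <= clip A. Proof. by rewrite /clip; case: ifP. Qed.

Let clip_sigma_additive : semi_sigma_additive clip.
Proof.
move=> F mF tF mUF; rewrite clipE//.
rewrite (_ : (fun n => _) = (fun n => \sum_(0 <= i < n) mu (F i))); last first.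
  by apply/funext => n; apply: eq_bigr => i _; rewrite clipE.
exact: measure_semi_sigma_additive.
Qed.

HB.instance Definition _ :=
  isMeasure.Build _ _ _ clip clip0 clip_ge0 clip_sigma_additive.

Hypothesis cmu : forall K, compact K -> mu K < +oo.

Let clip_compact K : compact K -> clip K < +oo.
Proof. by move=> cK; rewrite /clip; case: ifP => // _; exact: cmu. Qed.

Let clip_off A : ~ measurable A -> clip A = 0.
Proof. by move=> nA; rewrite /clip asboolF. Qed.

Definition radon_of : radon := MkRadon clip_compact clip_off.

Lemma radon_ofE A : measurable A -> radon_of A = mu A.
Proof. exact: clipE. Qed.

End clip.

Let mzero_compact (K : set R) : compact K -> @mzero _ R R K < +oo.
Proof. by move=> _; rewrite /mzero ltry. Qed.

Definition radon0 : radon := radon_of mzero_compact.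

HB.instance Definition _ := isPointed.Build radon radon0.

Section scale.
Variables (c : R) (c0 : (0 <= c)%R) (nu : radon).

Let scale_compact K : compact K -> mscale (NngNum c0) nu K < +oo.
Proof.
move=> /(radon_compact nu) h; rewrite /mscale/= lte_mul_pinfty//.
Qed.

Definition radon_scale : radon := radon_of scale_compact.

End scale.

(* As a != 0, the affine map is proper, so that its image measures are locally
   finite. *)
Section affine.
Variables (a b : R) (a0 : a != 0%R) (nu : radon).

Definition affine (x : R) : R := (a * x + b)%R.

Lemma continuous_affine : continuous affine.
Proof.
move=> x; apply: cvgD; last exact: cvg_cst.
by apply: cvgM; [exact: cvg_cst|exact: cvg_id].
Qed.

Let measurable_affine : measurable_fun [set: R] affine.
Proof. exact: measurable_realfun.continuous_measurable_fun continuous_affine. Qed.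

Definition affine_pushforward : set R -> \bar R := pushforward nu affine.

Let pushforward0 : affine_pushforward set0 = 0.
Proof. exact: measure0. Qed.

Let pushforward_ge0 A : 0 <= affine_pushforward A.
Proof. exact: measure_ge0. Qed.

Let pushforward_sigma_additive : semi_sigma_additive affine_pushforward.
Proof. exact: (measure_semi_sigma_additive (s := pushforward nu affine)). Qed.

HB.instance Definition _ := isMeasure.Build _ _ _ affine_pushforward
  pushforward0 pushforward_ge0 pushforward_sigma_additive.

Let affine_compact K : compact K -> affine_pushforward K < +oo.
Proof.
move=> cK; apply: (@radon_compact nu).
rewrite (_ : affine @^-1` K = (fun y : R => (a^-1 * (y - b))%R) @` K).
  apply: continuous_compact cK; apply: continuous_subspaceT => x.
  apply: cvgM; [exact: cvg_cst|apply: cvgB; [exact: cvg_id|exact: cvg_cst]].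
apply/seteqP; split => [x Kx|_ [y Ky <-]]; last first.
  by rewrite /preimage/= /affine mulVKf// subrK.
by exists (affine x); rewrite // /affine addrK mulKf.
Qed.

Definition radon_affine : radon := radon_of affine_compact.

End affine.

Definition Cc : Type :=
  {f : R -> R | continuous f /\ compact (closure [set x | f x != 0%R])}.

(* The initial topology of this map is the coarsest one making nu |-> int f dnu
   continuous for every continuous, compactly supported f. *)
Definition Cc_integral (nu : radon) : {ptws Cc -> R} :=
  fun f => (\int[nu]_x (sval f) x)%R.

HB.instance Definition _ := Topological.copy radon (initial_topology Cc_integral).

Definition norm_itv (n : nat) : set R := `[(- n.-1%:R)%R, (n%:R)%R[%classic.

Definition psi (nu : radon) : option nat :=
  least [set n | (0 < n)%N /\ 0 < nu (norm_itv n)].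

Lemma normalize_subproof (nu : radon) n : (0 <= (fine (nu (norm_itv n)))^-1)%R.
Proof. by rewrite invr_ge0 fine_ge0. Qed.

(* psi nu = None exactly when nu = 0. *)
Definition normalize (nu : radon) : radon :=
  if psi nu is Some n then radon_scale (normalize_subproof nu n) nu else radon0.

Definition Mstar : Type := set_type (range normalize).

Definition Nstar (nu : radon) : Mstar :=
  SigSub (mem_set (imageT normalize nu)).

HB.instance Definition _ := Topological.on Mstar.
HB.instance Definition _ := isPointed.Build Mstar (Nstar radon0).

Definition radon_of_Mstar (nu : Mstar) : radon := \val nu.

Definition translate (x : R) (nu : radon) : radon :=
  radon_affine (- x) (oner_neq0 R) nu.

Definition tstar (x : R) (nu : Mstar) : Mstar :=
  Nstar (translate x (radon_of_Mstar nu)).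

Definition tau (nu : Mstar) : option nat :=
  least [set n | (0 < n)%N /\
    0 < translate n%:R (radon_of_Mstar nu) `[0%R, 1%R[%classic].

(* Undefined (None) where tau is infinite. *)
Definition tmap (nu : Mstar) : option Mstar :=
  omap (fun n => tstar n%:R nu) (tau nu).

Definition tmap_preimage (A : set Mstar) : set Mstar :=
  [set nu | exists2 mu, tmap nu = Some mu & A mu].

Definition t_invariant (P : set (borel Mstar) -> \bar R) :
    set_system (borel Mstar) :=
  [set A : set (borel Mstar) |
    measurable A /\ P.-negligible (tmap_preimage A `+` A)].

End radon.
Coercion radon_of_Mstar : Mstar >-> radon.

Section conditional_expectation.
Context d (T : measurableType d) (R : realType).
Variables (P : probability T R) (G : set_system T).

Definition is_cond_exp (f h : T -> R) : Prop :=
  [/\ forall B, measurable B -> G (h @^-1` B),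
      P.-integrable [set: T] (EFin \o h) &
      forall A, G A -> \int[P]_(x in A) h x = \int[P]_(x in A) f x].

(* A chosen version; any two versions agree almost everywhere. *)
Definition cond_exp (f : T -> R) : T -> R := xget (cst 0) (is_cond_exp f).

Definition cond_prob (A : set T) : T -> R := cond_exp \1_A.

Definition cond_expC (f : T -> R[i]) (x : T) : R[i] :=
  Complex (cond_exp (fun y => complex.Re (f y)) x)
          (cond_exp (fun y => complex.Im (f y)) x).

End conditional_expectation.

Definition RintegralC d (T : measurableType d) (R : realType)
    (mu : {measure set T -> \bar R}) (D : set T) (f : T -> R[i]) : R[i] :=
  Complex (\int[mu]_(x in D) complex.Re (f x))
          (\int[mu]_(x in D) complex.Im (f x)).

Section CP.
Context (R : realType) (p : nat) (hp : (1 < p)%N).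

(* The alphabet {0, ..., p - 1}; its type carries hp, which makes it pointed. *)
Definition digit (_ : (1 < p)%N) : Type := discrete_topology 'I_p.

Local Notation Lambda := (digit hp).

HB.instance Definition _ := DiscreteTopology.copy Lambda (discrete_topology 'I_p).
HB.instance Definition _ := isPointed.Build Lambda (Ordinal (ltnW hp)).

Definition digit_nat (j : Lambda) : nat := nat_of_ord (j : 'I_p).

Definition points : Type := (Mstar R * {ptws int -> Lambda})%type.

HB.instance Definition _ := Topological.on points.
HB.instance Definition _ := Pointed.on points.

Definition Omega : Type := borel points.

HB.instance Definition _ := Measurable.on Omega.

Definition nuhat (w : Omega) : borel (Mstar R) := w.1.

Definition ihat (n : int) (w : Omega) : Lambda := w.2 n.

Lemma measurable_nuhat : measurable_fun [set: Omega] nuhat.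
Proof.
apply: (@continuous_measurable_borel points (Mstar R) fst) => w.
exact: cvg_fst.
Qed.

HB.instance Definition _ :=
  isMeasurableFun.Build _ _ Omega (borel (Mstar R)) nuhat measurable_nuhat.

Definition digit_itv (j : Lambda) : set R :=
  `[(digit_nat j)%:R / p%:R, (digit_nat j).+1%:R / p%:R[%classic.

Lemma p_neq0 : p%:R != 0 :> R.
Proof. by rewrite pnatr_eq0 -lt0n ltnW. Qed.

(* nu |-> rho_j nu, where rho_j(x) = p x - j. *)
Definition rho (j : Lambda) (nu : radon R) : radon R :=
  radon_affine (- (digit_nat j)%:R) p_neq0 nu.

Definition shift (i : {ptws int -> Lambda}) : {ptws int -> Lambda} :=
  fun n => i (n + 1).

Definition Mp (w : Omega) : Omega := (Nstar (rho (w.2 1) w.1), shift w.2).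

Definition past : set_system Omega :=
  <<s [set nuhat @^-1` B | B in measurable] `|`
      [set A | exists n j, (n <= 0) /\ A = ihat n @^-1` [set j]] >>.

Variable Q : probability Omega R.

Definition adapted : Prop := forall j : Lambda,
  {ae Q, forall w, (cond_prob Q past (ihat 1 @^-1` [set j]) w)%:E =
                   (nuhat w : Mstar R) (digit_itv j)}.

Definition invariant_distribution : Prop :=
  forall A : set Omega, measurable A -> Q (Mp @^-1` A) = Q A.

Definition ergodic : Prop :=
  forall A : set Omega, measurable A -> Mp @^-1` A = A -> Q A = 0%E \/ Q A = 1%E.

Definition extended_ECPD : Prop :=
  [/\ adapted, invariant_distribution & ergodic].

Definition deterministic : Prop :=
  {ae Q, forall w, cond_prob Q past (ihat 1 @^-1` [set ihat 1 w]) w = 1}.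

Definition nuhatQ : probability (borel (Mstar R)) R := distribution Q nuhat.

End CP.

Section averages.
Context (R : realType) (f : Mstar R -> R[i]).

Definition translate_average (nu : Mstar R) (T : R) : R[i] :=
  Complex (fine (nu `[0, T[%classic))^-1 0 *
    RintegralC nu `[0, T[%classic (fun x => f (tstar x nu)).

Definition integral01 (nu : Mstar R) : R[i] :=
  RintegralC nu `[0, 1[%classic (fun x => f (tstar x nu)).

End averages.

(* C is R[i] with its norm topology, given in the library by _^o. *)
Definition bounded_measurable (R : realType) (f : Mstar R -> R[i]) : Prop :=
  measurable_fun [set: borel (Mstar R)] (f : borel (Mstar R) -> borel (R[i]^o)) /\
  exists B : R, forall nu, `|f nu| <= Complex B 0.

(* Main.v *)
From HB Require Import structures.
From mathcomp Require Import all_boot all_order all_algebra.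
From mathcomp Require Import complex.
From mathcomp Require Import all_classical all_reals all_analysis.
From mathcomp Require Import measurable_realfun.
From mathcomp Require Import ring lra.
Require Import Defs.

Set Implicit Arguments.
Unset Strict Implicit.
Unset Printing Implicit Defensive.

Import Order.TTheory GRing.Theory Num.Theory.
Import numFieldNormedType.Exports.

Local Open Scope classical_set_scope.
Local Open Scope ring_scope.

(** Let [P] be the law of the measure [x] under [Q], and let [mass k x] be the
    mass of the unit cell [[k, k + 1[].

    Seen on its [k]-th unit cell, [x] is [mass k x] times the restriction to
    [[0, 1[] of the translate of [x] by [k] ([integral_cell]). The average of [f]
    over [[0, n[] is therefore the ratio of the sums over [k < n] of
    [mass k x * F (tstar k x)] and of [mass k x], where [F] is the average of [f]
    over the unit interval. The weights form a cocycle over the translations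
    ([mass_tstar]), and they contract the integral in mean:

      [E (mass k x * h (tstar k x)) <= E (h x)]   for [h] nonnegative.

    Under these two properties the ratio ergodic theorem of Hurewicz holds for
    the return map ([ratio_ergodic]), by Garsia's argument: the maximum of the
    sums satisfies a pointwise inequality at the first return, and its integral
    gives the maximal inequality [maximal_ineq]. The limit is the conditional
    expectation with respect to the sets invariant under the return map.

    The contraction property is where the symbolic dynamics enters
    ([transport_digits]). By invariance, [x] has the law of a magnification of
    [x] along its last [n] digits; by adaptedness these digits select a cell of
    generation [n] with a probability equal to its mass
    ([last_digits_integral]). A translation by [k] moves each cell to the [k]-th
    next one, and only the last [k] cells are lost. The loss disappears in the
    limit because the past digits are not eventually equal to [p - 1].

    The theorem also requires that the mass be infinite on both sides
    ([infinite_mass]). The mass [Y] of a half-line grows along the dynamics. The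
    event that it is finite is invariant; were it almost sure, [(1 + Y)^-1] would
    decrease along the dynamics and have a constant mean, hence [Y] would be
    invariant, no mass would ever leave the unit interval, and the measure would
    be carried by a single cell at each step: the distribution would be
    deterministic ([deterministic_of]).

    From integer to real windows, the mass of a single cell must be negligible
    before the mass of [[0, n[] ([mass_negligible]). This follows from the
    ratio theorem for the functions [(1 + x [-m, 0[)^-1]: their means tend to 0
    because the left mass is infinite, while the last term alone of their
    weighted sum controls the square of the share of the last cell.

    All this rests on the measurability of the maps involved. The vague topology
    has a countable basis made of constraints on the integrals of piecewise
    linear functions ([hat_nbhs_cvg]), so that a map into the normalized measures
    is measurable if and only if the masses of the Borel sets are
    ([measurable_Mstar_mass], [measurable_to_Mstar]). *)

(** * Borel structure of the vague topology *)

Section filters.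

Lemma cvg_initial (S : choiceType) (T : topologicalType) (f : S -> T)
    (F : set_system S) (s : S) :
  Filter F -> f @ F --> f s -> F --> (s : initial_topology f).
Proof.
move=> FF fF A /= [_ [[B oB <-] Bfs] BA].
rewrite nbhs_filterE; apply: filterS BA _.
by apply: fF; apply: open_nbhs_nbhs.
Qed.

Lemma cvg_ptws (I : Type) (T : topologicalType) (F : set_system {ptws I -> T})
    (g : {ptws I -> T}) :
  Filter F -> (forall i, (fun h : {ptws I -> T} => h i) @ F --> g i) -> F --> g.
Proof.
move=> FF Fg; apply/cvg_sup => i.
exact: (@cvg_initial _ _ (fun h : {ptws I -> T} => h i)).
Qed.

End filters.

Section hats.
Context {R : realType}.

Definition hat (z : R) : R := Num.max 0 (1 - `|z|).

Lemma hat_ge0 z : 0 <= hat z.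
Proof. by rewrite /hat le_max lexx. Qed.

Lemma hat_eq0 z : 1 <= `|z| -> hat z = 0.
Proof. by move=> z1; rewrite /hat; apply/max_idPl; rewrite subr_le0. Qed.

Lemma continuous_hat : continuous hat.
Proof.
move=> z.
have h : continuous (fun z : R => 1 - `|z|).
  by move=> y; apply: cvgB; [exact: cvg_cst|apply: cvg_norm; exact: cvg_id].
apply: (@continuous_max _ _ (cst 0) (fun z => 1 - `|z|)); last exact: h.
exact: cvg_cst.
Qed.

Let pos (z : R) : R := Num.max 0 z.

Let hatE z : hat z = (pos (z + 1) - pos z) - (pos z - pos (z - 1)).
Proof.
rewrite /hat /pos; case: (lerP 0 z) => z0.
- rewrite ger0_norm//.
  by case: (lerP 0 (1 - z)) => ?; case: (lerP 0 (z + 1)) => ?; case: (lerP 0 (z - 1)) => ?; lra.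
- rewrite ltr0_norm//.
  by case: (lerP 0 (1 - - z)) => ?; case: (lerP 0 (z + 1)) => ?; case: (lerP 0 (z - 1)) => ?; lra.
Qed.

Lemma hat_sumE (N : nat) (y : R) : \sum_(i < N) hat (y - i%:R) =
  (pos (y + 1) - pos y) - (pos (y - N%:R + 1) - pos (y - N%:R)).
Proof.
elim: N => [|N ih]; first by rewrite big_ord0 subr0 subrr.
rewrite big_ord_recr/= ih hatE -natr1.
rewrite (_ : y - N%:R - 1 = y - (N%:R + 1)); last by ring.
rewrite (_ : y - (N%:R + 1) + 1 = y - N%:R); last by ring.
ring.
Qed.

Lemma hat_sum1 (N : nat) (y : R) : 0 <= y -> y <= N%:R ->
  \sum_(i < N.+1) hat (y - i%:R) = 1.
Proof.
move=> y0 yN; rewrite hat_sumE -natr1 /pos.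
rewrite (_ : y - (N%:R + 1) + 1 = y - N%:R); last by ring.
rewrite !(max_r y0).
rewrite (max_r (_ : 0 <= y + 1)); last lra.
rewrite (max_l (_ : y - N%:R <= 0)); last lra.
rewrite (max_l (_ : y - (N%:R + 1) <= 0)); last lra.
ring.
Qed.

Definition hat_at (n : nat) (k : int) (x : R) : R := hat (n.+1%:R * x - k%:~R).

Lemma continuous_hat_at n k : continuous (hat_at n k).
Proof.
move=> x; rewrite /hat_at.
apply: (@continuous_comp R R R (fun x => n.+1%:R * x - k%:~R) hat).
  apply: cvgB; last exact: cvg_cst.
  by apply: cvgM; [exact: cvg_cst|exact: cvg_id].
exact: continuous_hat.
Qed.

(** Heine's theorem on a segment. The modulus is a mesh [1 / n.+1], in the
    multiplicative form in which the support of [hat_at] is expressed. *)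
Lemma uniform_continuity (f : R -> R) (M e : R) : continuous f -> 0 < e ->
  exists n, forall x y, `|x| <= M -> `|n.+1%:R * x - n.+1%:R * y| < 1 ->
    `|f x - f y| < e.
Proof.
move=> cf e0.
pose P (n : nat) (x : R) := forall y, `|n.+1%:R * x - n.+1%:R * y| < 1 ->
  `|f x - f y| < e.
have /compact_near_coveringP : compact `[- M, M]%classic by exact: segment_compact.
move=> /(_ nat \oo P) [].
  move=> x _; have e20 : 0 < e / 2 by rewrite divr_gt0.
  have /cvgrPdist_lt/(_ _ e20) [r /= r0 xr] := cf x.
  have r20 : 0 < r / 2 by rewrite divr_gt0.
  exists (ball x (r / 2), [set n | 2 / r < n.+1%:R]) => /=.
    split; first exact: nbhsx_ballx.
    exists (Num.truncn (2 / r)) => // n /= tn.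
    rewrite (lt_le_trans (truncnS_gt _))//.
    by rewrite ler_nat.
  move=> [x' n] /= [xx' rn] y; rewrite -mulrBr normrM ger0_norm// => h.
  have xy : `|x' - y| < r / 2.
    have h1 : 2 / r * `|x' - y| < 1.
      by apply: le_lt_trans h; rewrite ler_wpM2r// ltW.
    rewrite (_ : `|x' - y| = r / 2 * (2 / r * `|x' - y|)).
      by rewrite -[ltRHS]mulr1 ltr_pM2l.
    by rewrite mulrA mulf_div mulrC [2 * r]mulrC divff ?mulr1// mulf_neq0// gt_eqF.
  rewrite /ball/= in xx'.
  have h1 := xr x'; have h2 := xr y.
  rewrite (_ : f x' - f y = (f x - f y) - (f x - f x')); last by ring.
  rewrite (le_lt_trans (ler_normB _ _))// [e]splitr ltrD//.
    apply: h2; rewrite /ball/= (_ : x - y = (x - x') + (x' - y)); last by ring.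
    by rewrite (le_lt_trans (ler_normD _ _))// [r]splitr ltrD.
  by apply: h1; rewrite /ball/= (lt_trans xx')// ltr_pdivrMr// ltr_pMr// ltr1n.
move=> n _ /(_ n (leqnn n)) h; exists n => x y xM; apply: h => //=.
by rewrite in_itv/= -ler_norml.
Qed.

(** Piecewise linear interpolation of [f] at the points of mesh [1 / n.+1] in
    [[- m, m]]. *)
Definition interp (f : R -> R) (m n : nat) (x : R) : R :=
  \sum_(i < (m.*2 * n.+1).+1)
    f ((i%:R - (m * n.+1)%:R) / n.+1%:R) * hat_at n (i%:Z - (m * n.+1)%:Z) x.

Lemma hat_at_sum1 (m n : nat) (x : R) : `|x| <= m%:R ->
  \sum_(i < (m.*2 * n.+1).+1) hat_at n (i%:Z - (m * n.+1)%:Z) x = 1.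
Proof.
rewrite ler_norml => /andP[x1 x2].
rewrite -[RHS](@hat_sum1 (m.*2 * n.+1) (n.+1%:R * x + (m * n.+1)%:R)).
- apply: eq_bigr => i _; rewrite /hat_at rmorphB/=; congr hat.
  by rewrite -!pmulrn; ring.
- rewrite natrM (mulrC m%:R) -mulrDr mulr_ge0//; lra.
- rewrite natrM (mulrC _ x) -mulrDl natrM ler_wpM2r//.
  rewrite -addnn natrD; lra.
Qed.

Lemma interp_approx (f : R -> R) (M : R) (m n : nat) (e : R) :
  (forall x, M < `|x| -> f x = 0) -> M + 1 <= m%:R -> 0 < e ->
  (forall x y, `|x| <= m%:R -> `|n.+1%:R * x - n.+1%:R * y| < 1 ->
    `|f x - f y| < e) ->
  (forall x, m%:R < `|x| -> interp f m n x = 0) /\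
  (forall x, `|x| <= m%:R -> `|f x - interp f m n x| <= e).
Proof.
move=> f0 Mm e0 unif; split => x mx.
  rewrite /interp big1// => i _.
  have [h|h] := leP 1 `|n.+1%:R * x - (i%:Z - (m * n.+1)%:Z)%:~R|.
    by rewrite /hat_at hat_eq0// mulr0.
  rewrite f0 ?mul0r//; apply: contraTT mx; rewrite -!leNgt => h2.
  set y := (_ / _) in h2.
  have xy : `|x - y| <= 1.
    rewrite -(@ler_pM2l _ n.+1%:R)// -[X in X * _](@ger0_norm _ n.+1%:R)//.
    rewrite -normrM mulrBr (_ : n.+1%:R * y = (i%:Z - (m * n.+1)%:Z)%:~R).
      by rewrite (le_trans (ltW h))// mulr1 ler1n.
    rewrite /y mulrC divfK// ?pnatr_eq0//.
    by rewrite rmorphB/= -!pmulrn.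
  rewrite (_ : x = y + (x - y)); last by ring.
  rewrite (le_trans (ler_normD _ _))//; lra.
have -> : f x - interp f m n x = \sum_(i < (m.*2 * n.+1).+1)
    (f x - f ((i%:R - (m * n.+1)%:R) / n.+1%:R)) *
    hat_at n (i%:Z - (m * n.+1)%:Z) x.
  rewrite -[X in X - _]mulr1 -[X in _ * X - _](hat_at_sum1 n mx).
  rewrite mulr_sumr /interp -sumrB; apply: eq_bigr => i _.
  by rewrite -mulrBl.
rewrite (le_trans (ler_norm_sum _ _ _))//.
have -> : e = \sum_(i < (m.*2 * n.+1).+1) e * hat_at n (i%:Z - (m * n.+1)%:Z) x.
  by rewrite -mulr_sumr hat_at_sum1// mulr1.
apply: ler_sum => i _; rewrite normrM.
rewrite (ger0_norm (hat_ge0 _)).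
have [h|h] := leP 1 `|n.+1%:R * x - (i%:Z - (m * n.+1)%:Z)%:~R|.
  by rewrite /hat_at hat_eq0// !mulr0.
apply: ler_wpM2r; first exact: hat_ge0.
apply/ltW/unif => //.
rewrite [n.+1%:R * (_ / _)]mulrC divfK ?pnatr_eq0//.
by move: h; rewrite rmorphB/= -!pmulrn.
Qed.

End hats.

Section vague.
Context {R : realType}.
Implicit Types (nu : radon R) (f g : R -> R).

Definition supported_in (M : R) f := forall x, M < `|x| -> f x = 0.

Lemma radon_itv_fin nu (a b : R) : (nu `[a, b]%classic < +oo)%E.
Proof. by apply: radon_compact; exact: segment_compact. Qed.

Lemma integrable_Cc nu f (M : R) : continuous f -> supported_in M f ->
  nu.-integrable [set: R] (EFin \o f).
Proof.
move=> cf f0.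
have -> : EFin \o f = (EFin \o f) \_ `[- M, M]%classic.
  apply/funext => x; rewrite patchE; case: ifPn => //.
  rewrite notin_setE/= in_itv/= -ler_norml => /negP; rewrite -ltNge => /f0.
  by move=> ->.
apply/(integrable_mkcond _ _).1 => //.
apply: measurable_bounded_integrable => //.
- exact: radon_itv_fin.
- apply: measurable_funTS.
  exact: measurable_realfun.continuous_measurable_fun.
- have : {within `[- M, M], continuous f} by exact: continuous_subspaceT.
  move=> /continuous_compact/(_ (@segment_compact _ _ _))/compact_bounded.
  move=> [B [_ mrt]].
  by exists B; split; rewrite ?num_real // => ? ? ? ?; exact: mrt.
Qed.

Lemma hat_at_supported (n : nat) (k : int) :
  supported_in (`|k%:~R| + 1) (@hat_at R n k).
Proof.
move=> x kx; rewrite /hat_at hat_eq0//.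
have h : `|x| <= `|n.+1%:R * x|.
  by rewrite normrM ger0_norm// ler_peMl// ler1n.
have := lerB_normD (n.+1%:R * x) (- k%:~R); rewrite normrN.
move: h kx; set a := `|x|; set b := `| _ * x|; set c := `|_%:~R| => h kx.
apply: le_trans; lra.
Qed.

Lemma Cc_supported (F : Cc R) : exists M : R, supported_in M (sval F).
Proof.
case: F => f [cf /compact_bounded [M [_ Mf]]] /=.
exists (M + 1) => x Mx; apply/eqP; apply/negPn/negP => fx.
have := Mf (M + 1); rewrite ltrDl ltr01 => /(_ erefl x) /=.
rewrite leNgt Mx/= => h; suff: false by [].
by apply: h; apply: subset_closure.
Qed.

Lemma integrable_hat_at nu n k : nu.-integrable [set: R] (EFin \o hat_at n k).
Proof.
apply: integrable_Cc (@hat_at_supported _ _); exact: continuous_hat_at.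
Qed.

Lemma integral_interp nu f m n :
  (\int[nu]_x interp f m n x)%R = \sum_(i < (m.*2 * n.+1).+1)
   f ((i%:R - (m * n.+1)%:R) / n.+1%:R) *
   (\int[nu]_x hat_at n (i%:Z - (m * n.+1)%:Z) x)%R.
Proof.
rewrite /Rintegral.
under eq_integral do rewrite /interp -sumEFin.
have ih (i : 'I_((m.*2 * n.+1).+1)) : nu.-integrable [set: R] (fun x =>
    (f ((i%:R - (m * n.+1)%:R) / n.+1%:R) *
     hat_at n (i%:Z - (m * n.+1)%:Z) x)%:E).
  under eq_fun do rewrite EFinM.
  by apply: integrableZl => //; exact: integrable_hat_at.
rewrite integral_sum//; apply: EFin_inj; rewrite fineK; last first.
  by apply/sum_fin_numP => i _ _; exact: integrable_fin_num.
rewrite -sumEFin; apply: eq_bigr => i _.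
under eq_integral do rewrite EFinM.
rewrite integralZl//; last exact: integrable_hat_at.
rewrite EFinM fineK//; apply: integrable_fin_num => //; exact: integrable_hat_at.
Qed.

Lemma integrable_interp nu f m n : nu.-integrable [set: R] (EFin \o interp f m n).
Proof.
rewrite /comp; under eq_fun do rewrite /interp -sumEFin.
apply: integrable_sum => // i _; under eq_fun do rewrite EFinM.
by apply: integrableZl => //; exact: integrable_hat_at.
Qed.

Lemma interp1_ge0 m n (x : R) : 0 <= interp (cst 1) m n x.
Proof. by apply: sumr_ge0 => i _; rewrite mul1r hat_ge0. Qed.

Lemma integral_interp_approx f (M : R) : continuous f -> supported_in M f ->
  exists m, forall e, 0 < e -> exists n, forall nu,
    `|(\int[nu]_x f x)%R - (\int[nu]_x interp f m n x)%R| <=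
    e * (\int[nu]_x interp (cst 1) m 0 x)%R.
Proof.
move=> cf f0; pose m := (Num.truncn (M + 1)).+1; exists m => e e0.
have [n fn] := uniform_continuity m%:R cf e0.
have [i0 i1] := interp_approx f0 (ltW (truncnS_gt _)) e0 fn.
exists n => nu; rewrite -RintegralB//; first last.
- exact: integrable_interp.
- exact: integrable_Cc f0.
have ifn : nu.-integrable [set: R] (EFin \o (fun x => f x - interp f m n x)).
  rewrite /comp; under eq_fun do rewrite EFinB.
  by apply: integrableB => //; [exact: integrable_Cc f0|exact: integrable_interp].
apply: (le_trans (le_normr_Rintegral _ ifn)) => //.
rewrite -RintegralZl//; last exact: integrable_interp.
apply: le_Rintegral => //.
- exact: (integrable_abse ifn).
- rewrite /comp; under eq_fun do rewrite EFinM.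
  by apply: integrableZl => //; exact: integrable_interp.
move=> x _; have [xm|xm] := leP `|x| m%:R.
  rewrite (le_trans (i1 _ xm))// /interp; under eq_bigr do rewrite mul1r.
  by rewrite hat_at_sum1// mulr1.
rewrite i0// f0 ?subrr ?normr0.
  by rewrite mulr_ge0 ?interp1_ge0// ltW.
by rewrite (le_lt_trans _ xm)// (le_trans _ (ltW (truncnS_gt _)))// lerDl.
Qed.

(** Finitely many rational constraints on the integrals of the hats, encoded by
    a list so that the family of these sets is visibly countable. *)
Definition hat_box (l : seq (nat * int * (rat * rat))) : set (radon R) :=
  [set nu | all (fun c => (ratr c.2.1 < (\int[nu]_x hat_at c.1.1 c.1.2 x)%R) &&
                          ((\int[nu]_x hat_at c.1.1 c.1.2 x)%R < ratr c.2.2)) l].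

Definition hat_nbhs nu : set_system (radon R) :=
  [set A | exists2 l, hat_box l nu & hat_box l `<=` A].

Local Instance hat_nbhs_filter nu : Filter (hat_nbhs nu).
Proof.
split.
- by exists [::].
- move=> A B [l1 h1 s1] [l2 h2 s2]; exists (l1 ++ l2).
    by rewrite /hat_box/= all_cat; apply/andP; split.
  move=> mu; rewrite /hat_box/= all_cat => /andP[m1 m2].
  by split; [exact: s1|exact: s2].
- by move=> A B AB [l h s]; exists l => //; exact: subset_trans AB.
Qed.

Lemma hat_nbhs_hat_at nu n k :
  (fun mu : radon R => (\int[mu]_x hat_at n k x)%R) @ hat_nbhs nu -->
  (\int[nu]_x hat_at n k x)%R.
Proof.
apply/cvgrPdist_lt => e e0.
set a := (\int[nu]_x _)%R.
have [r /[!in_itv]/= /andP[r1 r2]] : exists r, ratr r \in `]a - e, a[.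
  by apply: rat_in_itvoo; rewrite ltrBlDr ltrDl.
have [s /[!in_itv]/= /andP[s1 s2]] : exists r, ratr r \in `]a, a + e[.
  by apply: rat_in_itvoo; rewrite ltrDl.
exists [:: ((n, k), (r, s))]; first by rewrite /hat_box/= r2 s1.
move=> mu /=; rewrite /hat_box/= andbT => /andP[ra sa].
rewrite ltr_norml; lra.
Qed.

Lemma hat_nbhs_interp nu f m n :
  (fun mu : radon R => (\int[mu]_x interp f m n x)%R) @ hat_nbhs nu -->
  (\int[nu]_x interp f m n x)%R.
Proof.
under eq_fun do rewrite integral_interp.
rewrite integral_interp; apply: cvg_big => //.
  by move=> x; apply: cvgD; [exact: cvg_fst|exact: cvg_snd].
move=> i _; apply: cvgM; [exact: cvg_cst|exact: hat_nbhs_hat_at].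
Qed.

(** The vague topology is second countable: a test function is a uniform limit
    of its interpolations, whose integrals are finite combinations of integrals
    of hats, and the error is controlled by the mass of a fixed compact set,
    that is, by the integral of one more combination of hats. *)
Lemma hat_nbhs_cvg nu : hat_nbhs nu --> nu.
Proof.
apply: (@cvg_initial _ _ (@Cc_integral R)); apply: cvg_ptws => F.
have [M FM] := Cc_supported F; have cF : continuous (sval F) by case: F {FM} => ? [].
apply/cvgrPdist_lt => e e0; rewrite /Cc_integral/=.
have [m mP] := integral_interp_approx cF FM.
pose c := (\int[nu]_x interp (cst 1) m 0 x)%R.
have c0 : 0 <= c by apply: Rintegral_ge0 => x _; exact: interp1_ge0.
have d0 : 0 < e / (3 * (c + 1)) by rewrite divr_gt0// mulr_gt0// ltr_wpDl.
have [n nP] := mP _ d0.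
have e30 : 0 < e / 3 by rewrite divr_gt0.
have /cvgrPdist_lt/(_ 1 ltr01) H2 := @hat_nbhs_interp nu (cst 1) m 0.
have /cvgrPdist_lt/(_ _ e30) H1 := @hat_nbhs_interp nu (sval F) m n.
suff : hat_nbhs nu
  [set mu | `|(\int[nu]_x sval F x)%R - (\int[mu]_x sval F x)%R| < e] by [].
have := @filterI _ _ (hat_nbhs_filter nu) _ _ H2 H1.
apply: (@filterS _ _ (hat_nbhs_filter nu)) => mu /= [h2 h1].
rewrite /=; have dc : e / (3 * (c + 1)) * (c + 1) = e / 3.
  by field; rewrite gt_eqF// ltr_wpDl.
have n1 : `|(\int[nu]_x sval F x)%R - (\int[nu]_x interp (sval F) m n x)%R| <=
    e / 3.
  by rewrite (le_trans (nP nu))// -dc ler_pM2l// lerDl.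
have n2 : `|(\int[mu]_x sval F x)%R - (\int[mu]_x interp (sval F) m n x)%R| <=
    e / 3.
  rewrite (le_trans (nP mu))// -dc ler_pM2l//.
  have := ltW h2; rewrite distrC ler_norml => /andP[_].
  by rewrite lerBlDl addrC.
move: n1 n2 h1; set i1 := (\int[nu]_x sval F x)%R.
set i2 := (\int[mu]_x sval F x)%R.
set j1 := (\int[nu]_x interp _ _ _ _)%R; set j2 := (\int[mu]_x interp _ _ _ _)%R.
rewrite !ler_norml !ltr_norml => /andP[? ?] /andP[? ?] /andP[? ?].
by apply/andP; split; lra.
Qed.

Lemma hat_box_measurable d (X : measurableType d) (G : X -> radon R) l :
  (forall n k, measurable_fun [set: X] (fun x => (\int[G x]_y hat_at n k y)%R)) ->
  measurable (G @^-1` hat_box l).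
Proof.
move=> mG; elim: l => [|[[n k] [r s]] l ih].
  by rewrite (_ : _ @^-1` _ = setT)//; apply/seteqP.
rewrite (_ : _ @^-1` _ =
   (fun x => (\int[G x]_y hat_at n k y)%R) @^-1` `]ratr r, ratr s[ `&`
   G @^-1` hat_box l).
  by apply: measurableI => //; rewrite -[X in measurable X]setTI; exact: mG.
apply/seteqP; split => x /=; rewrite /hat_box/= in_itv/=.
  by move=> /andP[].
by move=> [-> ->].
Qed.

(** Countably many boxes form a basis, so that the Borel structure of the vague
    topology is generated by the integrals of the hats. *)
Lemma open_radon_measurable d (X : measurableType d) (G : X -> radon R)
    (U : set (radon R)) :
  (forall n k, measurable_fun [set: X] (fun x => (\int[G x]_y hat_at n k y)%R)) ->
  open U -> measurable (G @^-1` U).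
Proof.
move=> mG oU.
have -> : U = \bigcup_(l in [set l | hat_box l `<=` U]) hat_box l.
  apply/seteqP; split => [nu Unu|nu [l /= lU]]; last exact: lU.
  have /hat_nbhs_cvg : nbhs nu U by apply: open_nbhs_nbhs.
  by rewrite nbhs_filterE => -[l lnu lU]; exists l.
rewrite preimage_bigcup bigcup_mkcond.
apply: countable_bigcupT_measurable => // l.
by case: ifPn => // _; exact: hat_box_measurable.
Qed.

End vague.

(** * Measurability of the masses of Borel sets *)

Section mass_measurable.
Context {R : realType}.

(** A continuous approximation from below of the indicator of [`]x, y[]. *)
Definition tent (x y : R) (n : nat) (z : R) : R :=
  Num.min 1 (Num.max 0 (n%:R * Num.min (z - x) (y - z))).

Lemma continuous_tent x y n : continuous (tent x y n).
Proof.
have mx (f g : R -> R) : continuous f -> continuous g -> continuous (f \max g).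
  by move=> cf cg z; apply: (@continuous_max _ _ f g); [exact: cf|exact: cg].
have mn (f g : R -> R) : continuous f -> continuous g -> continuous (f \min g).
  by move=> cf cg z; apply: (@continuous_min _ _ f g); [exact: cf|exact: cg].
apply: (mn (cst 1) _ (@cst_continuous _ _ _)).
apply: (mx (cst 0) _ (@cst_continuous _ _ _)).
have h : continuous (fun z : R => Num.min (z - x) (y - z)).
  by apply: (mn (fun z : R => z - x) (fun z => y - z)) => z;
    apply: cvgB; by [exact: cvg_cst|exact: cvg_id].
by move=> z; apply: cvgM; [exact: cvg_cst|exact: h].
Qed.

Lemma tent_eq0 x y n z : z \notin `]x, y[ -> tent x y n z = 0.
Proof.
move=> zxy.
have h : Num.min (z - x) (y - z) <= 0.
  rewrite ge_min !subr_le0; move: zxy.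
  by rewrite in_itv/= negb_and -!leNgt.
by rewrite /tent (max_l (mulr_ge0_le0 (ler0n _ _) h)) min_r.
Qed.

Lemma tent_supported x y n : supported_in (`|x| + `|y|) (tent x y n).
Proof.
move=> z h; apply: tent_eq0; apply: contraTN h; rewrite in_itv/= => /andP[xz zy].
rewrite -leNgt ler_norml.
have := ler_norm (- x); have := ler_norm y; rewrite normrN.
have := normr_ge0 x; have := normr_ge0 y => ? ? ? ?.
by apply/andP; split; lra.
Qed.

Lemma tent_ge0 x y n z : 0 <= tent x y n z.
Proof. by rewrite /tent le_min ler01 le_max lexx. Qed.

Lemma cvg_tent x y z : (tent x y n z)%:E @[n --> \oo] --> (\1_`]x, y[%classic z)%:E.
Proof.
have [zxy|zxy] := boolP (z \in `]x, y[); last first.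
  rewrite indicE memNset/=; last by move=> h; rewrite h in zxy.
  by under eq_fun do rewrite tent_eq0//; exact: cvg_cst.
rewrite indicE mem_set//=.
have a0 : 0 < Num.min (z - x) (y - z).
  move: zxy; rewrite in_itv/= => /andP[xz zy].
  by rewrite lt_min !subr_gt0 xz.
apply: cvg_near_cst.
exists (Num.truncn (Num.min (z - x) (y - z))^-1).+1 => // n /= hn.
congr EFin; rewrite /tent min_l// le_max; apply/orP; right.
rewrite -ler_pdivrMr// mul1r.
by rewrite (le_trans (ltW (truncnS_gt _)))// ler_nat.
Qed.

Lemma radon_itv_tent (nu : radon R) x y :
  (\int[nu]_z tent x y n z)%:E @[n --> \oo] --> nu `]x, y[%classic.
Proof.
have it n : nu.-integrable [set: R] (EFin \o tent x y n).
  exact: integrable_Cc (@continuous_tent x y n) (@tent_supported x y n).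
rewrite (_ : (fun n => _) = (fun n => (\int[nu]_z (tent x y n z)%:E)%E)); last first.
  by apply/funext => n; rewrite /Rintegral fineK//; exact: integrable_fin_num (it n).
rewrite -[nu _](_ : (\int[nu]_z (\1_`]x, y[%classic z)%:E)%E = _); last first.
  by rewrite integral_indic// setIT.
have dom n z : (`|(tent x y n z)%:E| <= (\1_`]x, y[%classic z)%:E)%E.
  rewrite lee_fin ger0_norm ?tent_ge0// indicE.
  have [zxy|zxy] := boolP (z \in `]x, y[).
    by rewrite mem_set// /tent ge_min lexx.
  by rewrite tent_eq0// ler0n.
have m1 : measurable `]x, y[%classic by [].
apply: (@dominated_cvg _ _ _ nu setT _ (fun n z => (tent x y n z)%:E) _
  (fun z => (\1_`]x, y[%classic z)%:E)) => //.
- by move=> n; exact: measurable_int (it n).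
- by move=> z _; exact: cvg_tent.
- apply/integrableP; split; first exact/measurable_EFinP/measurable_indic.
  under eq_integral do rewrite gee0_abs ?lee_fin//.
  rewrite integral_indic// setIT.
  apply: le_lt_trans (radon_itv_fin nu x y); apply: le_measure; rewrite ?inE//.
  by apply: subset_itv_oo_cc.
Qed.

Lemma itv_oo_setI (x y x' y' : R) : `]x, y[%classic `&` `]x', y'[%classic =
  `]Num.max x x', Num.min y y'[%classic.
Proof.
apply/seteqP; split=> z; rewrite /= !in_itv/= gt_max lt_min.
  by move=> [/andP[-> ->] /andP[-> ->]].
by move=> /andP[/andP[-> ->] /andP[-> ->]].
Qed.

(** The sets whose mass is measurable form a Dynkin system containing the open
    intervals, once the masses are made finite by a cut-off to bounded
    intervals. *)
Lemma measurable_mass d (X : measurableType d) (l : X -> radon R) :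
  (forall x y, measurable_fun [set: X] (fun t => l t `]x, y[%classic : \bar R)) ->
  forall A, measurable A -> measurable_fun [set: X] (fun t => l t A : \bar R).
Proof.
move=> ml A mA; pose I n := `]- n%:R, n%:R[%classic : set R.
have mI n : measurable (I n) by exact: measurable_itv.
have Ifin t n B : measurable B -> (l t (B `&` I n) < +oo)%E.
  move=> mB; apply: le_lt_trans (radon_itv_fin (l t) (- n%:R) n%:R).
  apply: le_measure; rewrite ?inE//; first exact: measurableI.
  by move=> x [_]; apply: subset_itv_oo_cc.
have step n : measurable_fun [set: X] (fun t => l t (A `&` I n) : \bar R).
  have ME : (@measurable _ R : set (set R)) = <<s @RGenOpens.G R >>.
    exact: RGenOpens.measurableE.
  move: mA; rewrite ME.
  apply: (@dynkin_induction _ _ (@RGenOpens.G R)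
    (fun B => measurable_fun [set: X] (fun t => l t (B `&` I n) : \bar R))) => //.
  - by move=> _ _ [x [y ->]] [x' [y' ->]]; rewrite itv_oo_setI; eexists; eexists; reflexivity.
  - by rewrite setTI; exact: ml.
  - by move=> _ [x [y ->]]; under eq_fun do rewrite /I itv_oo_setI; exact: ml.
  - move=> S mS mlS.
    rewrite (_ : (fun t => _) = (fun t => l t (I n) - l t (S `&` I n))%E).
      by apply: emeasurable_funB => //; exact: ml.
    apply/funext => t; rewrite setIC -setDE measureD//; last first.
      by rewrite -[I n]setTI; exact: Ifin.
    by rewrite setIC.
  - move=> F mF tF mlF.
    rewrite (_ : (fun t => _) =
       (fun t => \sum_(k <oo | k \in xpredT) l t (F k `&` I n))%E).
      by apply: ge0_emeasurable_sum => // k _; exact: mlF.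
    apply/funext => t; rewrite setI_bigcupl measure_bigcup//.
    + by apply: eq_eseriesl => k; rewrite in_setT.
    + by move=> k _; exact: measurableI.
    + exact: trivIset_setIr.
apply: (@emeasurable_fun_cvg _ _ _ _ (fun n t => l t (A `&` I n))) => // t _.
have IT : \bigcup_n I n = setT.
  apply/seteqP; split=> // x _; exists (Num.truncn `|x|).+1 => //.
  by rewrite /I/= in_itv/= -ltr_norml truncnS_gt.
have := @nondecreasing_cvg_mu _ _ _ (l t) (fun n => A `&` I n).
rewrite -setI_bigcupr IT setIT; apply => //.
- by move=> n; exact: measurableI.
- move=> m n mn; apply/subsetPset; apply: setIS => x; rewrite /I/= !in_itv/=.
  rewrite -!ltr_norml => /lt_le_trans; apply; by rewrite ler_nat.
Qed.

Lemma continuous_eval (I : Type) (T : topologicalType) (i : I) :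
  continuous (fun h : {ptws I -> T} => h i).
Proof.
move=> g; have /cvg_sup/(_ i) h : nbhs g --> g by exact: cvg_id.
apply: cvg_trans; last exact: (@initial_continuous _ _ (fun h : {ptws I -> T} => h i)).
move=> U; exact: h.
Qed.

Lemma continuous_Mstar_integral (f : Cc R) :
  continuous (fun nu : Mstar R => (\int[nu]_x sval f x)%R).
Proof.
move=> nu.
apply: (@continuous_comp (Mstar R) (radon R) R (@radon_of_Mstar R)
     (fun mu : radon R => (\int[mu]_x sval f x)%R)).
  exact: (@initial_continuous _ _ set_val).
apply: (@continuous_comp (radon R) {ptws Cc R -> R} R (@Cc_integral R) (fun h => h f)).
  exact: initial_continuous.
exact: continuous_eval.
Qed.

Lemma measurable_Mstar_integral (f : Cc R) :
  measurable_fun [set: borel (Mstar R)]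
    (fun nu : borel (Mstar R) => (\int[(nu : Mstar R)]_x sval f x)%R).
Proof.
apply: (measurability _ (RGenOpens.measurableE R)) => _ [_ [x [y ->]] <-].
rewrite setTI; apply: sub_sigma_algebra.
have /continuousP := @continuous_Mstar_integral f; apply.
exact: interval_open.
Qed.

Lemma Cc_of (M : R) (f : R -> R) : continuous f -> supported_in M f ->
  exists F : Cc R, sval F = f.
Proof.
move=> cf f0.
have h : continuous f /\ compact (closure [set x | f x != 0]).
  split => //; have cI : compact `[- M, M]%classic by exact: segment_compact.
  apply: (subclosed_compact _ cI); first exact: closed_closure.
  apply: (@subset_trans _ (closure `[- M, M]%classic)).
    apply: closureS => x /= fx; rewrite in_itv/= -ler_norml leNgt.
    by apply: contra fx => /f0 ->.
  by rewrite -(closure_id _).1//; exact: interval_closed.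
by exists (exist _ f h).
Qed.

Lemma measurable_Mstar_mass (A : set R) : measurable A ->
  measurable_fun [set: borel (Mstar R)]
    (fun nu : borel (Mstar R) => (nu : Mstar R) A : \bar R).
Proof.
apply: measurable_mass => x y.
apply: (@emeasurable_fun_cvg _ _ _ _
  (fun n (nu : borel (Mstar R)) => (\int[(nu : Mstar R)]_z tent x y n z)%:E)).
  move=> n; apply/measurable_EFinP.
  have [F <-] := Cc_of (@continuous_tent x y n) (@tent_supported x y n).
  exact: measurable_Mstar_integral.
by move=> nu _; exact: radon_itv_tent.
Qed.

End mass_measurable.

(** * Parametrized integrals against locally finite measures *)

Section kernel.
Context {R : realType}.
Local Open Scope ereal_scope.

Lemma ge0_integral_mrestr d (T : measurableType d)
    (m : {measure set T -> \bar R}) (D : set T) (mD : measurable D)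
    (f : T -> \bar R) : measurable_fun setT f -> (forall x, 0 <= f x) ->
  \int[mrestr m mD]_x f x = \int[m]_(x in D) f x.
Proof.
move=> mf f0.
rewrite -(setUv D) ge0_integral_setU//; first last.
- by rewrite disj_set2E setICr.
- by rewrite setUv.
- exact: measurableC.
rewrite [X in _ + X]null_set_integral; first last.
- by rewrite -[LHS]/(m (~` D `&` D)) setICl measure0.
- exact: measurable_funTS.
- exact: measurableC.
rewrite adde0; apply: eq_measure_integral => A mA AD.
by rewrite -[LHS]/(m (A `&` D)) setIidl.
Qed.

Lemma measurable_inv_ge0 d (T : measurableType d) (f : T -> R) :
  (forall x, 0 <= f x)%R -> measurable_fun setT f ->
  measurable_fun setT (fun x => (f x)^-1%R).
Proof.
move=> f0 mf; under eq_fun do rewrite -powR_inv1//.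
exact: measurableT_comp (@measurable_powR _ _) mf.
Qed.

Section locally_finite.
Context d (X : measurableType d) (l : X -> {measure set R -> \bar R}).
Hypothesis ml : forall U, measurable U -> measurable_fun [set: X] (fun x => l x U : \bar R).
Hypothesis lfin : forall x (n : nat), l x `[(- n%:R)%R, n%:R]%classic < +oo.

Let I (n : nat) : set R := `[(- n%:R)%R, n%:R]%classic.
Let F := seqDU I.

Let mF n : measurable (F n).
Proof.
apply: measurableD; first exact: measurable_itv.
by apply: bigsetU_measurable => k _; exact: measurable_itv.
Qed.

Let lF x n : l x (F n) < +oo.
Proof.
apply: le_lt_trans (lfin x n); apply: le_measure; rewrite ?inE//.
by move=> y [].
Qed.

Let FT : \bigcup_n F n = setT.
Proof.
rewrite -seqDU_bigcup_eq; apply/seteqP; split=> // x _.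
exists (Num.truncn `|x|%R).+1 => //.
by rewrite /I/= in_itv/= -ler_norml ltW// truncnS_gt.
Qed.

(* Rescaling makes the restriction to a bounded cell a uniformly bounded
   kernel. *)
Let c n x : R := (1 + fine (l x (F n)))^-1%R.

Let c_gt0 n x : (0 < c n x)%R.
Proof. by rewrite invr_gt0 ltr_pwDl// fine_ge0. Qed.

Let mc n : measurable_fun setT (c n).
Proof.
apply: measurable_inv_ge0; first by move=> x; rewrite addr_ge0// fine_ge0.
apply: (@measurable_realfun.measurable_funD _ _ _ setT (cst 1%R)) => //.
by apply: (measurableT_comp (f := @fine R)) => //; exact: ml.
Qed.

Let kern n x : {measure set R -> \bar R} :=
  mscale (NngNum (ltW (c_gt0 n x))) (mrestr (l x) (mF n)).

Let kernE n x U : kern n x U = (c n x)%:E * l x (U `&` F n).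
Proof. by []. Qed.

Let measurable_kern n U : measurable U ->
  measurable_fun [set: X] (kern n ^~ U).
Proof.
move=> mU; under eq_fun do rewrite kernE; apply: emeasurable_funM.
  by apply/measurable_EFinP; exact: mc.
by apply: ml; exact: measurableI.
Qed.

Let kern_uub n : measure_fam_uub (kern n).
Proof.
exists 1%R => x; rewrite kernE setTI.
rewrite -[l x _]fineK ?ge0_fin_numE// -EFinM lte_fin /c mulrC ltr_pdivrMr.
  by rewrite mul1r ltrDr.
by rewrite ltr_pwDl// fine_ge0.
Qed.

Let measurable_integral_kern n (k : X * R -> \bar R) :
  (forall z, 0 <= k z) -> measurable_fun setT k ->
  measurable_fun [set: X] (fun x => \int[kern n x]_y k (x, y)).
Proof.
pose i1 := isKernel.Build _ _ X _ R (kern n) (@measurable_kern n).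
pose K1 : R.-ker X ~> R := HB.pack (kern n) i1.
pose i2 := Kernel_isFinite.Build _ _ X _ R (K1 : X -> _) (kern_uub n).
pose K2 : R.-fker X ~> R := HB.pack (K1 : X -> _) i1 i2.
move=> k0 mk; have := @measurable_fun_integral_finite_kernel _ _ X R R k K2 k0 mk. exact.
Qed.

(** The measurability of parametrized integrals is known for finite kernels;
    a locally finite family is a countable sum of rescaled finite ones. *)
Lemma measurable_fun_integral_locally_finite (k : X * R -> \bar R) :
  (forall z, 0 <= k z) -> measurable_fun setT k ->
  measurable_fun [set: X] (fun x => \int[l x]_y k (x, y)).
Proof.
move=> k0 mk.
have mkx x : measurable_fun setT (fun y => k (x, y)).
  exact: measurableT_comp mk (pair1_measurable _).
rewrite (_ : (fun x => _) = (fun x => \sum_(n <oo | n \in xpredT)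
    (((c n x)^-1)%:E * \int[kern n x]_y k (x, y)))); last first.
  apply/funext => x; rewrite -FT ge0_integral_bigcup//; last 2 first.
  - exact: measurable_funTS.
  - exact: trivIset_seqDU.
  apply: eq_eseriesr => n _.
  rewrite FT ge0_integral_mscale// ge0_integral_mrestr//= muleA -EFinM.
  by rewrite mulVf ?mul1e// gt_eqF.
apply: ge0_emeasurable_sum => n *.
  rewrite mule_ge0//; first by rewrite lee_fin invr_ge0 ltW.
  by apply: integral_ge0.
apply: emeasurable_funM.
  by apply/measurable_EFinP; apply: measurable_inv_ge0 => [x|]; [exact: ltW|exact: mc].
exact: measurable_integral_kern.
Qed.

End locally_finite.

End kernel.

(** * Normalization and affine maps *)

Section radon_algebra.
Context {R : realType}.
Implicit Types (nu mu : radon R) (A : set R).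
Local Open Scope ereal_scope.

Lemma leastP (P : set nat) n : least P = Some n <->
  P n /\ forall m, P m -> (n <= m)%N.
Proof.
rewrite /least; case: pselect => [ex|nex]; last first.
  by split=> // -[Pn _]; exfalso; apply: nex; exists n; apply/asboolP.
case: ex_minnP => m /asboolP Pm mmin; split=> [[<-]|[Pn nmin]].
  by split=> // k Pk; apply: mmin; apply/asboolP.
congr Some; apply/eqP; rewrite eqn_leq nmin// mmin//; exact/asboolP.
Qed.

Lemma least_None (P : set nat) : least P = None <-> forall n, ~ P n.
Proof.
rewrite /least; case: pselect => [ex|nex].
  by split=> // h; exfalso; case: ex => n /asboolP; exact: h.
by split=> // _ n Pn; apply: nex; exists n; apply/asboolP.
Qed.

Lemma radon_itv_fin_num nu b1 b2 (x y : R) :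
  nu [set` Interval (BSide b1 x) (BSide b2 y)] \is a fin_num.
Proof.
rewrite ge0_fin_numE//; apply: le_lt_trans (radon_itv_fin nu x y).
apply: le_measure; rewrite ?inE; [exact: measurable_itv|exact: measurable_itv|].
move=> z; rewrite /= !in_itv/= => /andP[].
by case: b1; case: b2 => /=; do ?[move=> ->|move=> /ltW ->].
Qed.

Lemma measurable_norm_itv n : measurable (norm_itv n : set R).
Proof. exact: measurable_itv. Qed.

Lemma psi_None nu : psi nu = None -> forall A, measurable A -> nu A = 0.
Proof.
move=> /least_None h A mA.
have h0 n : (0 < n)%N -> nu (norm_itv n) = 0.
  move=> n0; apply/eqP; rewrite eq_le measure_ge0 andbT leNgt.
  by apply/negP => p; exact: (h n).
suff : nu.-negligible A by move=> /(negligibleP _ mA).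
apply: (@negligibleS _ _ _ _ (\bigcup_n norm_itv n.+1)); last first.
  apply: negligible_bigcup => n; apply/negligibleP; last exact: h0.
  exact: measurable_norm_itv.
move=> x _; exists (Num.truncn `|x|%R).+1 => //=.
rewrite /norm_itv/= in_itv/=.
have := truncnS_gt `|x|%R => xn.
have xn1 : (`|x| < (Num.truncn `|x|).+2%:R - 1)%R.
  by rewrite -natr1 addrK.
have := ler_norm x; have := ler_norm (- x)%R; rewrite normrN => h1 h2.
apply/andP; split; last lra.
move: xn; lra.
Qed.

Lemma normalize_psi nu A : measurable A -> normalize nu A =
  if psi nu is Some n then ((fine (nu (norm_itv n)))^-1)%:E * nu A else 0.
Proof.
move=> mA; rewrite /normalize; case: (psi nu) => [n|].
  by rewrite /radon_scale radon_ofE.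
by rewrite /radon0 radon_ofE.
Qed.

(** This weak form of normalization is enough to compose normalized maps: the
    constants never need to be computed. *)
Lemma normalizeE nu : exists2 c : R, (0 < c)%R &
  forall A, measurable A -> normalize nu A = c%:E * nu A.
Proof.
rewrite /normalize; case psin: (psi nu) => [n|]; last first.
  exists 1%R => // A mA; rewrite (psi_None psin)// mule0.
  by rewrite /radon0 radon_ofE.
have [[n0 nun] _] := (leastP _ _).1 psin.
exists ((fine (nu (norm_itv n)))^-1)%R.
  rewrite invr_gt0 fine_gt0// nun/= -ge0_fin_numE//; exact: radon_itv_fin_num.
by move=> A mA; rewrite /radon_scale radon_ofE.
Qed.

Lemma psi_scale mu nu (c : R) : (0 < c)%R ->
  (forall A, measurable A -> mu A = c%:E * nu A) -> psi mu = psi nu.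
Proof.
move=> c0 h; rewrite /psi; congr least; apply/funext => n /=.
by rewrite h ?pmule_rgt0//; exact: measurable_norm_itv.
Qed.

Lemma normalize_scale mu nu (c : R) : (0 < c)%R ->
  (forall A, measurable A -> mu A = c%:E * nu A) -> normalize mu = normalize nu.
Proof.
move=> c0 h; have psiE := psi_scale c0 h.
rewrite /normalize psiE; case psin: (psi nu) => [n|//].
have [[n0 nun] _] := (leastP _ _).1 psin.
have nfin : nu (norm_itv n) \is a fin_num by exact: radon_itv_fin_num.
apply: radon_ext => A mA; rewrite /radon_scale !radon_ofE//.
rewrite -[LHS]/(((fine (mu (norm_itv n)))^-1)%:E * mu A).
rewrite -[RHS]/(((fine (nu (norm_itv n)))^-1)%:E * nu A).
rewrite (h A mA) (h (norm_itv n)); last exact: measurable_norm_itv.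
rewrite fineM// invfM muleA -!EFinM.
by congr (_%:E * _); rewrite mulrAC mulVf ?mul1r// gt_eqF.
Qed.

Lemma normalize_unit nu A : 0 < nu `[0%R, 1%R[%classic -> measurable A ->
  normalize nu A = ((fine (nu `[0%R, 1%R[%classic))^-1)%:E * nu A.
Proof.
move=> nu0 mA; rewrite /normalize.
have I1 : norm_itv 1 = `[(0 : R)%R, 1%R[%classic by rewrite /norm_itv/= oppr0.
have -> : psi nu = Some 1%N.
  by apply/leastP; rewrite /= I1; split => // m [].
by rewrite /radon_scale radon_ofE//= /mscale/= I1.
Qed.

Lemma NstarE nu : radon_of_Mstar (Nstar nu) = normalize nu.
Proof. by []. Qed.

Lemma Mstar_inj (x y : Mstar R) : radon_of_Mstar x = radon_of_Mstar y -> x = y.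
Proof. exact: val_inj. Qed.

Lemma Nstar_scale mu nu (c : R) : (0 < c)%R ->
  (forall A, measurable A -> mu A = c%:E * nu A) -> Nstar mu = Nstar nu.
Proof. by move=> c0 h; apply: Mstar_inj; exact: normalize_scale c0 h. Qed.

Lemma Mstar_normalize (x : Mstar R) : normalize x = x.
Proof.
case: x => m mP; rewrite /radon_of_Mstar/=; move: (mP); rewrite inE => -[nu _ <-].
have [c c0 h] := normalizeE nu; exact: normalize_scale c0 h.
Qed.

Lemma Nstar_id (x : Mstar R) : Nstar x = x.
Proof. by apply: Mstar_inj; rewrite NstarE Mstar_normalize. Qed.

(** The normalizing window is [[0, 1[] as soon as it is charged. *)
Lemma Mstar_unit (x : Mstar R) :
  x `[0%R, 1%R[%classic = 0 \/ x `[0%R, 1%R[%classic = 1.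
Proof.
have [x0|x0] := eqVneq (x `[0%R, 1%R[%classic) 0; [by left|right].
have xp : 0 < x `[0%R, 1%R[%classic by rewrite lt0e x0 measure_ge0.
have xf : x `[0%R, 1%R[%classic \is a fin_num by exact: radon_itv_fin_num.
have := normalize_unit xp (measurable_itv `[0%R, 1%R[); rewrite Mstar_normalize => ->.
rewrite -{2}(fineK xf) -EFinM mulVf// gt_eqF// fine_gt0// xp/= -ge0_fin_numE//.
Qed.

Lemma radon_affineE (a b : R) (a0 : a != 0%R) nu A : measurable A ->
  radon_affine b a0 nu A = nu (affine a b @^-1` A).
Proof. by move=> mA; rewrite /radon_affine radon_ofE. Qed.

Lemma measurable_affine (a b : R) A : measurable A ->
  measurable (affine a b @^-1` A).
Proof.
move=> mA; rewrite -[X in measurable X]setTI.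
have : measurable_fun setT (affine a b).
  by apply: measurable_realfun.continuous_measurable_fun; exact: continuous_affine.
exact.
Qed.

(** Both [tstar] and the first component of [Mp] are normalized images under
    affine maps; [zoom] treats them together, and [zoom_comp] gives at once all
    the composition laws between translations and magnifications. *)
Definition zoom (a b : R) (a0 : a != 0%R) (x : Mstar R) : Mstar R :=
  Nstar (radon_affine b a0 x).

Lemma zoom_comp (a b c d : R) (a0 : a != 0%R) (c0 : c != 0%R)
    (ac0 : (a * c)%R != 0%R) (x : Mstar R) :
  zoom b a0 (zoom d c0 x) = zoom (a * d + b)%R ac0 x.
Proof.
rewrite /zoom; have [k k0 h] := normalizeE (radon_affine d c0 x).
apply: (Nstar_scale k0) => A mA.
rewrite !radon_affineE// NstarE h; last exact: measurable_affine.
rewrite radon_affineE; last exact: measurable_affine.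
congr (_ * x _); apply/funext => z; rewrite /preimage/= /affine.
by congr A; ring.
Qed.

Lemma zoom_eq (a b a' b' : R) (a0 : a != 0%R) (a0' : a' != 0%R) (x : Mstar R) :
  a = a' -> b = b' -> zoom b a0 x = zoom b' a0' x.
Proof. by move=> aa <-; move: a0 a0'; rewrite aa => h1 h2; rewrite (Prop_irrelevance h1 h2). Qed.

Lemma zoom_id (x : Mstar R) (a0 : (1 : R)%R != 0%R) : zoom 0 a0 x = x.
Proof.
rewrite -[RHS]Nstar_id; apply: (@Nstar_scale _ _ 1) => // A mA.
rewrite mul1e radon_affineE//; congr (x _).
by apply/funext => z; rewrite /preimage/= /affine mul1r addr0.
Qed.

Lemma preimage_affine_itv (a b u v : R) : (0 < a)%R ->
  affine a b @^-1` `[u, v[%classic = `[((u - b) / a)%R, ((v - b) / a)%R[%classic.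
Proof.
move=> a0; apply/seteqP; split=> x; rewrite /preimage/= !in_itv/= /affine;
  by rewrite ler_pdivrMr// ltr_pdivlMr// [(x * a)%R]mulrC lerBlDr ltrBrDr.
Qed.

Lemma zoomE (a b : R) (a0 : a != 0%R) (x : Mstar R) A : (0 < a)%R ->
  measurable A ->
  0 < x `[(- b / a)%R, ((1 - b) / a)%R[%classic ->
  zoom b a0 x A =
  ((fine (x `[(- b / a)%R, ((1 - b) / a)%R[%classic))^-1)%:E *
   x (affine a b @^-1` A).
Proof.
move=> ap mA x0; have E : radon_affine b a0 x `[0%R, 1%R[%classic =
    x `[(- b / a)%R, ((1 - b) / a)%R[%classic.
  rewrite radon_affineE; last exact: measurable_itv.
  by rewrite preimage_affine_itv// sub0r.
by rewrite /zoom NstarE normalize_unit ?E// radon_affineE.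
Qed.

Lemma tstarE (t : R) (x : Mstar R) : tstar t x = zoom (- t) (oner_neq0 R) x.
Proof. by []. Qed.

End radon_algebra.

(** * Measurable maps into the space of normalized measures *)

Section measurable_maps.
Context {R : realType}.

Lemma measurable_glue d d' (X : measurableType d) (Y : measurableType d')
    (I : countType) (idx : X -> I) (g : I -> X -> Y) :
  (forall k, measurable (idx @^-1` [set k])) ->
  (forall k, measurable_fun [set: X] (g k)) ->
  measurable_fun [set: X] (fun x => g (idx x) x).
Proof.
move=> midx mg _ B mB; rewrite setTI.
rewrite (_ : _ @^-1` _ = \bigcup_k (idx @^-1` [set k] `&` g k @^-1` B)); last first.
  by apply/seteqP; split => [x ?|x [k _ [<-]]//]; exists (idx x).
apply: countable_bigcupT_measurable => // k; apply: measurableI => //.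
by rewrite -[X in measurable X]setTI; exact: mg.
Qed.

Lemma measurable_least d (X : measurableType d) (P : X -> set nat) :
  (forall n, measurable [set x | P x n]) ->
  forall o, measurable [set x | least (P x) = o].
Proof.
move=> mP [n|].
  rewrite (_ : [set x | _] = [set x | P x n] `&`
      \bigcap_m (if (n <= m)%N then setT else ~` [set x | P x m])).
    apply: measurableI => //; apply: bigcapT_measurable => m.
    by case: ifP => // _; exact: measurableC.
  apply/seteqP; split => x /=.
    by move=> /leastP[Px minx]; split => // m _; case: ifPn => // /negP nm /minx.
  move=> [Px h]; apply/leastP; split => // m Pm.
  by have := h m Logic.I; case: ifPn.
rewrite (_ : [set x | _] = \bigcap_m (~` [set x | P x m])).
  by apply: bigcapT_measurable => m; exact: measurableC.
apply/seteqP; split => x /=; first by move=> /least_None h m _; exact: h.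
by move=> h; apply/least_None => n; exact: (h n).
Qed.

(** The converse of [measurable_Mstar_mass]: the masses of the Borel sets
    determine the integrals of the hats, which generate the Borel structure. *)
Lemma measurable_to_Mstar d (X : measurableType d) (G : X -> Mstar R) :
  (forall A, measurable A -> measurable_fun [set: X] (fun t => G t A : \bar R)) ->
  measurable_fun [set: X] (G : X -> borel (Mstar R)).
Proof.
move=> mG.
apply: (@measurability _ _ X (borel (Mstar R)) _ _ (@open (Mstar R))).
  by [].
move=> _ [B [W oW <-] <-]; rewrite setTI.
apply: (@open_radon_measurable R d X (fun t => radon_of_Mstar (G t)) W) => // n k.
apply: (measurableT_comp (f := @fine R)); first by [].
apply: (@measurable_fun_integral_kernel _ _ X R R
  (fun t => radon_measure (radon_of_Mstar (G t))) mG
  (fun y => (hat_at n k y)%:E)) => [z|].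
  by rewrite lee_fin; exact: hat_ge0.
apply/measurable_EFinP.
exact: (measurable_realfun.continuous_measurable_fun (@continuous_hat_at R n k)).
Qed.

(** Normalization is not continuous, but it divides by a mass in a window which
    takes countably many values. *)
Lemma measurable_Nstar d (X : measurableType d) (G : X -> radon R) :
  (forall A, measurable A -> measurable_fun [set: X] (fun t => G t A : \bar R)) ->
  measurable_fun [set: X] (fun t => Nstar (G t) : borel (Mstar R)).
Proof.
move=> mG; apply: measurable_to_Mstar => A mA.
pose g (o : option nat) (t : X) : \bar R := if o is Some n then
  (((fine (G t (norm_itv n)))^-1)%:E * G t A)%E else 0%E.
rewrite (_ : (fun t => _) = (fun t => g (psi (G t)) t)); last first.
  by apply/funext => t; rewrite NstarE normalize_psi.
apply: (@measurable_glue _ _ X _ _ (fun t => psi (G t)) g).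
  move=> o; apply: measurable_least => n /=.
  case: (ltnP 0 n) => [n0|]; last first.
    rewrite leqn0 => /eqP ->; rewrite (_ : [set x | _] = set0)//.
    by apply/seteqP; split=> // x [].
  rewrite (_ : [set x | _] =
      (fun t => G t (norm_itv n) : \bar R) @^-1` `]0%E, +oo[).
    by rewrite -[X in measurable X]setTI; apply: mG => //;
      [exact: measurable_norm_itv|exact: emeasurable_itv].
  apply/seteqP; split => t /=; rewrite in_itv/= andbT; [by move=> []|by []].
case=> [n|]; last exact: measurable_cst.
apply: emeasurable_funM; last exact: mG.
apply/measurable_EFinP/measurable_inv_ge0; first by move=> x; rewrite fine_ge0.
apply: (measurableT_comp (f := @fine R)) => //; apply: mG; exact: measurable_norm_itv.
Qed.

Lemma measurable_zoom (a b : R) (a0 : a != 0) :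
  measurable_fun [set: borel (Mstar R)] (zoom b a0 : borel (Mstar R) -> borel (Mstar R)).
Proof.
apply: measurable_Nstar => A mA; under eq_fun do rewrite radon_affineE//.
by apply: measurable_Mstar_mass; exact: measurable_affine.
Qed.

Lemma measurable_tstar2 d (X : measurableType d) (u : X -> R)
    (v : X -> borel (Mstar R)) :
  measurable_fun setT u -> measurable_fun setT v ->
  measurable_fun [set: X] (fun z => tstar (u z) (v z) : borel (Mstar R)).
Proof.
move=> mu mv; apply: measurable_Nstar => A mA.
rewrite (_ : (fun t => _) = (fun t => \int[v t : Mstar R]_y
    (fun z => (\1_A (affine 1 (- u z.1) z.2))%:E) (t, y))%E); last first.
  apply/funext => t /=; rewrite /translate radon_affineE//.
  rewrite -[RHS]/(\int[v t : Mstar R]_y (\1_(affine 1 (- u t) @^-1` A) y)%:E)%E.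
  by rewrite integral_indic ?setIT//; exact: measurable_affine.
have mvU U : measurable U -> measurable_fun setT (fun t => (v t : Mstar R) U : \bar R).
  by move=> mU; exact: (measurableT_comp (measurable_Mstar_mass mU) mv).
apply: (@measurable_fun_integral_locally_finite R _ X
  (fun t => radon_measure (radon_of_Mstar (v t))) mvU
  (fun x n => radon_itv_fin _ _ _)
  (fun z => (\1_A (affine 1 (- u z.1) z.2))%:E)).
- by move=> z; rewrite lee_fin.
- apply/measurable_EFinP.
  apply: (measurableT_comp (f := \1_A : R -> R)); first exact: measurable_indic.
  rewrite /affine; apply: measurable_realfun.measurable_funD.
    apply: measurable_realfun.measurable_funM => //; exact: measurable_snd.
  apply: (measurableT_comp (f := -%R : R -> R)); first exact: oppr_measurable.
  by apply: (measurableT_comp (f := u)) => //; exact: measurable_fst.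
Qed.

Lemma measurable_tstar (t : R) :
  measurable_fun [set: borel (Mstar R)] (tstar t : borel (Mstar R) -> borel (Mstar R)).
Proof. exact: measurable_zoom. Qed.

Lemma measurable_tstar_l (x : Mstar R) :
  measurable_fun [set: R] (fun t => tstar t x : borel (Mstar R)).
Proof. exact: (@measurable_tstar2 _ R id (cst x)). Qed.

(** Fubini's measurability statement for the kernel that sends a normalized
    measure to itself, hence the need for locally finite kernels. *)
Lemma measurable_integral_tstar (I : set R) (g : borel (Mstar R) -> R) :
  measurable I -> measurable_fun setT g ->
  measurable_fun [set: borel (Mstar R)]
    (fun nu : borel (Mstar R) => (\int[nu : Mstar R]_(x in I) g (tstar x nu))%R).
Proof.
move=> mI mg; apply: (measurableT_comp (f := @fine R)) => //.
under eq_fun do rewrite integralE.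
have pn (h : borel (Mstar R) -> \bar R) : measurable_fun setT h ->
    (forall x, 0 <= h x)%E ->
    measurable_fun [set: borel (Mstar R)]
    (fun nu : borel (Mstar R) => \int[nu : Mstar R]_(x in I) h (tstar x nu))%E.
  move=> mh h0; under eq_fun do rewrite integral_mkcond.
  rewrite (_ : (fun nu => _) = (fun nu : borel (Mstar R) => \int[nu : Mstar R]_y
    (fun z : borel (Mstar R) * R => h (tstar z.2 z.1) * (\1_I z.2)%:E) (nu, y))%E).
    apply: (@measurable_fun_integral_locally_finite R _ (borel (Mstar R))
      (fun t => radon_measure (radon_of_Mstar t)) (fun U mU => measurable_Mstar_mass mU)
      (fun x n => radon_itv_fin _ _ _)
      (fun z : borel (Mstar R) * R => h (tstar z.2 z.1) * (\1_I z.2)%:E)%E).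
    - by move=> z; rewrite mule_ge0// lee_fin.
    - apply: emeasurable_funM.
        apply: (measurableT_comp mh).
        by apply: measurable_tstar2; [exact: measurable_snd|exact: measurable_fst].
      apply/measurable_EFinP.
      apply: (measurableT_comp (f := \1_I : R -> R)); last exact: measurable_snd.
      exact: measurable_indic.
  apply/funext => nu; apply: eq_integral => y _ /=; rewrite patchE indicE.
  by case: ifP => yI; rewrite ?mule1 ?mule0.
apply: emeasurable_funB.
  have mp : measurable_fun setT ((EFin \o g)^\+)%E.
    by apply: measurable_funepos; exact/measurable_EFinP.
  have p0 x : (0 <= ((EFin \o g)^\+) x)%E by exact: funepos_ge0.
  rewrite (_ : (fun x => _) = (fun nu : borel (Mstar R) =>
      \int[nu : Mstar R]_(x in I) ((EFin \o g)^\+) (tstar x nu))%E).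
    exact: pn.
  by apply/funext => nu; apply: eq_integral => y _; rewrite !funeposE.
have mn : measurable_fun setT ((EFin \o g)^\-)%E.
  by apply: measurable_funeneg; exact/measurable_EFinP.
have n0 x : (0 <= ((EFin \o g)^\-) x)%E by exact: funeneg_ge0.
rewrite (_ : (fun x => _) = (fun nu : borel (Mstar R) =>
    \int[nu : Mstar R]_(x in I) ((EFin \o g)^\-) (tstar x nu))%E).
  exact: pn.
by apply/funext => nu; apply: eq_integral => y _; rewrite !funenegE.
Qed.

End measurable_maps.

(** * Conditional expectations and densities *)

Section cond_exp_exists.
Context d (T : measurableType d) (R : realType) (P : probability T R).
Variable G : set_system T.
Hypotheses (sG : sigma_algebra setT G) (Gm : forall A, G A -> measurable A).

Local Notation S := (g_sigma_algebraType G).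

Let measurableS A : @measurable _ S A -> G A.
Proof.
move=> mA; rewrite -(sigma_algebra_id sG); exact: mA.
Qed.

Let sub_id : T -> S := id.

Let measurable_sub_id : measurable_fun setT sub_id.
Proof. by move=> _ A mA; rewrite setTI; apply: Gm; exact: measurableS. Qed.

HB.instance Definition _ := isMeasurableFun.Build _ _ T S sub_id measurable_sub_id.

(** Radon and Nikodym on the smaller sigma-algebra: the conditional expectation
    is the density of the charge [A |-> int_A f]. *)
Lemma cond_exp_exists (f : T -> R) : P.-integrable setT (EFin \o f) ->
  exists h, is_cond_exp P G f h.
Proof.
move=> intf; pose mu : probability S R := distribution P sub_id.
pose nu0 : {charge set T -> \bar R} := induced_charge intf.
pose nuS : set S -> \bar R := nu0.
have h0 : nuS set0 = 0%E by rewrite /nuS charge0.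
have hfin : fin_num_fun nuS.
  by move=> A mA; apply: (@fin_num_measure _ _ _ nu0); apply: Gm; exact: measurableS.
have hsa : semi_sigma_additive nuS.
  move=> F mF tF mUF; apply: (@charge_semi_sigma_additive _ _ _ nu0) => //.
  - by move=> n; apply: Gm; exact: measurableS.
  - by apply: Gm; exact: measurableS.
pose nu : {charge set S -> \bar R} :=
  HB.pack nuS (isCharge.Build _ _ _ nuS h0 hfin hsa).
have nu_mu : nu `<< mu.
  apply/null_content_dominatesP => A mA muA0.
  have mA' : measurable (A : set T) by apply: Gm; exact: measurableS.
  rewrite -[LHS]/(\int[P]_(x in A) (f x)%:E)%E null_set_integral//.
  by apply: measurable_funTS; exact: measurable_int intf.
have [h [hf hi hE]] : exists h : S -> \bar R, [/\ (forall x, h x \is a fin_num),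
    mu.-integrable [set: S] h &
    forall A, measurable A -> nu A = (\int[mu]_(x in A) h x)%E].
  exists (Radon_Nikodym nu mu); split.
  - by move=> x; exact: Radon_Nikodym_fin_num.
  - exact: Radon_Nikodym_integrable.
  - by move=> A mA; exact: Radon_Nikodym_integral.
have mh : measurable_fun [set: S] h by exact: measurable_int hi.
have fE : EFin \o (fine \o h) = h :> (S -> \bar R).
  by apply/funext => x; rewrite /= fineK.
have hP : P.-integrable setT (h : T -> \bar R).
  apply/integrableP; split.
    exact: (measurableT_comp mh measurable_sub_id).
  move: hi => /integrableP[_]; rewrite ge0_integral_pushforward//.
  exact: measurableT_comp.
exists (fine \o h); split.
- move=> B mB; apply: measurableS; rewrite -[X in measurable X]setTI.
  exact: (measurableT_comp (f := @fine R)).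
- by rewrite fE.
- move=> A GA; rewrite /Rintegral; congr fine.
  have mA : @measurable _ S A by exact: sub_sigma_algebra.
  rewrite -[RHS]/(nu A) hE// (integral_pushforward measurable_sub_id)//.
  + by apply: eq_integral => x _; rewrite -[in RHS]fE.
  + by rewrite preimage_id; apply: (integrableS measurableT) => //; exact: Gm.
Qed.

Lemma cond_expP (f : T -> R) : P.-integrable setT (EFin \o f) ->
  is_cond_exp P G f (cond_exp P G f).
Proof. by move=> /cond_exp_exists /cid; rewrite /cond_exp => -[h hP]; exact: (xgetI _ hP). Qed.

End cond_exp_exists.

Section density.
Context d (T : measurableType d) (R : realType).
Local Open Scope ereal_scope.

Import HBNNSimple.

(** By approximation with simple functions and monotone convergence. *)
Lemma ge0_integral_density (m1 m2 : {measure set T -> \bar R}) (g : T -> \bar R)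
    (f : T -> \bar R) :
  measurable_fun setT g -> (forall x, 0 <= g x) -> (forall x, g x \is a fin_num) ->
  measurable_fun setT f -> (forall x, 0 <= f x) ->
  (forall A, measurable A -> m1 A = \int[m2]_(x in A) g x) ->
  \int[m1]_x f x = \int[m2]_x (f x * g x).
Proof.
move=> mg g0 gfin mf f0 m12; pose f_ := nnsfun_approx measurableT mf.
have fcvg x : (f_ n x)%:E @[n --> \oo] --> f x by exact: cvg_nnsfun_approx.
have fnd x : {homo (fun n => f_ n x) : m n / (m <= n)%N >-> (m <= n)%R}.
  by move=> m n mn; exact/lefP/nd_nnsfun_approx.
have step n : \int[m1]_x (f_ n x)%:E = \int[m2]_x ((f_ n x)%:E * g x).
  have mind r : measurable (f_ n @^-1` [set r]) by [].
  under eq_integral do rewrite fimfunE -fsumEFin//.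
  rewrite ge0_integral_fsum//; last 2 first.
  - by move=> r; exact/measurable_EFinP/measurableT_comp.
  - by move=> r x _; rewrite EFinM nnfun_muleindic_ge0.
  transitivity (\int[m2]_x (\sum_(r \in range (f_ n))
      ((r * \1_(f_ n @^-1` [set r]) x)%:E * g x))); last first.
    apply: eq_integral => x _; rewrite -ge0_mule_fsuml => [|r]; last first.
      exact: nnfun_muleindic_ge0.
    by rewrite fsumEFin// -fimfunE.
  rewrite ge0_integral_fsum//; last 2 first.
  - move=> r; apply: emeasurable_funM => //.
    exact/measurable_EFinP/measurableT_comp.
  - by move=> r x _; rewrite mule_ge0// EFinM nnfun_muleindic_ge0.
  apply: eq_fsbigr => r _.
  have [r0|r0] := leP 0%R r; last first.
    rewrite !integral0_eq// => x _; rewrite preimage_nnfun0// indic0 mulr0//.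
    by rewrite mul0e.
  under eq_integral do rewrite EFinM.
  under [RHS]eq_integral do rewrite EFinM -muleA.
  have mi : measurable_fun setT (fun x => (\1_(f_ n @^-1` [set r]) x)%:E : \bar R).
    exact/measurable_EFinP/measurable_indic.
  rewrite !ge0_integralZl//; last 2 first.
  - exact: emeasurable_funM.
  - by move=> x _; rewrite mule_ge0// lee_fin.
  congr (_ * _); rewrite integral_indic// setIT m12// integral_mkcond.
  apply: eq_integral => x _; rewrite patchE indicE.
  by case: ifP => _; rewrite ?mul1e ?mul0e.
have l1 : \int[m1]_x (f_ n x)%:E @[n --> \oo] --> \int[m1]_x f x.
  rewrite (_ : \int[m1]_x f x = \int[m1]_x limn (fun n => (f_ n x)%:E)).
    apply: cvg_monotone_convergence => //.
    - by move=> n; exact/measurable_EFinP.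
    - by move=> n x _; rewrite lee_fin.
    - by move=> x _ m n mn; rewrite lee_fin; exact: fnd.
  by apply: eq_integral => x _; apply/esym/cvg_lim => //.
have l2 : \int[m2]_x ((f_ n x)%:E * g x) @[n --> \oo] --> \int[m2]_x (f x * g x).
  rewrite (_ : \int[m2]_x _ = \int[m2]_x limn (fun n => (f_ n x)%:E * g x)).
    apply: cvg_monotone_convergence => //.
    - by move=> n; apply: emeasurable_funM => //; exact/measurable_EFinP.
    - by move=> n x _; rewrite mule_ge0// lee_fin.
    - by move=> x _ m n mn; rewrite lee_wpmul2r// lee_fin; exact: fnd.
  apply: eq_integral => x _; apply/esym/cvg_lim => //.
  exact: cvgeZr.
apply: cvg_unique l2; first exact: ereal_hausdorff.
rewrite /=; move: l1; rewrite (_ : (fun n => \int[m1]_x _) =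
  (fun n => \int[m2]_x ((f_ n x)%:E * g x)))//.
by apply/funext => n; exact: step.
Qed.

End density.

(** * Weighted sums along the integer translates *)

Section orbit.
Context {R : realType}.
Implicit Types (x y : Mstar R) (k m n : nat).

Definition mass k x : R := fine (x `[k%:R, k.+1%:R[%classic).

Lemma mass_ge0 k x : 0 <= mass k x.
Proof. exact: fine_ge0. Qed.

Lemma EFin_mass k x : (mass k x)%:E = x `[k%:R, k.+1%:R[%classic.
Proof. by rewrite /mass fineK//; exact: radon_itv_fin_num. Qed.

Lemma radon_itv_split (nu : radon R) (a b c : R) : a <= b -> b <= c ->
  nu `[a, c[%classic = (nu `[a, b[%classic + nu `[b, c[%classic)%E.
Proof.
move=> ab bc; rewrite -measureU.
- congr (nu _); apply/seteqP; split => z; rewrite /= !in_itv/=.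
    by move=> /andP[az zc]; have [zb|bz] := ltP z b; [left|right]; rewrite ?az.
  by move=> [|] /andP[h1 h2]; rewrite ?h1 ?h2 ?(le_trans ab)//= (lt_le_trans h2).
- exact: measurable_itv.
- exact: measurable_itv.
- apply/seteqP; split => // z; rewrite /= !in_itv/= => -[/andP[_ h1] /andP[h2 _]].
  by move: h1; rewrite ltNge h2.
Qed.

Lemma radon_itv_mass x m n :
  x `[m%:R, (m + n)%:R[%classic = (\sum_(m <= i < m + n) mass i x)%:E.
Proof.
elim: n => [|n ih].
  rewrite addn0 big_geq// set_itv_ge ?measure0//=.
  by rewrite -leNgt.
rewrite addnS (radon_itv_split _ (b := (m + n)%:R)) ?ler_nat ?leq_addr//.
by rewrite ih big_nat_recr ?leq_addr//= EFinD EFin_mass.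
Qed.

Lemma tstar_tstar (s t : R) x : tstar s (tstar t x) = tstar (t + s) x.
Proof.
have E := @zoom_comp R 1 (- s) 1 (- t) (oner_neq0 R) (oner_neq0 R)
  (mulf_neq0 (oner_neq0 R) (oner_neq0 R)) x.
by rewrite !tstarE E; apply: zoom_eq; rewrite ?mul1r// opprD.
Qed.

Lemma tstar0 x : tstar 0 x = x.
Proof. by rewrite tstarE oppr0 zoom_id. Qed.

Lemma tstar_charged k x A : 0 < mass k x -> measurable A ->
  tstar k%:R x A = (((mass k x)^-1)%:E * x (affine 1 (- k%:R) @^-1` A))%E.
Proof.
move=> k0 mA; have e : `[(- (- k%:R) / 1 : R), ((1 - (- k%:R)) / 1 : R)[%classic =
    `[k%:R, k.+1%:R[%classic :> set R.
  by rewrite !divr1 !opprK -natr1 addrC.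
by rewrite tstarE zoomE// e// -EFin_mass lte_fin.
Qed.

Lemma tstar_itv k x (u v : R) : 0 < mass k x ->
  tstar k%:R x `[u, v[%classic =
  (((mass k x)^-1)%:E * x `[(u + k%:R)%R, (v + k%:R)%R[%classic)%E.
Proof.
move=> k0; rewrite (tstar_charged k0 (measurable_itv `[u, v[)).
by rewrite preimage_affine_itv// !opprK !divr1.
Qed.

(** The cocycle property of the weights: it makes the sums along the orbit of
    the unit translates behave as Birkhoff sums with multiplicative weights. *)
Lemma mass_tstar k m x : 0 < mass k x ->
  mass m (tstar k%:R x) = mass (k + m) x / mass k x.
Proof.
move=> k0; rewrite {1}/mass tstar_itv// -natrD -natrD addSn addnC -EFin_mass.
by rewrite -EFinM/= mulrC.
Qed.

Lemma tauP x n : tau x = Some n <->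
  [/\ (0 < n)%N, 0 < mass n x & forall m, (0 < m < n)%N -> mass m x = 0].
Proof.
have tr m : translate m%:R x `[0%R, 1%R[%classic = (mass m x)%:E.
  rewrite /translate radon_affineE; last exact: measurable_itv.
  rewrite preimage_affine_itv// !opprK !divr1 add0r EFin_mass.
  by rewrite addrC natr1.
rewrite leastP /= tr lte_fin; split.
  move=> [[n0 nx] h]; split => // m /andP[m0 mn]; apply/eqP.
  rewrite eq_le mass_ge0 andbT leNgt; apply/negP => mx.
  have := h m; rewrite /= tr lte_fin => /(_ (conj m0 mx)).
  by rewrite leqNgt mn.
move=> [n0 nx h]; split => // m [m0]; rewrite tr lte_fin => mx.
by rewrite leqNgt; apply/negP => mn; rewrite h ?m0// ltxx in mx.
Qed.

Lemma tau_ex x k : (0 < k)%N -> 0 < mass k x ->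
  exists2 n, tau x = Some n & (n <= k)%N.
Proof.
move=> k0 kx; have ex : exists n, (0 < n)%N && (0 < mass n x).
  by exists k; rewrite k0.
case: (ex_minnP ex) => n /andP[n0 nx] nmin.
exists n; last by apply: nmin; rewrite k0.
apply/tauP; split => // m /andP[m0 mn]; apply/eqP.
rewrite eq_le mass_ge0 andbT leNgt; apply/negP => mx.
by have := nmin m; rewrite m0 mx => /(_ isT); rewrite leqNgt mn.
Qed.

Implicit Types g : borel (Mstar R) -> R.

(** Every translate by an integer enters with its mass as weight: the translates
    outside of the orbit of the return map have weight zero. *)
Definition orbit_sum n g x : R := \sum_(k < n) mass k x * g (tstar k%:R x).

Lemma orbit_sum1 n x : orbit_sum n (cst 1) x = \sum_(k < n) mass k x.
Proof. by apply: eq_bigr => i _; rewrite mulr1. Qed.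

Lemma orbit_sum1_ge0 n x : 0 <= orbit_sum n (cst 1) x.
Proof. by rewrite orbit_sum1; apply: sumr_ge0 => i _; exact: mass_ge0. Qed.

Lemma orbit_sum1_nd m n x : (m <= n)%N ->
  orbit_sum m (cst 1) x <= orbit_sum n (cst 1) x.
Proof.
move=> mn; rewrite !orbit_sum1 -!(big_mkord xpredT (fun k => mass k x)).
rewrite (big_cat_nat (leq0n m) mn)/= lerDl.
by apply: sumr_ge0 => i _; exact: mass_ge0.
Qed.

Lemma orbit_sumB n g c x :
  orbit_sum n (fun y => g y - c) x = orbit_sum n g x - c * orbit_sum n (cst 1) x.
Proof.
rewrite /orbit_sum mulr_sumr -sumrB; apply: eq_bigr => i _.
by rewrite mulr1 mulrBr [c * _]mulrC.
Qed.

Lemma orbit_sumN n g x : orbit_sum n (fun y => - g y) x = - orbit_sum n g x.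
Proof. by rewrite /orbit_sum -sumrN; apply: eq_bigr => i _; rewrite mulrN. Qed.

(** The renewal equation at the first return, a consequence of the cocycle
    property; it replaces the decomposition of a Birkhoff sum at time one. *)
Lemma orbit_sum_return k m g x : mass 0 x = 1 -> tau x = Some k ->
  orbit_sum (k + m) g x = g x + mass k x * orbit_sum m g (tstar k%:R x).
Proof.
move=> x0 /tauP[k0 kx kmin].
rewrite /orbit_sum -!(big_mkord xpredT (fun k => mass k _ * g (tstar k%:R _))).
rewrite (big_cat_nat (leq0n k) (leq_addr m k))/=; congr (_ + _).
  case: k k0 kx kmin => // k _ kx kmin.
  rewrite big_nat_recl// x0 mul1r tstar0 big_nat big1 ?addr0// => i ik.
  by rewrite kmin ?mul0r// ltnS /= ltnS; case/andP: ik.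
rewrite -{1}[k]add0n big_addn addKn mulr_sumr.
apply: eq_bigr => i _; rewrite mass_tstar// tstar_tstar addnC natrD.
by rewrite mulrA; congr (_ * _); rewrite mulrCA divff ?mulr1 ?gt_eqF.
Qed.

Lemma orbit_sum_noreturn n g x : mass 0 x = 1 ->
  (forall k, (0 < k < n.+1)%N -> mass k x = 0) ->
  orbit_sum n.+1 g x = g x.
Proof.
move=> x0 h; rewrite /orbit_sum big_ord_recl x0 mul1r tstar0 big1 ?addr0//.
by move=> i _; rewrite h ?mul0r//=; rewrite /bump/= add1n ltnS.
Qed.

Definition orbit_max N g x : R := \big[Num.max/0]_(n < N.+1) orbit_sum n g x.

Lemma orbit_max_ge0 N g x : 0 <= orbit_max N g x.
Proof. exact: bigmax_ge_id. Qed.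

Lemma orbit_sum_le_max n N g x : (n <= N)%N -> orbit_sum n g x <= orbit_max N g x.
Proof.
by move=> nN; apply: (@le_bigmax _ _ _ _ (fun i : 'I_N.+1 => orbit_sum i g x)
  (Ordinal (nN : (n < N.+1)%N))).
Qed.

Lemma orbit_max_le N g x c : 0 <= c ->
  (forall n, (n <= N)%N -> orbit_sum n g x <= c) -> orbit_max N g x <= c.
Proof.
by move=> c0 h; apply: bigmax_le => // i _; apply: h; rewrite -ltnS.
Qed.

Definition return_max N g x : R :=
  if tau x is Some k then mass k x * orbit_max N g (tstar k%:R x) else 0.

Lemma return_max_ge0 N g x : 0 <= return_max N g x.
Proof.
rewrite /return_max; case: (tau x) => // k.
by rewrite mulr_ge0 ?mass_ge0 ?orbit_max_ge0.
Qed.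

(** Garsia's pointwise inequality: where the maximum is positive it is attained
    at a positive time, and the renewal equation bounds the sum up to that time
    by [g] plus the weighted maximum at the first return. *)
Lemma orbit_max_garsia N g x : mass 0 x = 1 ->
  orbit_max N g x <= (if 0 < orbit_max N g x then g x else 0) + return_max N g x.
Proof.
move=> x0; case: ifPn => [M0|]; last first.
  by rewrite -leNgt add0r => /le_trans; apply; exact: return_max_ge0.
have h n : (0 < n <= N)%N -> orbit_sum n g x <= g x + return_max N g x.
  move=> /andP[n0 nN].
  have [[k kn tk]|notk] := pselect (exists2 k, (k < n)%N & tau x = Some k).
    rewrite -(subnKC (ltnW kn)) (orbit_sum_return _ _ x0 tk) lerD2l.
    rewrite /return_max tk ler_wpM2l ?mass_ge0//; apply: orbit_sum_le_max.
    by rewrite (leq_trans (leq_subr _ _)).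
  case: n n0 nN notk => // n _ nN notk.
  rewrite orbit_sum_noreturn//; first by rewrite lerDl return_max_ge0.
  move=> k /andP[k0 kn]; apply/eqP; rewrite eq_le mass_ge0 andbT leNgt.
  apply/negP => kx; have [j tj jk] := tau_ex k0 kx.
  by apply: notk; exists j => //; exact: leq_ltn_trans kn.
have [p0|p0] := leP 0 (g x + return_max N g x).
  apply: orbit_max_le => // -[_|n nN]; first by rewrite /orbit_sum big_ord0.
  exact: h.
exfalso; move: M0; apply/negP; rewrite -leNgt; apply: orbit_max_le => // -[_|n nN].
  by rewrite /orbit_sum big_ord0.
by rewrite (le_trans (h n.+1 _))// ltW.
Qed.

Section measurability.

Lemma measurable_mass_cell k : measurable_fun [set: borel (Mstar R)] (mass k).
Proof.
apply: (measurableT_comp (f := @fine R)); first by [].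
by apply: measurable_Mstar_mass; exact: measurable_itv.
Qed.

Lemma measurable_orbit_term k g : measurable_fun setT g ->
  measurable_fun [set: borel (Mstar R)]
    (fun x : borel (Mstar R) => mass k x * g (tstar k%:R x)).
Proof.
move=> mg; apply: measurable_realfun.measurable_funM.
  exact: measurable_mass_cell.
exact: (measurableT_comp mg (@measurable_tstar R k%:R)).
Qed.

Lemma measurable_orbit_sum n g : measurable_fun setT g ->
  measurable_fun [set: borel (Mstar R)] (orbit_sum n g).
Proof. by move=> mg; apply: measurable_sum => k; exact: measurable_orbit_term. Qed.

Lemma measurable_orbit_max N g : measurable_fun setT g ->
  measurable_fun [set: borel (Mstar R)] (orbit_max N g).
Proof.
move=> mg; rewrite /orbit_max; elim: (index_enum _) => [|i s ih].
  by under eq_fun do rewrite big_nil; exact: measurable_cst.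
under eq_fun do rewrite big_cons; apply: measurable_maxr => //.
exact: measurable_orbit_sum.
Qed.

Lemma measurable_tau (o : option nat) :
  measurable [set x : borel (Mstar R) | tau x = o].
Proof.
apply: measurable_least => n /=; case: (posnP n) => [->|n0].
  rewrite (_ : [set x | _] = set0)//.
  by apply/seteqP; split=> // x [].
have tr (x : Mstar R) : translate n%:R x `[0%R, 1%R[%classic = (mass n x)%:E.
  rewrite /translate radon_affineE; last exact: measurable_itv.
  rewrite preimage_affine_itv// !opprK !divr1 add0r EFin_mass.
  by rewrite addrC natr1.
rewrite (_ : [set x | _] = mass n @^-1` `]0, +oo[).
  by rewrite -[X in measurable X]setTI; apply: measurable_mass_cell => //;
    exact: measurable_itv.
apply/seteqP; split => x /=; rewrite in_itv/= andbT.
  by move=> []; rewrite tr lte_fin.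
by rewrite tr lte_fin.
Qed.

Lemma measurable_return_max N g : measurable_fun setT g ->
  measurable_fun [set: borel (Mstar R)] (return_max N g).
Proof.
move=> mg; apply: (@measurable_glue _ _ (borel (Mstar R)) _ _ (@tau R)
  (fun o x => if o is Some k then mass k x * orbit_max N g (tstar k%:R x) else 0)).
  exact: measurable_tau.
case=> [k|]; last exact: measurable_cst.
by apply: measurable_orbit_term; exact: measurable_orbit_max.
Qed.

End measurability.

End orbit.

Lemma measurable_pos_set d (T : measurableType d) (R : realType) (u : T -> R) :
  measurable_fun setT u -> measurable [set x | 0 < u x].
Proof.
move=> mu; rewrite (_ : [set x | _] = u @^-1` `]0, +oo[).
  by rewrite -[X in measurable X]setTI; apply: mu => //; exact: measurable_itv.
by apply/seteqP; split => x /=; rewrite in_itv/= andbT.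
Qed.

Section ae_integral.
Context d (T : measurableType d) (R : realType) (P : {measure set T -> \bar R}).
Local Open Scope ereal_scope.

Lemma ae_le_integrable (u v : T -> R) : P.-integrable setT (EFin \o u) ->
  P.-integrable setT (EFin \o v) -> {ae P, forall x, (u x <= v x)%R} ->
  \int[P]_x (u x)%:E <= \int[P]_x (v x)%:E.
Proof.
move=> iu iv uv.
have ivu : P.-integrable setT (EFin \o (fun x => v x - u x)%R).
  by rewrite /comp; under eq_fun do rewrite EFinB; exact: integrableB.
rewrite -sube_ge0; last by apply/orP; left; exact: integrable_fin_num iu.
rewrite -integralB_EFin//.
under eq_integral do rewrite -EFinB.
rewrite (@ae_eq_integral _ _ _ P setT (fun x => `|(v x - u x)%:E|))//.
- by apply: integral_ge0.
- exact: measurable_int ivu.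
- by apply: measurableT_comp => //; exact: measurable_int ivu.
- apply: filterS uv => x uvx _; rewrite gee0_abs// lee_fin subr_ge0//.
Qed.

End ae_integral.

(** * The maximal inequality *)

Section integrals.
Context {R : realType} (P : probability (borel (Mstar R)) R).
Local Notation X := (borel (Mstar R)).
Implicit Types (A : set X) (g : X -> R).
Local Open Scope ereal_scope.

Let PT : P setT = 1. Proof. exact: probability_setT. Qed.

Hypothesis mass0 : {ae P, forall x : X, mass 0 x = 1%R}.
Hypothesis transport : forall k (h : X -> \bar R), measurable_fun setT h ->
  (forall x, 0 <= h x) ->
  \int[P]_x ((mass k x)%:E * h (tstar k%:R x)) <= \int[P]_x h x.

(** A null set is not visited by the translates, by [transport] applied to its
    indicator. *)
Lemma transport_null k A : measurable A -> P A = 0 ->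
  {ae P, forall x : X, (0 < mass k x)%R -> ~ A (tstar k%:R x)}.
Proof.
move=> mA PA.
have mi : measurable_fun setT (fun x => (\1_A x)%:E : \bar R).
  exact/measurable_EFinP/measurable_indic.
have mt : measurable_fun setT (fun x : X => (mass k x)%:E * (\1_A (tstar k%:R x))%:E).
  under eq_fun do rewrite -EFinM; apply/measurable_EFinP.
  exact: (measurable_orbit_term k (measurable_indic mA)).
have i0 : \int[P]_x `|(mass k x)%:E * (\1_A (tstar k%:R x))%:E| = 0.
  apply/eqP; rewrite eq_le integral_ge0// andbT.
  rewrite (eq_integral (fun x : X => (mass k x)%:E * (\1_A (tstar k%:R x))%:E)).
    apply: le_trans (transport k mi _) _; first by move=> x; rewrite lee_fin.
    by rewrite integral_indic// setIT le_eqVlt; apply/orP; left; apply/eqP.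
  by move=> x _; rewrite gee0_abs// mule_ge0 ?lee_fin ?mass_ge0.
move/(ae_eq_integral_abs _ measurableT mt) : i0.
apply: filterS => x /(_ Logic.I) /= h kx Ax; move: h.
rewrite indicE mem_set// mule1 => -[] kx0; by rewrite kx0 ltxx in kx.
Qed.

Lemma integrable_mass k : P.-integrable setT (fun x => (mass k x)%:E).
Proof.
have mm : measurable_fun setT (fun x : X => (mass k x)%:E).
  by apply/measurable_EFinP; exact: measurable_mass_cell.
apply/integrableP; split => //.
apply: (@le_lt_trans _ _ 1); last exact: ltry.
rewrite (eq_integral (fun x : X => (mass k x)%:E * cst 1 (tstar k%:R x))).
  apply: le_trans (transport k (measurable_cst _) (fun x => lee01)) _.
  by rewrite integral_cst// mul1e le_eqVlt; apply/orP; left; apply/eqP.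
by move=> x _; rewrite mule1 gee0_abs// lee_fin mass_ge0.
Qed.

Definition bounded_by (B : R) g := forall x, (`|g x| <= B)%R.

Lemma bounded_integrable B g : measurable_fun setT g -> bounded_by B g ->
  P.-integrable setT (EFin \o g).
Proof.
move=> mg gB; apply: measurable_bounded_integrable => //.
  by apply: (@le_lt_trans _ _ 1); [rewrite le_eqVlt; apply/orP; left; apply/eqP|exact: ltry].
exists B; split; first exact: num_real.
by move=> M BM x _ /=; rewrite (le_trans (gB x))// ltW.
Qed.

Lemma integrable_orbit_max N g B : measurable_fun setT g -> bounded_by B g ->
  P.-integrable setT (EFin \o orbit_max N g).
Proof.
move=> mg gB.
apply: (@le_integrable _ _ _ P setT _ _
   (fun x => B%:E * \sum_(k < N) (mass k x)%:E)) => //.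
- by apply/measurable_EFinP; exact: measurable_orbit_max.
- move=> x _; have B0 : (0 <= B)%R by exact: le_trans (gB point).
  have S0 : (0 <= B * \sum_(i < N) mass i x)%R.
    by rewrite mulr_ge0//; apply: sumr_ge0 => i _; exact: mass_ge0.
  rewrite /= sumEFin -EFinM lee_fin (ger0_norm (orbit_max_ge0 _ _ _)) ger0_norm//.
  apply: orbit_max_le => // n nN.
  rewrite -orbit_sum1; apply: (@le_trans _ _ (B * orbit_sum n (cst 1%R) x)%R).
    rewrite /orbit_sum mulr_sumr; apply: ler_sum => i _.
    rewrite mulr1 mulrC ler_wpM2r ?mass_ge0//.
    exact: le_trans (ler_norm _) (gB _).
  by rewrite ler_wpM2l// orbit_sum1_nd.
- apply: integrableZl => //; apply: integrable_sum => // k _.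
  exact: integrable_mass.
Qed.

(* The first return after [k] steps lands in [D k], the points whose previous
   charged cell lies exactly [k] cells back. As these sets are disjoint, the
   transport inequalities for all [k] can be added. *)
Let D k : set X := [set x : X | 0 < (x : Mstar R) `[(- k%:R)%R, (- k%:R + 1)%R[%classic /\
  (x : Mstar R) `[(- k%:R + 1)%R, 0%R[%classic = 0].

Let measurable_D k : measurable (D k).
Proof.
rewrite (_ : D k = (fun x : X => (x : Mstar R) `[(- k%:R)%R, (- k%:R + 1)%R[%classic : \bar R)
    @^-1` `]0, +oo[ `&`
  (fun x : X => (x : Mstar R) `[(- k%:R + 1)%R, 0%R[%classic : \bar R)
    @^-1` [set 0]).
  apply: measurableI; rewrite -[X in measurable X]setTI.
    by apply: (measurable_Mstar_mass (measurable_itv `[(- k%:R)%R, (- k%:R + 1)%R[)) => //;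
      exact: emeasurable_itv.
  by apply: (measurable_Mstar_mass (measurable_itv `[(- k%:R + 1)%R, 0%R[)).
by apply/seteqP; split => x /=; rewrite /D/= in_itv/= andbT.
Qed.

Let D_disjoint k l x : (0 < k < l)%N -> D k x -> D l x -> False.
Proof.
move=> /andP[k0 kl] [kx _] [_ lx]; move: kx; apply/negP; rewrite -leNgt -lx.
apply: le_measure; rewrite ?inE; [exact: measurable_itv|exact: measurable_itv|].
move=> y; rewrite /= !in_itv/= => /andP[ky yk].
have kl' : (k%:R + 1 <= l%:R :> R)%R by rewrite natr1 ler_nat.
have k0' : (1 <= k%:R :> R)%R by rewrite ler1n.
apply/andP; split; lra.
Qed.

Let D_return k x : mass 0 x = 1%R -> tau x = Some k -> D k (tstar k%:R x).
Proof.
move=> x0 /tauP[k0 kx kmin]; split; rewrite tstar_itv//.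
  rewrite addNr (_ : (- k%:R + 1 + k%:R = 1)%R); last by ring.
  rewrite -(EFin_mass 0) x0 mule1 lte_fin invr_gt0//.
rewrite (_ : (- k%:R + 1 + k%:R = 1)%R) ?add0r; last by ring.
suff -> : x `[1%R, k%:R[%classic = 0 by rewrite mule0.
have := radon_itv_mass x 1 (k.-1); rewrite add1n prednK// => ->.
by rewrite big_nat big1// => i ik; rewrite kmin.
Qed.

(** Integrated along the return map, the maximum does not increase: this is the
    substitute for the invariance of the measure in Garsia's argument. *)
Let integral_return_max N g B : measurable_fun setT g -> bounded_by B g ->
  \int[P]_x (return_max N g x)%:E <= \int[P]_x (orbit_max N g x)%:E.
Proof.
move=> mg gB; pose E k : set X := [set x : X | tau x = Some k.+1].
have mE k : measurable (E k) by exact: measurable_tau.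
have tE : trivIset setT E.
  by apply/trivIsetP => i j _ _ ij; apply/seteqP; split => // x []; rewrite /E/= => ->;
    move=> [ji]; rewrite ji eqxx in ij.
have tD : trivIset setT (fun k => D k.+1).
  apply/trivIsetP => i j _ _ ij; apply/seteqP; split => // x [xi xj].
  move: ij; rewrite neq_ltn => /orP[] ij; first exact: (@D_disjoint i.+1 j.+1 x).
  exact: (@D_disjoint j.+1 i.+1 x).
have mM : measurable_fun setT (fun x : X => (orbit_max N g x)%:E).
  by apply/measurable_EFinP; exact: measurable_orbit_max.
have mR : measurable_fun setT (fun x : X => (return_max N g x)%:E).
  by apply/measurable_EFinP; exact: measurable_return_max.
have -> : \int[P]_x (return_max N g x)%:E = \int[P]_(x in \bigcup_k E k) (return_max N g x)%:E.
  rewrite [RHS]integral_mkcond; apply: eq_integral => x _; rewrite patchE.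
  case: ifPn => //; rewrite notin_setE => nE.
  rewrite /return_max; case tx : (tau x) => [k|//].
  case: k tx => [/tauP[]//|k tx]; exfalso; apply: nE; by exists k.
rewrite ge0_integral_bigcup//; last 2 first.
- exact: measurable_funTS.
- by move=> x _; rewrite lee_fin return_max_ge0.
apply: (@le_trans _ _ (\sum_(k <oo) \int[P]_(x in D k.+1) (orbit_max N g x)%:E)).
  apply: lee_nneseries => [k _ _|k _].
    by apply: integral_ge0 => x _; rewrite lee_fin return_max_ge0.
  pose h : X -> \bar R := (fun x => (orbit_max N g x)%:E) \_ (D k.+1).
  have mh : measurable_fun setT h.
    by apply/(measurable_restrictT _ _).1 => //; exact: measurable_funTS.
  have h0 x : 0 <= h x.
    by rewrite /h patchE; case: ifP => // _; rewrite lee_fin orbit_max_ge0.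
  rewrite [leRHS]integral_mkcond -/h; apply: le_trans (transport k.+1 mh h0).
  rewrite integral_mkcond; apply: ae_ge0_le_integral => //.
  - move=> x _; rewrite patchE; case: ifP => // _.
    by rewrite lee_fin return_max_ge0.
  - by apply/(measurable_restrictT _ _).1 => //; exact: measurable_funTS.
  - by move=> x _; rewrite mule_ge0// lee_fin mass_ge0.
  - apply: emeasurable_funM.
      by apply/measurable_EFinP; exact: measurable_mass_cell.
    exact: (measurableT_comp mh (@measurable_tstar R k.+1%:R)).
  - apply: filterS mass0 => x x0 _; rewrite patchE; case: ifPn => [|_].
      rewrite inE => tx; rewrite /return_max tx /h patchE mem_set//.
      exact: D_return.
    by rewrite mule_ge0// lee_fin mass_ge0.
rewrite -ge0_integral_bigcup//; last 2 first.
- exact: measurable_funTS.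
- by move=> x _; rewrite lee_fin orbit_max_ge0.
apply: ge0_subset_integral => //; first exact: bigcupT_measurable.
by move=> x _; rewrite lee_fin orbit_max_ge0.
Qed.

Let maximal_ineq_finite N g B : measurable_fun setT g -> bounded_by B g ->
  0 <= \int[P]_(x in [set x : X | (0 < orbit_max N g x)%R]) (g x)%:E.
Proof.
move=> mg gB; pose g1 (x : X) := if (0 < orbit_max N g x)%R then g x else 0%R.
have mS : measurable [set x : X | (0 < orbit_max N g x)%R].
  by apply: measurable_pos_set; exact: measurable_orbit_max.
have g1E : EFin \o g1 = (EFin \o g) \_ [set x : X | (0 < orbit_max N g x)%R].
  apply/funext => x; rewrite patchE /g1/=; case: ifPn => [h|/negP h].
    by rewrite mem_set.
  by rewrite memNset.
have ig1 : P.-integrable setT (EFin \o g1).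
  rewrite g1E; apply/(integrable_mkcond _ _).1 => //.
  by apply: (integrableS measurableT) => //; exact: bounded_integrable gB.
rewrite integral_mkcond -g1E.
have iM := integrable_orbit_max N mg gB.
have iR : P.-integrable setT (EFin \o return_max N g).
  apply/integrableP; split.
    by apply/measurable_EFinP; exact: measurable_return_max.
  rewrite (eq_integral (fun x : X => (return_max N g x)%:E)); last first.
    by move=> x _; rewrite gee0_abs// lee_fin return_max_ge0.
  apply: le_lt_trans (integral_return_max N mg gB) _.
  by apply: integrable_lty.
have fM : \int[P]_x (orbit_max N g x)%:E \is a fin_num by exact: integrable_fin_num iM.
have fR : \int[P]_x (return_max N g x)%:E \is a fin_num by exact: integrable_fin_num iR.
apply: (@le_trans _ _ (\int[P]_x (orbit_max N g x - return_max N g x)%:E)).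
  by rewrite integralB_EFin// sube_ge0 ?fR ?integral_return_max// (integral_return_max N mg gB).
apply: ae_le_integrable => //.
  by rewrite /comp; under eq_fun do rewrite EFinB; exact: integrableB.
by apply: filterS mass0 => x x0; rewrite lerBlDr; exact: orbit_max_garsia.
Qed.

(** Hopf's maximal inequality: Garsia's pointwise inequality is integrated, and
    the integrals of the maximum cancel up to the sign, by
    [integral_return_max]; then the horizon tends to infinity. *)
Lemma maximal_ineq g B : measurable_fun setT g -> bounded_by B g ->
  0 <= \int[P]_(x in [set x : X | exists n, (0 < orbit_sum n g x)%R]) (g x)%:E.
Proof.
move=> mg gB.
set S := [set x | _]; pose SN N : set X := [set x : X | (0 < orbit_max N g x)%R].
have mSN N : measurable (SN N).
  by apply: measurable_pos_set; exact: measurable_orbit_max.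
have SE : S = \bigcup_N SN N.
  apply/seteqP; split => x [n].
    move=> nx; exists n => //; rewrite /SN/=; apply: lt_le_trans nx _.
    exact: orbit_sum_le_max.
  move=> _; rewrite /SN/= => h; apply: contrapT => /forallNP nS.
  move: h; apply/negP; rewrite -leNgt; apply: orbit_max_le => // m _.
  by rewrite leNgt; apply/negP; exact: nS.
have mS : measurable S by rewrite SE; exact: bigcupT_measurable.
have ig : P.-integrable setT (EFin \o g) by exact: bounded_integrable gB.
rewrite integral_mkcond.
have : \int[P]_x ((EFin \o g) \_ (SN n)) x @[n --> \oo] -->
    \int[P]_x ((EFin \o g) \_ S) x.
  apply: (@dominated_cvg _ _ _ P setT _ _ _ (fun x => `|(g x)%:E|)) => //.
  - move=> n; apply/(measurable_restrictT _ _).1 => //.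
    by apply: measurable_funTS; exact/measurable_EFinP.
  - move=> x _; have [xS|xS] := pselect (S x).
      rewrite patchE mem_set//; apply: cvg_near_cst.
      have [n nx] := xS; exists n => // m /= nm; rewrite patchE mem_set//.
      rewrite /SN/=; apply: lt_le_trans nx _; exact: orbit_sum_le_max.
    rewrite patchE memNset//; apply: cvg_near_cst; apply: nearW => n.
    rewrite patchE memNset// => xn; apply: xS; rewrite SE; by exists n.
  - exact: integrable_abse ig.
  - move=> n x _; rewrite patchE; case: ifP => // _; by rewrite abse0.
move=> h; rewrite -(cvg_lim _ h)//; apply: lime_ge; first exact: cvgP h.
apply: nearW => n; rewrite -integral_mkcond; exact: maximal_ineq_finite gB.
Qed.

End integrals.

(** * The ratio ergodic theorem *)

Section return_invariance.
Context {R : realType}.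
Local Notation X := (borel (Mstar R)).
Implicit Types (x y : Mstar R) (F : X -> R).

(** A charged cell is reached from the previous charged cell by one return; this
    gives induction on charged cells along the return map. *)
Lemma tau_prev x k : 0 < mass 0 x -> (0 < k)%N -> 0 < mass k x ->
  exists j, [/\ (j < k)%N, 0 < mass j x & tau (tstar j%:R x) = Some (k - j)%N].
Proof.
move=> x0 k0 kx.
have exj : exists j, (j < k)%N && (0 < mass j x) by exists 0%N; rewrite k0.
have ub j : (j < k)%N && (0 < mass j x) -> (j <= k)%N by move=> /andP[/ltnW].
case: (ex_maxnP exj ub) => j /andP[jk jx] jmax.
exists j; split => //; apply/tauP; rewrite subn_gt0 mass_tstar// subnKC ?(ltnW jk)//.
split => //; first by rewrite divr_gt0.
move=> m /andP[m0 mkj]; rewrite mass_tstar//.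
have -> : mass (j + m) x = 0; last by rewrite mul0r.
apply/eqP; rewrite eq_le mass_ge0 andbT leNgt; apply/negP => jmx.
have := jmax (j + m)%N; rewrite jmx -ltn_subRL mkj => /(_ isT).
by rewrite leqNgt -[X in (X < _)%N]addn0 ltn_add2l m0.
Qed.

Definition right_infinite x := forall M : R, exists n, M < orbit_sum n (cst 1) x.

Lemma right_infinite_tau x : mass 0 x = 1 -> right_infinite x ->
  exists k, tau x = Some k.
Proof.
move=> x0 xoo; have [n xn] := xoo 1.
case: n xn => [|n]; first by rewrite /orbit_sum big_ord0 ltNge ler01.
move=> xn; apply: contrapT => /forallNP nt.
move: xn; rewrite orbit_sum_noreturn ?ltxx// => k /andP[k0 _].
apply/eqP; rewrite eq_le mass_ge0 andbT leNgt; apply/negP => kx.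
by have [j tj _] := tau_ex k0 kx; exact: nt tj.
Qed.

Lemma right_infinite_return x k : mass 0 x = 1 -> tau x = Some k ->
  right_infinite x -> right_infinite (tstar k%:R x).
Proof.
move=> x0 tk xoo M; have [_ kx _] := (tauP _ _).1 tk.
have [n xn] := xoo (1 + mass k x * M); exists n.
have := lt_le_trans xn (orbit_sum1_nd x (leq_addl k n)).
by rewrite (orbit_sum_return _ _ x0 tk) ltrD2l ltr_pM2l.
Qed.

Lemma right_infinite_near x M : right_infinite x ->
  exists N, forall n, (N <= n)%N -> M < orbit_sum n (cst 1) x.
Proof.
by move=> /(_ M)[N NM]; exists N => n Nn; exact: lt_le_trans (orbit_sum1_nd x Nn).
Qed.

(** The upper limit of the ratios of [F] exceeds [b]. The rational margin [q]
    above [b] absorbs the bounded terms that appear when the orbit sums are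
    started at another point of the orbit. *)
Definition limsup_above F (b : R) : set X := [set x : X | exists q : rat, b < ratr q /\
  forall N, exists n, (N <= n)%N /\ 0 < orbit_sum n (fun y => F y - ratr q) x].

Lemma measurable_limsup_above F b : measurable_fun setT F ->
  measurable (limsup_above F b).
Proof.
move=> mF.
rewrite (_ : limsup_above F b = \bigcup_(q : rat)
   (if b < ratr q then \bigcap_N \bigcup_n
      (if (N <= n)%N then [set x : X | 0 < orbit_sum n (fun y => F y - ratr q) x] else set0)
    else set0)).
  apply: countable_bigcupT_measurable => // q; case: ifP => // _.
  apply: bigcapT_measurable => N; apply: bigcupT_measurable => n.
  case: ifP => // _; apply: measurable_pos_set; apply: measurable_orbit_sum.
  exact: measurable_realfun.measurable_funB.
apply/seteqP; split => x.
  move=> [q [bq h]]; exists q => //; rewrite bq => N _.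
  by have [n [Nn xn]] := h N; exists n => //; rewrite Nn.
move=> [q _]; case: ifP => // bq h; exists q; split => // N.
by have [n _] := h N Logic.I; case: ifP => // Nn xn; exists n.
Qed.

Lemma limsup_above_return F b B x k : bounded_by B F -> mass 0 x = 1 ->
  tau x = Some k -> right_infinite x ->
  limsup_above F b (tstar k%:R x) <-> limsup_above F b x.
Proof.
move=> FB x0 tk xoo; set y := tstar k%:R x.
have [_ kx _] := (tauP _ _).1 tk.
have yoo : right_infinite y by exact: right_infinite_return.
have FxB := FB x; rewrite ler_norml in FxB; have /andP[Fx1 Fx2] := FxB.
have big (q q' : rat) : (ratr q' : R) < ratr q ->
    exists N, forall n, (N <= n)%N ->
      B + `|ratr q| + `|ratr q'| < mass k x * ((ratr q - ratr q') * orbit_sum n (cst 1) y).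
  move=> qq; have d0 : 0 < mass k x * (ratr q - ratr q') by rewrite mulr_gt0// subr_gt0.
  have [N NP] := right_infinite_near ((B + `|ratr q| + `|ratr q'|) /
    (mass k x * (ratr q - ratr q'))) yoo.
  exists N => n /NP; rewrite ltr_pdivrMr// => h.
  rewrite (_ : mass k x * _ =
    orbit_sum n (cst 1) y * (mass k x * (ratr q - ratr q')))//; ring.
split=> -[q [bq h]].
- have [q' /[!in_itv]/= /andP[bq' qq']] : exists r, ratr r \in `]b, ratr q[.
    exact: rat_in_itvoo.
  have [M MP] := big _ _ qq'.
  exists q'; split => // N; have [n [Nn nx]] := h (maxn N M).
  exists (k + n)%N; split.
    by rewrite (leq_trans _ (leq_addl _ _))// (leq_trans (leq_maxl _ _) Nn).
  rewrite (orbit_sum_return _ _ x0 tk) -/y.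
  have := MP n (leq_trans (leq_maxr _ _) Nn).
  move: nx; rewrite !orbit_sumB.
  set a := orbit_sum n F y; set s := orbit_sum n (cst 1) y; set w := mass k x.
  move=> /(mulr_gt0 kx); rewrite -/w => h1 h2.
  rewrite (_ : w * (a - ratr q' * s) =
     w * (a - ratr q * s) + w * ((ratr q - ratr q') * s)); last by ring.
  have := ler_norm (ratr q' : R); have := normr_ge0 (ratr q : R).
  lra.
- have [q' /[!in_itv]/= /andP[bq' qq']] : exists r, ratr r \in `]b, ratr q[.
    exact: rat_in_itvoo.
  have [M MP] := big _ _ qq'.
  exists q'; split => // N; have [n [Nn nx]] := h (k + maxn N M)%N.
  have nk : (k <= n)%N by rewrite (leq_trans _ Nn)// leq_addr.
  have Nn' : (maxn N M <= n - k)%N by rewrite leq_subRL.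
  exists (n - k)%N; split; first by rewrite (leq_trans (leq_maxl _ _) Nn').
  have := MP (n - k)%N (leq_trans (leq_maxr _ _) Nn').
  move: nx; rewrite -{1}(subnKC nk) (orbit_sum_return _ _ x0 tk) -/y !orbit_sumB.
  set a := orbit_sum _ F y; set s := orbit_sum _ (cst 1) y; set w := mass k x.
  move=> h1 h2; rewrite -(pmulr_rgt0 _ kx) -/w.
  rewrite (_ : w * (a - ratr q' * s) =
     w * (a - ratr q * s) + w * ((ratr q - ratr q') * s)); last by ring.
  have := ler_norm (- ratr q : R); rewrite normrN; have := normr_ge0 (ratr q' : R).
  lra.
Qed.

End return_invariance.

Section ergodic_theorem.
Context {R : realType} (P : probability (borel (Mstar R)) R).
Local Notation X := (borel (Mstar R)).
Local Notation J := (t_invariant P).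
Implicit Types (A : set X) (F : X -> R).

Hypothesis mass0 : {ae P, forall x : X, mass 0 x = 1}.
Hypothesis transport : forall k (h : X -> \bar R), measurable_fun setT h ->
  (forall x, 0 <= h x)%E ->
  (\int[P]_x ((mass k x)%:E * h (tstar k%:R x)) <= \int[P]_x h x)%E.
Hypothesis growth : {ae P, forall x : X, right_infinite x}.

Lemma tmap_tau (x : Mstar R) k : tau x = Some k -> tmap x = Some (tstar k%:R x).
Proof. by rewrite /tmap => ->. Qed.

(** Almost everywhere the return time is finite, so that invariance up to null
    sets can be read pointwise along the returns. *)
Lemma invariantP A : measurable A ->
  J A <-> {ae P, forall x : X, forall k, tau x = Some k -> (A (tstar k%:R x) <-> A x)}.
Proof.
have tN x k : tau (x : Mstar R) = Some k -> forall A : set X, tmap_preimage A x <-> A (tstar k%:R x).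
  move=> tk A'; rewrite /tmap_preimage/= (tmap_tau tk).
  by split => [[mu [<-]]//|h]; exists (tstar k%:R x).
move=> mA; split.
  move=> [_]; apply: negligibleS => x /= nx; apply: contrapT => nA; apply: nx => k tk.
  have tA := tN _ _ tk A.
  split => h; apply: contrapT => nh; apply: nA.
    by left; split => //; exact/tA.
  by right; split => // /tA.
move=> hA; split => //; apply: negligibleS (negligibleU hA (negligibleU mass0 growth)).
move=> x /= xA; apply: contrapT => /not_orP[h1 /not_orP[h2 h3]].
move: h1 h2 h3 => /contrapT h1 /contrapT h2 /contrapT h3.
have [k tk] := right_infinite_tau h2 h3.
have := h1 k tk; have := tN _ _ tk A.
by case: xA => -[]; tauto.
Qed.

Lemma sigma_algebra_invariant : sigma_algebra setT J.
Proof.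
split.
- apply/invariantP => //; apply: nearW => x k _.
  by split.
- move=> A JA; have mA : measurable A by case: JA.
  rewrite setTD; apply/invariantP; first exact: measurableC.
  apply: filterS ((invariantP mA).1 JA) => x h k tk; have := h k tk.
  by rewrite /setC/=; tauto.
- move=> A JA; have mA n : measurable (A n) by case: (JA n).
  apply/invariantP; first exact: bigcupT_measurable.
  have : {ae P, forall x : X, forall n, forall k, tau (x : Mstar R) = Some k ->
      (A n (tstar k%:R x) <-> A n x)}.
    by apply: ae_foralln => n; exact: (invariantP (mA n)).1.
  apply: filterS => x h k tk; split => -[n _ An]; exists n => //.
    exact/(h n k tk).
  exact/(h n k tk).
Qed.

Lemma invariant_measurable A : J A -> measurable A.
Proof. by case. Qed.

Lemma invariantI A A' : J A -> J A' -> J (A `&` A').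
Proof.
move=> JA JA'; rewrite -(sigma_algebra_id sigma_algebra_invariant).
by apply: (@measurableI _ (g_sigma_algebraType J)); exact: sub_sigma_algebra.
Qed.

(** The exceptional null set of [invariantP] is avoided by the whole orbit, by
    [transport_null]; then the returns are composed. *)
Lemma invariant_orbit A : J A ->
  {ae P, forall x : X, forall k, 0 < mass k x -> (A (tstar k%:R x) <-> A x)}.
Proof.
move=> JA; have /(invariantP (invariant_measurable JA)) [N [mN PN AN]] := JA.
have : {ae P, forall x : X, forall k, 0 < mass k x -> ~ N (tstar k%:R x)}.
  by apply: ae_foralln => k; exact: (transport_null transport).
apply: filterS2 mass0 => x x0 xN k.
elim/ltn_ind: k => k ih kx; have [->|k0] := posnP k; first by rewrite tstar0.
have x0' : 0 < mass 0 (x : Mstar R) by rewrite [X in _ < X]x0.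
have [j [jk jx tj]] := tau_prev x0' k0 kx.
have <- := ih j jk jx.
have := xN j jx; move/subsetC : AN => /(_ (tstar j%:R x)) /[apply]/contrapT.
move=> /(_ _ tj); rewrite tstar_tstar -natrD subnKC ?(ltnW jk)//.
Qed.

Lemma limsup_above_invariant F b B : measurable_fun setT F -> bounded_by B F ->
  J (limsup_above F b).
Proof.
move=> mF FB; apply/invariantP; first exact: measurable_limsup_above.
apply: filterS2 mass0 growth => x x0 xoo k tk.
exact: limsup_above_return FB x0 tk xoo.
Qed.

(** The maximal inequality for [F - b] on the invariant set where the upper
    limit exceeds [b] and [h < b]: there every point has a positive orbit sum, so
    that the integral of [F - b], which is the integral of [h - b], is
    nonnegative. *)
Lemma limsup_above_null F B h (b : R) : measurable_fun setT F -> bounded_by B F ->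
  is_cond_exp P J F h -> P (h @^-1` `]-oo, b[ `&` limsup_above F b) = 0%E.
Proof.
move=> mF FB [Jh ih hE]; set A := _ `&` _.
have JA : J A.
  apply: invariantI; last exact: limsup_above_invariant FB.
  by apply: Jh; exact: measurable_itv.
have mA := invariant_measurable JA.
have mh : measurable_fun setT h by apply/measurable_EFinP; exact: measurable_int ih.
have iF : P.-integrable setT (EFin \o F) by exact: bounded_integrable FB.
have ic (c : R) : P.-integrable setT (EFin \o cst c).
  by apply: (@bounded_integrable _ P `|c|) => // x.
pose g : X -> R := (fun x => F x - b) \_ A.
have mg : measurable_fun setT g.
  apply/(measurable_restrictT _ _).1 => //; apply: measurable_funTS.
  exact: measurable_realfun.measurable_funB.
have gB : bounded_by (B + `|b|) g.
  move=> x; rewrite /g patchE; case: ifP => _.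
    by rewrite (le_trans (ler_normB _ _))// lerD2r.
  by rewrite normr0 addr_ge0// (le_trans _ (FB point)).
have := maximal_ineq mass0 transport mg gB; set S := [set x : X | _].
have mS : measurable S.
  rewrite (_ : S = \bigcup_n [set x : X | 0 < orbit_sum n g x]).
    apply: bigcupT_measurable => n.
    by apply: measurable_pos_set; exact: measurable_orbit_sum.
  by apply/seteqP; split => x [n]; [exists n|exists n].
have mg' : measurable_fun setT (fun x => (g x)%:E) by exact/measurable_EFinP.
rewrite integral_mkcond (@ae_eq_integral _ _ _ P setT (fun x => (g x)%:E))//; last 2 first.
- by apply/(measurable_restrictT _ _).1 => //; exact: measurable_funTS.
- apply: filterS (invariant_orbit JA) => x xA _; rewrite patchE.
  have [xS|xS] := pselect (S x); first by rewrite mem_set.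
  rewrite memNset//; have [Ax|nAx] := pselect (A x); last by rewrite /g patchE memNset.
  exfalso; apply: xS; have [_ [q [bq xq]]] := Ax.
  have [n [_ nx]] := xq 0%N; exists n.
  apply: (lt_le_trans nx); apply: ler_sum => i _.
  have [ix|ix] := ltP 0 (mass i x); last first.
    have -> : mass i x = 0 by apply/eqP; rewrite eq_le ix mass_ge0.
    by rewrite !mul0r.
  rewrite ler_wpM2l ?mass_ge0// /g patchE mem_set; last exact/xA.
  by rewrite lerD2l lerN2 ltW.
have -> : (\int[P]_x (g x)%:E)%E = (\int[P]_(x in A) (F x - b)%R)%:E.
  rewrite /Rintegral fineK.
    by rewrite [RHS]integral_mkcond; apply: eq_integral => x _; rewrite /g !patchE; case: ifP.
  apply: integrable_fin_num => //; apply: (integrableS measurableT) => //.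
  under eq_fun do rewrite EFinB; apply: integrableB => //; exact: ic.
rewrite lee_fin RintegralB//; last 2 first.
- exact: (integrableS measurableT).
- exact: (integrableS measurableT _ _ (ic b)).
rewrite -(hE _ JA) -RintegralB//; last 2 first.
- exact: (integrableS measurableT).
- exact: (integrableS measurableT _ _ (ic b)).
move=> h0.
pose u x : R := h x - b.
have ibh : P.-integrable A (EFin \o u).
  apply: (integrableS measurableT) => //.
  by rewrite /comp; under eq_fun do rewrite EFinB; apply: integrableB => //; exact: ic.
have i0 : (\int[P]_(x in A) `|(EFin \o u) x| = 0)%E.
  apply/eqP; rewrite eq_le integral_ge0// andbT.
  rewrite (eq_integral (fun x => - (EFin \o u) x)%E); last first.
    move=> x /[!inE] -[]; rewrite /= in_itv/= => hb _.
    by rewrite ltr0_norm// subr_lt0.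
  rewrite integralN//; last exact: integrable_add_def.
  by rewrite oppe_le0; move: h0; rewrite -lee_fin /Rintegral fineK//; exact: integrable_fin_num.
have /(ae_eq_integral_abs _ mA (measurable_int _ ibh)) := i0.
move=> hn; apply/negligibleP => //; apply: negligibleS hn => x Ax /= /(_ Ax).
move: Ax => [/=]; rewrite in_itv/= => hb _ [] /eqP; rewrite subr_eq0 => /eqP e.
by rewrite e ltxx in hb.
Qed.

Lemma ae_forall_rat (Pr : rat -> X -> Prop) :
  (forall q, {ae P, forall x, Pr q x}) -> {ae P, forall x, forall q, Pr q x}.
Proof.
move=> h; have : {ae P, forall x, forall n, if unpickle n is Some q then Pr q x else True}.
  by apply: ae_foralln => n; case: (unpickle n) => [q|]; [exact: h|exact: nearW].
by apply: filterS => x hx q; have := hx (pickle q); rewrite pickleK.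
Qed.

Lemma ratio_limsup F B h : measurable_fun setT F -> bounded_by B F ->
  is_cond_exp P J F h ->
  {ae P, forall x : X, forall e, 0 < e -> exists N, forall n, (N <= n)%N ->
    orbit_sum n F x <= (h x + e) * orbit_sum n (cst 1) x}.
Proof.
move=> mF FB hF.
have : {ae P, forall x : X, forall q : rat, h x < ratr q -> ~ limsup_above F (ratr q) x}.
  apply: ae_forall_rat => q.
  have P0 := limsup_above_null (ratr q) mF FB hF.
  have mA : measurable (h @^-1` `]-oo, (ratr q)[ `&` limsup_above F (ratr q)).
    apply: measurableI; last exact: measurable_limsup_above.
    by case: hF => + _ _ => /(_ _ (measurable_itv `]-oo, (ratr q)[)) [].
  exists (h @^-1` `]-oo, (ratr q)[ `&` limsup_above F (ratr q)); split => // x /= nx.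
  apply: contrapT => nA; apply: nx => hq lx; apply: nA; split; last exact: lx.
  by rewrite /= in_itv/=.
apply: filterS => x hx e e0.
have [b /[!in_itv]/= /andP[hb be]] : exists b, ratr b \in `]h x, h x + e[.
  by apply: rat_in_itvoo; rewrite ltrDl.
have [q /[!in_itv]/= /andP[bq qe]] : exists q, ratr q \in `](ratr b), h x + e[.
  exact: rat_in_itvoo.
have := hx _ hb; rewrite /limsup_above/= => /forallNP/(_ q)/not_andP[//|].
move=> /existsNP[N] /forallNP NP; exists N => n Nn.
have := NP n => /not_andP[//|/negP]; rewrite -leNgt orbit_sumB subr_le0.
move=> /le_trans; apply; rewrite ler_wpM2r ?orbit_sum1_ge0// ltW//.
Qed.

Lemma is_cond_expN F h : P.-integrable setT (EFin \o F) ->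
  is_cond_exp P J F h -> is_cond_exp P J (fun x => - F x) (fun x => - h x).
Proof.
move=> iF [Jh ih hE]; split.
- move=> C mC; rewrite (_ : _ @^-1` _ = h @^-1` (-%R @^-1` C))//; apply: Jh.
  rewrite -[X in measurable X]setTI; apply: (@oppr_measurable R setT) => //.
- rewrite /comp; under eq_fun do rewrite EFinN; exact: integrableN.
- move=> A JA; have mA := invariant_measurable JA.
  have N1 (u : X -> R) : P.-integrable setT (EFin \o u) ->
      \int[P]_(x in A) (- u x) = - \int[P]_(x in A) u x.
    move=> iu; under eq_Rintegral do rewrite -mulN1r.
    by rewrite RintegralZl ?mulN1r//; exact: (integrableS measurableT).
  by rewrite !N1// hE.
Qed.

(** The ratio ergodic theorem of Hurewicz for the return map: the upper limit of
    the ratios is at most the conditional expectation, for [F] and for [- F]. *)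
Lemma ratio_ergodic F B : measurable_fun setT F -> bounded_by B F ->
  {ae P, forall x : X, orbit_sum n F x / orbit_sum n (cst 1) x @[n --> \oo] -->
    cond_exp P J F x}.
Proof.
move=> mF FB; have iF : P.-integrable setT (EFin \o F) by exact: bounded_integrable FB.
have hF := cond_expP sigma_algebra_invariant invariant_measurable iF.
set h := cond_exp P J F in hF *.
have up := ratio_limsup mF FB hF.
have NFB : bounded_by B (fun x => - F x) by move=> x; rewrite normrN.
have mNF : measurable_fun setT (fun x => - F x).
  by apply: (measurableT_comp (f := -%R : R -> R)) => //; exact: oppr_measurable.
have dn := ratio_limsup mNF NFB (is_cond_expN iF hF).
apply: filterS2 (filterI up dn) growth => x [upx dnx] xoo.
apply/cvgrPdist_le => e e0; have [N1 hN1] := upx _ e0; have [N2 hN2] := dnx _ e0.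
have [N3 hN3] := right_infinite_near 0 xoo.
exists (maxn N1 (maxn N2 N3)) => // n /=; rewrite !geq_max => /and3P[n1 n2 n3].
have := hN1 n n1; have := hN2 n n2; have := hN3 n n3; rewrite orbit_sumN.
set a := orbit_sum n F x; set s := orbit_sum n _ x => s0 h2 h1.
rewrite distrC ler_norml lerBrDl ler_pdivlMr// lerBlDl ler_pdivrMr//.
by apply/andP; split; lra.
Qed.

Definition left_mass (m : nat) (x : Mstar R) : R := fine (x `[- m%:R, 0[%classic).

Hypothesis left_growth :
  {ae P, forall x : X, forall M : R, exists m, M < left_mass m x}.

(* Seen from the [n]-th cell, the left mass is the mass of the cells before it,
   in units of the mass of that cell: [F m] is close to 1 at the cells much
   heavier than their [m] predecessors. *)
Let F m (x : X) : R := (1 + left_mass m x)^-1.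

Let left_mass_ge0 m x : 0 <= left_mass m x.
Proof. exact: fine_ge0. Qed.

Let F_bound m : bounded_by 1 (F m).
Proof.
move=> x; rewrite ger0_norm; last by rewrite invr_ge0 addr_ge0.
by rewrite invf_le1 ?lerDl// ltr_pwDl.
Qed.

Let measurable_F m : measurable_fun setT (F m).
Proof.
apply: measurable_inv_ge0; first by move=> x; rewrite addr_ge0.
apply: (@measurable_realfun.measurable_funD _ _ _ setT (cst 1)) => //.
apply: (measurableT_comp (f := @fine R)); first by [].
exact: (measurable_Mstar_mass (measurable_itv `[- m%:R, 0[)).
Qed.

Let left_mass_nd m n x : (m <= n)%N -> left_mass m x <= left_mass n x.
Proof.
move=> mn; rewrite /left_mass fine_le ?radon_itv_fin_num//.
apply: le_measure; rewrite ?inE; [exact: measurable_itv|exact: measurable_itv|].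
move=> y; rewrite /= !in_itv/= => /andP[my ->]; rewrite andbT.
by rewrite (le_trans _ my)// lerN2 ler_nat.
Qed.

Let integral_F : (\int[P]_x (F m x)%:E)%E @[m --> \oo] --> 0%E.
Proof.
have h0 : {ae P, forall x : X, setT x -> (F m x)%:E @[m --> \oo] --> (cst 0%E x : \bar R)}.
  apply: filterS left_growth => x xoo _; apply/fine_cvgP; split; first exact: nearW.
  apply/cvgrPdist_le => e e0; have [m hm] := xoo e^-1.
  exists m => // n /= mn; rewrite sub0r normrN ger0_norm ?invr_ge0 ?addr_ge0//.
  rewrite -[leRHS]invrK lef_pV2 ?posrE ?invr_gt0 ?ltr_pwDl//.
  have := left_mass_nd x mn; have := ltW hm; lra.
have dom : {ae P, forall (x : X) m, setT x -> (`|(F m x)%:E| <= cst 1%:E x)%E}.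
  by apply: nearW => x m _; rewrite lee_fin; exact: F_bound.
have i1 : P.-integrable setT (cst 1%:E).
  by apply: (@bounded_integrable _ P 1 (cst 1)) => // x; rewrite normr1.
have mF' m : measurable_fun setT (fun x : X => (F m x)%:E) by exact/measurable_EFinP.
have [_ _] := @dominated_convergence _ _ _ P setT measurableT
  (fun m x => (F m x)%:E) (cst 0%E) (cst 1%:E) mF' (measurable_cst _) h0 i1 dom.
by rewrite integral0.
Qed.

Let h m := cond_exp P J (F m).

Let cond_exp_F_small : {ae P, forall x : X, forall e, 0 < e -> exists m, h m x < e}.
Proof.
have hF m : is_cond_exp P J (F m) (h m).
  apply: (cond_expP sigma_algebra_invariant invariant_measurable).
  exact: bounded_integrable (@F_bound m).
have step (q : rat) : {ae P, forall x : X, 0 < ratr q :> R -> exists m, h m x < ratr q}.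
  have [q0|q0] := leP (ratr q : R) 0; first exact: nearW.
  pose Zm m : set X := h m @^-1` `[ratr q, +oo[.
  have JZ m : J (Zm m) by have [+ _ _] := hF m; apply; exact: measurable_itv.
  have mZ m : measurable (Zm m) by exact: invariant_measurable.
  have bound m : ((ratr q)%:E * P (\bigcap_m Zm m) <= \int[P]_x (F m x)%:E)%E.
    apply: (@le_trans _ _ ((ratr q)%:E * P (Zm m))%E).
      rewrite lee_pmul2l// le_measure ?inE//; first exact: bigcapT_measurable.
      by move=> x; exact.
    rewrite -integral_cst//.
    have [_ ih hE] := hF m.
    apply: (@le_trans _ _ (\int[P]_(x in Zm m) (h m x)%:E)%E).
      apply: le_integral => //.
      - by apply: (integrableS measurableT) => //;
          apply: (@bounded_integrable _ P `|ratr q| (cst (ratr q))) => // x.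
      - exact: (integrableS measurableT).
      - by move=> x; rewrite inE /Zm/= in_itv/= andbT lee_fin.
    have iFm : P.-integrable setT (EFin \o F m) by exact: bounded_integrable (@F_bound m).
    have -> : (\int[P]_(x in Zm m) (h m x)%:E = \int[P]_(x in Zm m) (F m x)%:E)%E.
      rewrite -[LHS]fineK; last first.
        by apply: integrable_fin_num => //; exact: (integrableS measurableT).
      rewrite -[RHS]fineK; last first.
        by apply: integrable_fin_num => //; exact: (integrableS measurableT).
      by congr EFin; exact: (hE _ (JZ m)).
    apply: ge0_subset_integral => //; first exact/measurable_EFinP.
    by move=> x _; rewrite lee_fin invr_ge0 addr_ge0.
  have PZ : ((ratr q)%:E * P (\bigcap_m Zm m) <= 0)%E.
    rewrite -(cvg_lim _ integral_F)//; apply: lime_ge; first exact: cvgP integral_F.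
    exact: nearW.
  exists (\bigcap_m Zm m); split.
  - exact: bigcapT_measurable.
  - apply/eqP; rewrite eq_le measure_ge0 andbT.
    by move: PZ; rewrite pmule_rle0// lte_fin.
  - move=> x /= nx m _; rewrite /Zm/= in_itv/= andbT leNgt; apply/negP => hx.
    by apply: nx => _; exists m.
apply: filterS (ae_forall_rat step) => x hx e e0.
have [q /[!in_itv]/= /andP[q0 qe]] : exists q, ratr q \in `](0 : R), e[.
  exact: rat_in_itvoo.
by have [m hm] := hx q q0; exists m; exact: lt_trans qe.
Qed.

(** The last term alone of the orbit sum of [F m] is of the order of the square
    of the mass of the last cell over the total mass. *)
Let orbit_sum_F m n x : (m <= n)%N ->
  (mass n x) ^+ 2 <= orbit_sum n.+1 (F m) x * orbit_sum n.+1 (cst 1) x.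
Proof.
move=> mn; have [nx|nx] := ltP 0 (mass n x); last first.
  have -> : mass n x = 0 by apply/eqP; rewrite eq_le nx mass_ge0.
  rewrite expr0n/= mulr_ge0 ?orbit_sum1_ge0//; apply: sumr_ge0 => i _.
  by rewrite mulr_ge0 ?mass_ge0// invr_ge0 addr_ge0.
have W : orbit_sum n.+1 (cst 1) x >= mass n x + fine (x `[(n - m)%N%:R, n%:R[%classic).
  have := radon_itv_mass x (n - m) m; rewrite subnK// => ->/=.
  rewrite orbit_sum1 big_ord_recr/= [leLHS]addrC lerD2r.
  rewrite -(big_mkord xpredT (fun k => mass k x)).
  rewrite (big_cat_nat (leq0n _) (leq_subr m n))/= lerDr.
  by apply: sumr_ge0 => i _; exact: mass_ge0.
have last : mass n x * F m (tstar n%:R x) <= orbit_sum n.+1 (F m) x.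
  rewrite /orbit_sum big_ord_recr/= lerDr; apply: sumr_ge0 => i _.
  by rewrite mulr_ge0 ?mass_ge0// invr_ge0 addr_ge0.
have FE : mass n x * F m (tstar n%:R x) *
    (mass n x + fine (x `[(n - m)%N%:R, n%:R[%classic)) = mass n x ^+ 2.
  rewrite /F /left_mass tstar_itv// add0r [- m%:R + _]addrC -natrB//.
  have cf : x `[(n - m)%N%:R, n%:R[%classic \is a fin_num by exact: radon_itv_fin_num.
  rewrite fineM//=; set c := fine _; have c0 : 0 <= c by exact: fine_ge0.
  have w0 : mass n x != 0 by rewrite gt_eqF.
  have wc0 : mass n x + c != 0 by rewrite gt_eqF// ltr_pwDl.
  have -> : 1 + (mass n x)^-1 * c = (mass n x + c) / mass n x.
    by rewrite mulrDl divff// mulrC.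
  by rewrite invf_div mulrA divfK// expr2.
rewrite -FE ler_pM//; last by rewrite addr_ge0 ?mass_ge0 ?fine_ge0.
by rewrite mulr_ge0 ?mass_ge0// invr_ge0 addr_ge0.
Qed.

(** The ratio ergodic theorem bounds the square of the share of the last cell by
    the conditional expectation of [F m], which is small for some [m] because
    [F m] decreases to 0. *)
Lemma mass_negligible : {ae P, forall x : X, forall e, 0 < e -> exists N, forall n,
  (N <= n)%N -> mass n x <= e * orbit_sum n (cst 1) x}.
Proof.
have rat : {ae P, forall x : X, forall m,
    orbit_sum n (F m) x / orbit_sum n (cst 1) x @[n --> \oo] --> h m x}.
  by apply: ae_foralln => m; exact: ratio_ergodic (@F_bound m).
apply: filterS2 (filterI rat cond_exp_F_small) growth => x [ratx hx] xoo e0 e0_gt0.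
pose e := Num.min (1 / 2) (e0 / 2).
have e_gt0 : 0 < e by rewrite lt_min !divr_gt0.
have [m hm] := hx (e ^+ 2) (exprn_gt0 _ e_gt0).
have d0 : 0 < e ^+ 2 - h m x by rewrite subr_gt0.
have /cvgrPdist_lt/(_ _ d0) [N1 _ hN1] := ratx m.
have [N2 hN2] := right_infinite_near 0 xoo.
exists (maxn N1 (maxn N2 m)) => n; rewrite !geq_max => /and3P[n1 n2 n3].
have := hN1 n.+1 (leqW n1); have := hN2 n n2; have := hN2 n.+1 (leqW n2).
have := orbit_sum_F x n3; rewrite /=.
set s1 := orbit_sum n.+1 (cst 1) x; set a := orbit_sum n.+1 (F m) x.
have s1E : s1 = orbit_sum n (cst 1) x + mass n x.
  by rewrite /s1 !orbit_sum1 big_ord_recr.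
move=> h1 s1_gt0 s_gt0; rewrite distrC => /(le_lt_trans (ler_norm _)).
rewrite ltrD2r ltr_pdivrMr// => h2.
have : mass n x ^+ 2 <= (e * s1) ^+ 2.
  rewrite (le_trans h1)// exprMn [s1 ^+ 2]expr2 mulrA ler_wpM2r ?(ltW s1_gt0)//.
  exact: ltW.
rewrite ler_sqr ?nnegrE ?mass_ge0 ?mulr_ge0 ?(ltW e_gt0) ?(ltW s1_gt0)// s1E.
have e1 : e <= 1 / 2 by rewrite ge_min lexx.
have e2 : e <= e0 / 2 by rewrite ge_min lexx orbT.
have := mass_ge0 n x; move: s_gt0; set s := orbit_sum _ _ _; set w := mass n x.
move=> s0 w0 h3.
have h4 : e * w <= 1 / 2 * w by rewrite ler_wpM2r.
have h5 : e * s <= e0 / 2 * s by rewrite ler_wpM2r// ltW.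
have h6 : w <= e * s + e * w by rewrite -mulrDr.
lra.
Qed.

End ergodic_theorem.

(** * Digits, cells and magnifications *)

Section symbolic.
Context {R : realType} {p : nat} {hp : (1 < p)%N}.
Local Notation Omega := (Omega R hp).
Local Notation X := (borel (Mstar R)).
Local Notation past := (@past R p hp).
Local Notation S := (g_sigma_algebraType past).
Implicit Types (w : Omega) (j : 'I_p).

Definition digit_event (n : int) (j : 'I_p) : set Omega :=
  @ihat R p hp n @^-1` [set j : digit hp].

Lemma measurable_digit_event n j : measurable (digit_event n j).
Proof.
apply: sub_sigma_algebra.
have /continuousP : continuous (fun w : points R hp => w.2 n : digit hp).
  move=> w; apply: (@continuous_comp _ {ptws int -> digit hp} _ snd (fun h => h n)).
    exact: cvg_snd.
  exact: continuous_eval.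
by apply; exact: discrete_open.
Qed.

Lemma past_sigma_algebra : sigma_algebra setT past.
Proof. exact: smallest_sigma_algebra. Qed.

Lemma pastE : <<s past >> = past.
Proof. exact: sigma_algebra_id past_sigma_algebra. Qed.

Lemma past_measurable A : past A -> measurable (A : set Omega).
Proof.
apply: (@smallest_sub _ _ _ (@measurable _ Omega)); first exact: sigma_algebra_measurable.
move=> B [[C mC <-]|[n [j [_ ->]]]].
  by rewrite -[X in measurable X]setTI; apply: measurable_nuhat.
exact: measurable_digit_event.
Qed.

Lemma past_nuhat (B : set X) : measurable B -> past (@nuhat R p hp @^-1` B).
Proof. by move=> mB; apply: sub_sigma_algebra; left; exists B. Qed.

Lemma past_digit n j : n <= 0 -> past (digit_event n j).
Proof. by move=> n0; apply: sub_sigma_algebra; right; exists n, j. Qed.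

Lemma measurable_past_nuhat : measurable_fun [set: S] (@nuhat R p hp : S -> X).
Proof. by move=> _ B mB; rewrite setTI /measurable/= pastE; exact: past_nuhat. Qed.

Lemma past_measurable_fun d (Y : measurableType d) (f : Omega -> Y) :
  measurable_fun [set: S] (f : S -> Y) -> measurable_fun [set: Omega] f.
Proof.
move=> mf _ B mB; rewrite setTI; apply: past_measurable.
have := mf measurableT B mB; rewrite setTI; rewrite /measurable/= pastE.
exact.
Qed.

(** The position, in units of the current scale, of the unit interval inside the
    unit interval of [n] steps before: it is the index of the cell of generation
    [n] that has been magnified since then. *)
Definition last_digits (n : nat) w : nat :=
  (\sum_(m < n) p ^ m * digit_nat (ihat (- m%:Z) w))%N.

Lemma ihat_Mp (n : int) w : ihat n (Mp w) = ihat (n + 1) w.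
Proof. by []. Qed.

Lemma last_digits_Mp n w :
  last_digits n.+1 (Mp w) = (digit_nat (ihat 1 w) + p * last_digits n w)%N.
Proof.
rewrite /last_digits big_ord_recl expn0 mul1n ihat_Mp oppr0 add0r; congr (_ + _)%N.
rewrite big_distrr; apply: eq_bigr => i _; rewrite ihat_Mp/= mulnA -expnS.
by rewrite /bump/= add1n intS opprD addrAC addNr add0r.
Qed.

Lemma last_digits_past n k : past (last_digits n @^-1` [set k]).
Proof.
rewrite -pastE; suff : measurable (last_digits n @^-1` [set k] : set S) by [].
elim: n k => [|n ih] k.
  have [->|k0] := eqVneq k 0%N.
    rewrite (_ : _ @^-1` _ = setT)//; apply/seteqP; split => // w _.
    by rewrite /last_digits/= big_ord0.
  rewrite (_ : _ @^-1` _ = set0)//; apply/seteqP; split => // w /=.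
  by rewrite /last_digits/= big_ord0 => e; rewrite e eqxx in k0.
rewrite (_ : _ @^-1` _ = \bigcup_a (\bigcup_(b : 'I_p)
   (if (a + p ^ n * b)%N == k then
     (last_digits n @^-1` [set a]) `&` digit_event (- n%:Z) b else set0))).
  apply: bigcupT_measurable => a; apply: countable_bigcupT_measurable => // b.
  case: ifP => // _; apply: measurableI; first exact: ih.
  by rewrite /measurable/= pastE; apply: past_digit; rewrite oppr_le0.
apply/seteqP; split => [w /= wk|w [a _ [b _]]].
  exists (last_digits n w) => //; exists (ihat (- n%:Z) w : 'I_p) => //.
  by rewrite -wk /last_digits big_ord_recr/= eqxx.
case: ifP => // /eqP <- [/= <- wb]; rewrite /last_digits big_ord_recr/=.
by rewrite wb.
Qed.

Lemma pexp_neq0 n : (p%:R ^+ n : R) != 0.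
Proof. by rewrite expf_neq0// pnatr_eq0 -lt0n ltnW. Qed.

Lemma p_gt0 : (0 : R) < p%:R.
Proof. by rewrite ltr0n ltnW. Qed.

Lemma pexp_gt0 n : (0 : R) < p%:R ^+ n.
Proof. by rewrite exprn_gt0// p_gt0. Qed.

Definition magnify n (J : nat) (x : Mstar R) : Mstar R :=
  zoom (- J%:R) (pexp_neq0 n) x.

Definition cell n (J : nat) : set R :=
  `[J%:R / p%:R ^+ n, J.+1%:R / p%:R ^+ n[%classic.

Lemma measurable_cell n J : measurable (cell n J).
Proof. exact: measurable_itv. Qed.

Lemma digit_itvE (j : 'I_p) : @digit_itv R p hp j = cell 1 j.
Proof. by rewrite /digit_itv /cell expr1. Qed.

Lemma Mp_nuhat w : nuhat (Mp w) = magnify 1 (digit_nat (ihat 1 w)) (nuhat w).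
Proof.
rewrite -[LHS]/(zoom (- (digit_nat (ihat 1 w))%:R) (p_neq0 R hp) (nuhat w)).
by apply: zoom_eq; rewrite ?expr1.
Qed.

Lemma magnify0 (x : Mstar R) : magnify 0 0 x = x.
Proof.
rewrite -[RHS](zoom_id x (oner_neq0 R)).
by apply: zoom_eq; rewrite ?expr0 ?oppr0.
Qed.

Lemma magnify_magnify n (J j : nat) (x : Mstar R) :
  magnify 1 j (magnify n J x) = magnify n.+1 (j + p * J) x.
Proof.
have E := @zoom_comp R _ (- j%:R) _ (- J%:R) (pexp_neq0 1) (pexp_neq0 n)
  (mulf_neq0 (pexp_neq0 1) (pexp_neq0 n)) x.
rewrite /magnify E; apply: zoom_eq; first by rewrite expr1 -exprS.
by rewrite expr1 natrD natrM opprD mulrN addrC.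
Qed.

Lemma tstar_magnify n J k (x : Mstar R) :
  tstar k%:R (magnify n J x) = magnify n (J + k) x.
Proof.
have E := @zoom_comp R _ (- k%:R) _ (- J%:R) (oner_neq0 R) (pexp_neq0 n)
  (mulf_neq0 (oner_neq0 R) (pexp_neq0 n)) x.
rewrite /magnify tstarE E; by apply: zoom_eq; rewrite mul1r// natrD opprD.
Qed.

Lemma magnifyE n J (x : Mstar R) A : measurable A -> (0 < x (cell n J))%E ->
  magnify n J x A = (((fine (x (cell n J)))^-1)%:E *
    x (affine (p%:R ^+ n) (- J%:R) @^-1` A))%E.
Proof.
move=> mA xJ; have e : `[(- (- J%:R) / p%:R ^+ n : R), ((1 - (- J%:R)) / p%:R ^+ n : R)[%classic
   = cell n J by rewrite !opprK addrC natr1.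
by rewrite /magnify zoomE ?e ?pexp_gt0.
Qed.

Lemma cell_fin n J (x : Mstar R) : x (cell n J) \is a fin_num.
Proof. exact: radon_itv_fin_num. Qed.

Lemma preimage_cell n J m K :
  affine (p%:R ^+ n) (- J%:R) @^-1` (cell m K) = cell (n + m) (K + p ^ m * J).
Proof.
rewrite /cell preimage_affine_itv ?pexp_gt0// !opprK.
have e (a : nat) : (a%:R / p%:R ^+ m + J%:R) / p%:R ^+ n =
    (a + p ^ m * J)%:R / p%:R ^+ (n + m) :> R.
  rewrite natrD natrM natrX exprD invfM (mulrC (_ ^+ n)^-1) mulrA; congr (_ * _).
  by rewrite mulrDl mulrAC divff ?mul1r// pexp_neq0.
by rewrite !e addSn.
Qed.

(** The restriction of a magnification to the cells is the original measure, up
    to the mass of the magnified cell, which also covers the null case. *)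
Lemma magnify_cell n J m K (x : Mstar R) :
  (x (cell n J) * magnify n J x (cell m K))%E = (if x (cell n J) == 0%E then 0%E else
    x (cell (n + m) (K + p ^ m * J))).
Proof.
case: ifPn => [/eqP ->|x0]; first by rewrite mul0e.
have xp : (0 < x (cell n J))%E by rewrite lt0e x0 measure_ge0.
rewrite magnifyE//; last exact: measurable_cell.
rewrite preimage_cell muleA -{1}(fineK (cell_fin n J x)) -EFinM divff ?mul1e//.
by rewrite gt_eqF// fine_gt0// xp -ge0_fin_numE// cell_fin.
Qed.

Lemma cell_subset n (J j : nat) : (j < p)%N -> cell n.+1 (j + p * J) `<=` cell n J.
Proof.
move=> jp x; rewrite /cell/= !in_itv/= => /andP[h1 h2].
rewrite !ler_pdivrMr ?pexp_gt0// !ltr_pdivlMr ?pexp_gt0// in h1 h2 *.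
have p0 := p_gt0; move: h1 h2; rewrite exprS mulrCA.
move=> h1 h2; apply/andP; split.
  rewrite -(ler_pM2l p0); apply: le_trans h1.
  by rewrite -natrM ler_nat leq_addl.
rewrite -(ltr_pM2l p0); apply: (lt_le_trans h2).
by rewrite -natrM ler_nat mulnS -addSn leq_add2r.
Qed.

Lemma magnify_digit n (J j : nat) (x : Mstar R) : (j < p)%N ->
  (x (cell n J) * magnify n J x (cell 1 j) = x (cell n.+1 (j + p * J)))%E.
Proof.
move=> jp; rewrite magnify_cell addn1 expn1; case: ifPn => // /eqP x0.
apply/esym/eqP; rewrite eq_le measure_ge0 andbT -x0.
apply: le_measure; rewrite ?inE; [exact: measurable_cell|exact: measurable_cell|].
exact: cell_subset.
Qed.

End symbolic.

(** * The law of the last digits *)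

Section adaptedness.
Context {R : realType} {p : nat} {hp : (1 < p)%N} (Q : probability (Omega R hp) R).
Local Notation Omega := (Omega R hp).
Local Notation X := (borel (Mstar R)).
Local Notation past := (@past R p hp).
Local Notation S := (g_sigma_algebraType past).
Local Notation cell := (@cell R p).
Implicit Types (w : Omega) (j : 'I_p) (x : X).
Local Open Scope ereal_scope.

Let forget : Omega -> S := id.

Let measurable_forget : measurable_fun setT forget.
Proof. by move=> _ A mA; rewrite setTI; apply: past_measurable; rewrite -pastE. Qed.

HB.instance Definition _ := isMeasurableFun.Build _ _ Omega S forget measurable_forget.

Lemma measurable_cell_mass n J : measurable_fun [set: X] (fun x : X => (x : Mstar R) (cell n J)).
Proof. by apply: measurable_Mstar_mass; exact: measurable_cell. Qed.

Lemma measurable_nuhat_cell n J :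
  measurable_fun [set: Omega] (fun w => (nuhat w : Mstar R) (cell n J)).
Proof. exact: (measurableT_comp (measurable_cell_mass n J) (@measurable_nuhat R p hp)). Qed.

Hypothesis Qadapted : adapted Q.

(** Adaptedness in integrated form, on the events of the past. *)
Lemma adapted_set (A : set Omega) j : past A ->
  Q (A `&` digit_event 1 j) = \int[Q]_(w in A) (nuhat w : Mstar R) (cell 1 j).
Proof.
move=> pA; have mA := past_measurable pA; have mE := measurable_digit_event (R := R) (hp := hp) 1 j.
have iE : Q.-integrable setT (EFin \o (\1_(digit_event 1 j) : Omega -> R)).
  by apply: integrable_indic.
have [_ ih hE] := cond_expP past_sigma_algebra (@past_measurable R p hp) iE.
have {}hE := hE _ pA; have ihA := integrableS measurableT mA (@subsetT _ A) ih.
have {}iE := integrableS measurableT mA (@subsetT _ A) iE.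
transitivity (\int[Q]_(w in A) (\1_(digit_event 1 j) w)%:E).
  by rewrite integral_indic// setIC.
have fin1 := integrable_fin_num mA iE; have fin2 := integrable_fin_num mA ihA.
move: hE; rewrite /Rintegral => hE.
transitivity (\int[Q]_(w in A) (cond_exp Q past \1_(digit_event 1 j) w)%:E).
  by rewrite -(fineK fin1) -[RHS](fineK fin2); congr EFin.
apply: ae_eq_integral => //.
- exact: measurable_int ihA.
- exact: measurable_funTS (measurable_nuhat_cell 1 j).
- by move: (Qadapted (j : digit hp)); apply: filterS => w h _ /=; rewrite -digit_itvE -h.
Qed.

(** The same against nonnegative functions of the past, through the density of
    the restriction of [Q] to the event that the next digit is [j]. *)
Lemma digit_integral (phi : Omega -> \bar R) j :
  measurable_fun [set: S] (phi : S -> \bar R) -> (forall w, 0 <= phi w) ->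
  \int[Q]_w (phi w * (\1_(digit_event 1 j) w)%:E) =
  \int[Q]_w (phi w * (nuhat w : Mstar R) (cell 1 j)).
Proof.
move=> mphi phi0; have mE := measurable_digit_event (R := R) (hp := hp) 1 j.
have mphi' := past_measurable_fun mphi.
pose m1 := pushforward (mrestr Q mE) forget.
pose m2 := pushforward Q forget.
pose g (w : S) : \bar R := (nuhat w : Mstar R) (cell 1 j).
have mg : measurable_fun [set: S] g.
  exact: (measurableT_comp (measurable_cell_mass 1 j) measurable_past_nuhat).
have /(_ measurable_forget measurable_forget) :=
  @ge0_integral_density _ S R m1 m2 g phi mg _ _ mphi phi0.
rewrite !ge0_integral_pushforward//; last 2 first.
- by apply: emeasurable_funM.
- by move=> y _; rewrite mule_ge0.
rewrite preimage_setT ge0_integral_mrestr// => <-//.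
- by rewrite [RHS]integral_mkcond; apply: eq_integral => w _; rewrite patchE indicE;
    case: ifP => _; rewrite ?mule1 ?mule0.
- by move=> x; exact: cell_fin.
- move=> A mA; rewrite ge0_integral_pushforward//.
  + have pA : past A by rewrite -pastE.
    exact: adapted_set.
  + exact: measurable_funTS.
Qed.

End adaptedness.

Section invariance.
Context {R : realType} {p : nat} {hp : (1 < p)%N} (Q : probability (Omega R hp) R).
Local Notation Omega := (Omega R hp).
Local Notation X := (borel (Mstar R)).
Local Notation past := (@past R p hp).
Local Notation S := (g_sigma_algebraType past).
Local Notation cell := (@cell R p).
Implicit Types (w : Omega) (j : 'I_p) (x : X).
Local Open Scope ereal_scope.

Hypothesis Qinv : invariant_distribution Q.

(** The functions [g] and [g \o Mp] have the same law under [Q]. *)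
Lemma invariant_integral (g : Omega -> \bar R) : measurable_fun setT g ->
  measurable_fun setT (g \o @Mp R p hp) -> (forall w, 0 <= g w) ->
  \int[Q]_w g (Mp w) = \int[Q]_w g w.
Proof.
move=> mg mgM g0; pose nn := (fun y : \bar R => `|y|).
have mn : measurable_fun [set: \bar R] nn by exact: abse_measurable.
pose u : {mfun Omega >-> \bar R} := mfun_Sub (mem_set mg).
pose v : {mfun Omega >-> \bar R} := mfun_Sub (mem_set mgM).
have E (k : Omega -> \bar R) : (forall w, 0 <= k w) ->
    \int[Q]_w k w = \int[Q]_w (nn \o k) w.
  by move=> k0; apply: eq_integral => w _; rewrite /= /nn gee0_abs.
rewrite [LHS]E// [RHS]E//.
rewrite -[RHS](@ge0_integral_distribution _ _ _ _ _ Q u nn)//; last by move=> y; exact: abse_ge0.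
rewrite -[LHS](@ge0_integral_distribution _ _ _ _ _ Q v nn)//; last by move=> y; exact: abse_ge0.
apply: eq_measure_integral => A mA _.
rewrite -[LHS]/(Q (@Mp R p hp @^-1` (g @^-1` A))) -[RHS]/(Q (g @^-1` A)); apply: Qinv.
by rewrite -[X in measurable X]setTI; exact: (mg measurableT A mA).
Qed.

Hypothesis Qadapted : adapted Q.

(** On the event that the cell of [j] is null, [j] has conditional probability
    zero. *)
Lemma charged_digit : {ae Q, forall w, (0 < (nuhat w : Mstar R) (cell 1 (digit_nat (ihat 1 w))))}.
Proof.
have h j : {ae Q, forall w, digit_event 1 j w -> 0 < (nuhat w : Mstar R) (cell 1 j)}.
  pose A := [set w : Omega | (nuhat w : Mstar R) (cell 1 j) = 0].
  have pA : past A.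
    apply: (@past_nuhat R p hp [set x : X | (x : Mstar R) (cell 1 j) = 0]).
    rewrite -[X in measurable X]setTI.
    exact: (measurable_cell_mass 1 j measurableT (emeasurable_set1 0)).
  have mA := past_measurable pA.
  have mE := measurable_digit_event (R := R) (hp := hp) 1 j.
  have : Q (A `&` digit_event 1 j) = 0.
    by rewrite (adapted_set Qadapted)// integral0_eq.
  move=> /(proj2 (negligibleP _ (measurableI _ _ mA mE))).
  apply: negligibleS => w /= /not_implyP[Ew /negP].
  by rewrite -leNgt measure_le0 => /eqP.
have : {ae Q, forall w, forall k : nat, forall j, nat_of_ord j = k ->
    digit_event 1 j w -> 0 < (nuhat w : Mstar R) (cell 1 j)}.
  apply: ae_foralln => k; have [kp|kp] := ltnP k p; last first.
    by apply: aeW => w j jk; move: (ltn_ord j); rewrite jk ltnNge kp.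
  by apply: filterS (h (Ordinal kp)) => w hw j jk; rewrite (_ : j = Ordinal kp)//; exact: val_inj.
by apply: filterS => w /(_ _ _ erefl); apply.
Qed.

Lemma nuhat_unit : {ae Q, forall w, (nuhat w : Mstar R) `[0%R, 1%R[%classic = 1}.
Proof.
apply: filterS charged_digit => w h.
have [e|//] := Mstar_unit (nuhat w : Mstar R).
have : (nuhat w : Mstar R) (cell 1 (digit_nat (ihat 1 w))) <= 0.
  rewrite -e; apply: le_measure; rewrite ?inE//=.
    exact: measurable_cell.
  have e0 : `[0%R, 1%R[%classic = cell 0 0 by rewrite /cell expr0 invr1 !mulr1.
  rewrite e0; have := @cell_subset R p hp 0 0 (digit_nat (ihat 1 w)).
  by rewrite muln0 addn0; apply; exact: (ltn_ord (ihat 1 w : 'I_p)).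
by rewrite leNgt h.
Qed.

Lemma sum_digits n (F : nat -> \bar R) :
  (\sum_(K < p ^ n.+1) F K = \sum_(J < p ^ n) \sum_(j < p) F (j + p * J)%N).
Proof.
rewrite expnSr -(big_mkord xpredT F) big_nat_mul big_mkord.
apply: eq_bigr => J _; rewrite -{1}[(J * p)%N]add0n big_addn mulSn addnK big_mkord.
by apply: eq_bigr => j _; rewrite mulnC.
Qed.

Lemma measurable_magnify n J :
  measurable_fun setT (magnify (hp := hp) n J : X -> X).
Proof. exact: measurable_zoom. Qed.

(** By invariance the current measure has the law of a magnification of the
    measure [n] steps before, along the digits read since then, and by
    adaptedness these digits select a cell according to its mass. The induction
    separates the last digit read. *)
Lemma last_digits_integral n (psi : nat -> X -> \bar R) :
  (forall J, measurable_fun setT (psi J)) -> (forall J x, 0 <= psi J x) ->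
  \int[Q]_w psi (last_digits n w) (nuhat w) =
  \int[Q]_w \sum_(J < p ^ n) ((nuhat w : Mstar R) (cell n J) *
                            psi J (magnify (hp := hp) n J (nuhat w))).
Proof.
elim: n psi => [|n ih] psi mpsi psi0.
  apply: ge0_ae_eq_integral => //.
  - apply: (measurable_glue (idx := @last_digits R p hp 0) (g := fun k w => psi k (nuhat w))).
      by move=> k; apply: past_measurable; exact: last_digits_past.
    by move=> k; exact: (measurableT_comp (mpsi k) (@measurable_nuhat R p hp)).
  - apply: emeasurable_sum => J _; apply: emeasurable_funM => //; first exact: measurable_nuhat_cell.
    exact: (measurableT_comp (mpsi J)
      (measurableT_comp (measurable_magnify 0 J) (@measurable_nuhat R p hp))).
  - by move=> w _; apply: sume_ge0 => J _; exact: mule_ge0.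
  apply: filterS nuhat_unit => w h _ /=.
  rewrite expn0 big_ord_recl big_ord0 adde0 magnify0 /cell expr0 invr1 !mulr1 h mul1e.
  by rewrite /last_digits big_ord0.
pose psi1 J x := \sum_(j < p) ((x : Mstar R) (cell 1 j) *
   psi (j + p * J)%N (magnify (hp := hp) 1 j x)).
have mpsi1 J : measurable_fun setT (psi1 J : X -> \bar R).
  apply: emeasurable_sum => j _; apply: emeasurable_funM => //; first exact: measurable_cell_mass.
  exact: (measurableT_comp (mpsi _) (measurable_magnify _ _)).
have psi10 J x : 0 <= psi1 J x by apply: sume_ge0 => j _; exact: mule_ge0.
have mphi j : measurable_fun [set: S]
    (fun w => psi (j + p * last_digits n w)%N (magnify (hp := hp) 1 j (nuhat w))).
  apply: (measurable_glue (X := S) (idx := @last_digits R p hp n)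
    (g := fun k w => psi (j + p * k)%N (magnify (hp := hp) 1 j (nuhat w)))).
    by move=> k; rewrite /measurable/= pastE; exact: last_digits_past.
  move=> k; apply: (measurableT_comp (mpsi _)).
  exact: (measurableT_comp (measurable_magnify _ _) measurable_past_nuhat).
have mphi' j := past_measurable_fun (mphi j).
have mind j : measurable_fun setT (fun w : Omega => (\1_(digit_event 1 j) w)%:E : \bar R).
  by apply/measurable_EFinP/measurable_indic; exact: measurable_digit_event.
have split_digits w : psi (last_digits n.+1 (Mp w)) (nuhat (Mp w)) =
    \sum_(j < p) (psi (j + p * last_digits n w)%N (magnify (hp := hp) 1 j (nuhat w)) *
                  (\1_(digit_event 1 j) w)%:E).
  rewrite last_digits_Mp Mp_nuhat (bigD1 (ihat 1 w : 'I_p))//= big1 ?adde0.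
    by rewrite indicE mem_set// mule1.
  move=> j jw; rewrite indicE memNset ?mule0// => e.
  by move: jw; rewrite -e eqxx.
rewrite -[LHS]invariant_integral//; last 2 first.
- apply: (measurable_glue (idx := @last_digits R p hp n.+1) (g := fun k w => psi k (nuhat w))).
    by move=> k; apply: past_measurable; exact: last_digits_past.
  by move=> k; exact: (measurableT_comp (mpsi k) (@measurable_nuhat R p hp)).
- rewrite /comp; under eq_fun do rewrite split_digits.
  apply: emeasurable_sum => j _; apply: emeasurable_funM => //; exact: mphi'.
under eq_integral do rewrite split_digits.
rewrite ge0_integral_sum//; last 2 first.
- by move=> j; apply: emeasurable_funM => //; exact: mphi'.
- by move=> j w _; exact: mule_ge0.
under eq_bigr do rewrite (digit_integral Qadapted _ (mphi _))//.
rewrite -ge0_integral_sum//; last 2 first.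
- by move=> j; apply: emeasurable_funM => //; exact: measurable_nuhat_cell.
- by move=> j w _; exact: mule_ge0.
transitivity (\int[Q]_w psi1 (last_digits n w) (nuhat w)).
  by apply: eq_integral => w _; apply: eq_bigr => j _; rewrite muleC.
rewrite ih//; apply: eq_integral => w _; rewrite [RHS](sum_digits n (fun J =>
  (nuhat w : Mstar R) (cell n.+1 J) * psi J (magnify (hp := hp) n.+1 J (nuhat w)))).
apply: eq_bigr => J _; rewrite /psi1 ge0_sume_distrr; last by move=> j _; exact: mule_ge0.
apply: eq_bigr => j _; rewrite muleA magnify_digit// magnify_magnify//.
Qed.

End invariance.

Lemma ae_full d (T : measurableType d) (R : realType) (P : probability T R) D :
  measurable D -> P D = 1%E -> {ae P, forall x, D x}.
Proof.
move=> mD D1; apply/(negligibleP _ (measurableC mD)).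
have h := probability_setC P mD; rewrite D1 subee// in h; exact: h.
Qed.

(** * Determinism and infinite mass *)

Section growth.
Context {R : realType} {p : nat} {hp : (1 < p)%N} (Q : probability (Omega R hp) R).
Local Notation Omega := (Omega R hp).
Local Notation X := (borel (Mstar R)).
Local Notation past := (@past R p hp).
Local Notation cell := (@cell R p).
Implicit Types (w : Omega) (j : 'I_p) (x : X).
Local Open Scope ereal_scope.

Let QT : Q setT = 1. Proof. exact: probability_setT. Qed.

Hypothesis Qinv : invariant_distribution Q.
Hypothesis Qadapted : adapted Q.

Lemma ae_digit (Pr : Omega -> 'I_p -> Prop) :
  (forall j, {ae Q, forall w, Pr w j}) -> {ae Q, forall w, forall j, Pr w j}.
Proof.
move=> h; have : {ae Q, forall w, forall k : nat, forall j, nat_of_ord j = k -> Pr w j}.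
  apply: ae_foralln => k; have [kp|kp] := ltnP k p; last first.
    by apply: aeW => w j jk; move: (ltn_ord j); rewrite jk ltnNge kp.
  by apply: filterS (h (Ordinal kp)) => w hw j jk; rewrite (_ : j = Ordinal kp)//; exact: val_inj.
by apply: filterS => w /(_ _ _ erefl).
Qed.

Lemma cell1_bounds j : [/\ (0 <= (nat_of_ord j)%:R / p%:R :> R)%R,
   ((nat_of_ord j)%:R / p%:R <= (nat_of_ord j).+1%:R / p%:R :> R)%R &
   ((nat_of_ord j).+1%:R / p%:R <= 1 :> R)%R].
Proof.
have pp : (0 < p%:R :> R)%R by rewrite ltr0n ltnW.
split; first by rewrite divr_ge0.
- by rewrite ler_pM2r ?invr_gt0// ler_nat.
- by rewrite ler_pdivrMr// mul1r ler_nat.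
Qed.

Lemma sum_cells (nu : radon R) n :
  nu `[0%R, (n%:R / p%:R)%R[%classic = \sum_(j < n) nu (cell 1 j).
Proof.
elim: n => [|n ih]; first by rewrite big_ord0 mul0r set_itv_ge ?measure0//= ltxx.
rewrite big_ord_recr/= -ih /cell expr1 -radon_itv_split//.
by rewrite ler_pM2r ?ler_nat// invr_gt0 ltr0n ltnW.
Qed.

(** For every [j], adaptedness makes either the cell of [j] or [C j] null.
    Applied to two charged cells this contradicts the separation by [C], so that
    one cell carries the whole mass and the next digit is determined. *)
Lemma deterministic_of (C : 'I_p -> set R) : (forall j, measurable (C j)) ->
  (forall i j, i != j -> cell 1 i `<=` C j \/ cell 1 j `<=` C i) ->
  {ae Q, forall w, (nuhat w : Mstar R) (C (ihat 1 w : 'I_p)) = 0} -> deterministic Q.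
Proof.
move=> mC sepC C0.
have h j : {ae Q, forall w, (nuhat w : Mstar R) (cell 1 j) = 0 \/ (nuhat w : Mstar R) (C j) = 0}.
  pose A := [set w : Omega | (nuhat w : Mstar R) (C j) != 0].
  have mnC : measurable_fun [set: X] (fun x : X => (x : Mstar R) (C j)).
    exact: measurable_Mstar_mass.
  have pA : past A.
    apply: (@past_nuhat R p hp [set x : X | (x : Mstar R) (C j) != 0]).
    rewrite (_ : [set _ | _] = ~` [set x : X | (x : Mstar R) (C j) = 0]).
      apply: measurableC; rewrite -[X in measurable X]setTI.
      exact: (mnC measurableT _ (emeasurable_set1 0)).
    by apply/seteqP; split => x /= /eqP.
  have mA := past_measurable pA.
  have mE := measurable_digit_event (R := R) (hp := hp) 1 j.
  have QAE : Q (A `&` digit_event 1 j) = 0.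
    apply/(negligibleP _ (measurableI _ _ mA mE)).
    move: C0; apply: negligibleS => w [/= /eqP Aw Ew] /=.
    by apply: contra_not Aw => <-; rewrite Ew.
  have mcell := measurable_nuhat_cell (R := R) (hp := hp) 1 j.
  have : \int[Q]_(w in A) `|(nuhat w : Mstar R) (cell 1 j)| = 0.
    by rewrite -QAE (adapted_set Qadapted)//; apply: eq_integral => w _; rewrite gee0_abs.
  move/(ae_eq_integral_abs _ mA (measurable_funTS mcell)).
  apply: filterS => w hw; have [->|/eqP wA] := pselect ((nuhat w : Mstar R) (C j) = 0); first by right.
  by left; exact: hw.
have ad := ae_digit (fun j => Qadapted (j : digit hp)).
have cd := charged_digit Qadapted; have nu1 := nuhat_unit Qadapted.
apply: filterS (filterI (filterI ad cd) (filterI nu1 (filterI C0 (ae_digit h)))).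
move=> w [[{}ad {}cd] [{}nu1 [{}C0 {}h]]].
have le0 (A B : set R) : measurable A -> measurable B -> A `<=` B ->
    (nuhat w : Mstar R) B = 0 -> (nuhat w : Mstar R) A = 0.
  move=> mA mB AB B0; apply/eqP; rewrite -measure_le0 -B0.
  by apply: le_measure; rewrite ?inE.
have z j : j != (ihat 1 w : 'I_p) -> (nuhat w : Mstar R) (cell 1 j) = 0.
  move=> jw; have [//|Cj] := h j.
  have [sub|sub] := sepC _ _ jw.
    exact: le0 (measurable_cell _ _) (mC _) sub C0.
  have := le0 _ _ (measurable_cell _ _) (mC _) sub Cj.
  by move=> e; move: cd; rewrite /digit_nat e ltxx.
have := ad (ihat 1 w : 'I_p); rewrite digit_itvE => e; apply: EFin_inj.
rewrite [LHS]e -nu1.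
have := sum_cells (nuhat w : Mstar R) p; rewrite divff; last exact: p_neq0.
move=> ->; rewrite (bigD1 (ihat 1 w : 'I_p))//= big1 ?adde0// => j jw.
Qed.

Hypothesis Qerg : ergodic Q.

Lemma measurable_nuhat_Mp : measurable_fun [set: Omega] (fun w => nuhat (Mp w) : X).
Proof.
under eq_fun do rewrite Mp_nuhat.
apply: (measurable_glue (idx := fun w : Omega => ihat 1 w : 'I_p)
  (g := fun j w => magnify (hp := hp) 1 (nat_of_ord j) (nuhat w) : X)).
  by move=> j; exact: measurable_digit_event.
by move=> j; exact: (measurableT_comp (measurable_magnify 1 j) (@measurable_nuhat R p hp)).
Qed.

(** The mass [Y] of [B] grows along the dynamics, at least by the mass of the
    part [C j] of the unit interval that the next digit [j] sends into [B].
    Finiteness of [Y] is an invariant event; were it almost sure, [(1 + Y)^-1]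
    would decrease along the dynamics and keep its mean, so that [Y] would be
    invariant and nothing would be sent into [B]. *)
Lemma infinite_mass (B : set R) (C : 'I_p -> set R) :
  measurable B -> (forall j, measurable (C j)) -> (forall j, C j `&` B = set0) ->
  (forall j, C j `<=` `[0%R, 1%R[) ->
  (forall j, affine p%:R (- j%:R) @^-1` B = C j `|` B) ->
  ~ {ae Q, forall w, (nuhat w : Mstar R) (C (ihat 1 w : 'I_p)) = 0} ->
  {ae Q, forall w, (nuhat w : Mstar R) B = +oo}.
Proof.
move=> mB mC CB C1 pB nC.
pose Y (w : Omega) : \bar R := (nuhat w : Mstar R) B.
have mY : measurable_fun [set: Omega] Y.
  exact: (measurableT_comp (measurable_Mstar_mass mB) (@measurable_nuhat R p hp)).
have YU w j : (nuhat w : Mstar R) (C j `|` B) = (nuhat w : Mstar R) (C j) + Y w.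
  by rewrite measureU.
have Cfin w j : (nuhat w : Mstar R) (C j) < +oo.
  apply: le_lt_trans (radon_itv_fin (nuhat w : Mstar R) 0 1).
  apply: le_measure; rewrite ?inE; [exact: mC|exact: (measurable_itv `[0%R, 1%R])|].
  by move=> z /(C1 j); rewrite /= !in_itv/= => /andP[-> /ltW].
pose D := [set w : Omega | Y w < +oo].
have mD : measurable D.
  rewrite (_ : D = ~` (Y @^-1` [set +oo])).
    apply: measurableC; rewrite -[X in measurable X]setTI.
    exact: (mY measurableT _ (emeasurable_set1 +oo)).
  by apply/seteqP; split => w /=; rewrite /D/= ltey => /eqP.
have DM : @Mp R p hp @^-1` D = D.
  have e w : Y (Mp w) < +oo <-> Y w < +oo.
    rewrite /Y /= NstarE.
    have [c c0 ->//] := normalizeE (rho (w.2 1%R) w.1).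
    rewrite (radon_affineE _ _ _ mB) pB YU; split => h.
      apply: (@le_lt_trans _ _ ((nuhat w : Mstar R) (C (w.2 1%R)) + Y w)); first exact: leeDr.
      by rewrite ltey; apply: contraTneq h => ->; rewrite gt0_muley ?lte_fin// ltxx.
    by rewrite lte_mul_pinfty ?lee_fin ?(ltW c0)// lte_add_pinfty.
  by apply/seteqP; split => w /=; rewrite /D/= => /e.
have [D0|D1] := Qerg mD DM.
  move: D0 => /(proj2 (negligibleP _ mD)); apply: negligibleS => w /= h.
  by rewrite /D/= ltey; exact/eqP.
exfalso; apply: nC.
have Yfin : {ae Q, forall w, Y w < +oo} := ae_full mD D1.
pose g (w : Omega) : R := (1 + fine (Y w))^-1%R.
have mYM : measurable_fun [set: Omega] (Y \o @Mp R p hp).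
  exact: (measurableT_comp (measurable_Mstar_mass mB) measurable_nuhat_Mp).
have finv_meas (Z : Omega -> \bar R) : measurable_fun setT Z -> (forall w, 0 <= Z w) ->
    measurable_fun setT (fun w => (1 + fine (Z w))^-1%R).
  move=> mZ Z0; apply: measurable_inv_ge0; first by move=> w; rewrite addr_ge0// fine_ge0.
  apply: measurable_realfun.measurable_funD => //.
  exact: (measurableT_comp (f := @fine R)).
have mg : measurable_fun setT g by apply: finv_meas.
have mgM : measurable_fun setT (g \o @Mp R p hp).
  by apply: (finv_meas _ mYM) => w; exact: measure_ge0.
have g01 w : (0 <= g w <= 1)%R.
  have y0 : (0 <= fine (Y w))%R by rewrite fine_ge0.
  by rewrite invr_ge0 addr_ge0//= invf_le1 ?lerDl// ltr_pwDl.
have ig (k : Omega -> R) : measurable_fun setT k -> (forall w, 0 <= k w <= 1)%R ->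
    Q.-integrable setT (EFin \o k).
  move=> mk k01; apply: measurable_bounded_integrable => //.
    by apply: (@le_lt_trans _ _ 1); [rewrite le_eqVlt; apply/orP; left; apply/eqP|exact: ltry].
  exists 1%R; split; first exact: num_real.
  move=> M M1 w _ /=; have /andP[k0 k1] := k01 w.
  by rewrite ger0_norm// (le_trans k1)// ltW.
have iG := ig _ mg g01; have iGM := ig _ mgM (fun w => g01 (Mp w)).
have eqI : \int[Q]_w ((g w)%:E - (g (Mp w))%:E) = 0.
  rewrite (integralB_EFin _ iG iGM)//.
  rewrite (invariant_integral Qinv (g := EFin \o g))//; last 3 first.
  - exact/measurable_EFinP.
  - exact/measurable_EFinP.
  - by move=> w; rewrite lee_fin; case/andP: (g01 w).
  by rewrite subee// integrable_fin_num.
have grow : {ae Q, forall w, [/\ Y w \is a fin_num, Y (Mp w) \is a fin_num &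
    Y w + (nuhat w : Mstar R) (C (ihat 1 w : 'I_p)) <= Y (Mp w)]}.
  apply: filterS (filterI Yfin (filterI (charged_digit Qadapted) (nuhat_unit Qadapted))).
  move=> w [Yw [cd nu1]].
  have fY : Y w \is a fin_num by rewrite ge0_fin_numE.
  have fYM : Y (Mp w) \is a fin_num.
    rewrite ge0_fin_numE//; suff : D (Mp w) by [].
    by rewrite -[D (Mp w)]/((@Mp R p hp @^-1` D) w) DM.
  split => //.
  rewrite [Y (Mp w)]/Y Mp_nuhat magnifyE// expr1 pB YU addeC.
  set m := (nuhat w : Mstar R) (cell _ _) in cd *.
  have mf : m \is a fin_num by exact: cell_fin.
  have m0 : (0 < fine m)%R by rewrite fine_gt0// cd -ge0_fin_numE// ltW.
  have m1 : (fine m <= 1)%R.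
    rewrite -lee_fin fineK// -nu1; apply: le_measure; rewrite ?inE.
    - exact: measurable_cell.
    - exact: (measurable_itv `[0%R, 1%R[).
    - have [h1 h2 h3] := cell1_bounds (ihat 1 w : 'I_p).
      move=> z; rewrite /cell expr1 /= !in_itv/= => /andP[h4 h5].
      by rewrite (le_trans h1 h4) (lt_le_trans h5 h3).
  by rewrite -[leLHS]mul1e lee_wpmul2r ?adde_ge0// lee_fin invf_ge1.
have u0 : {ae Q, forall w, (0 <= g w - g (Mp w))%R}.
  apply: filterS grow => w [fY fYM h]; rewrite subr_ge0 /g lef_pV2 ?posrE.
  - rewrite lerD2l fine_le//; apply: le_trans h; exact: leeDl.
  - by rewrite ltr_pwDl// fine_ge0.
  - by rewrite ltr_pwDl// fine_ge0.
have mu : measurable_fun setT (fun w => (g w)%:E - (g (Mp w))%:E).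
  under eq_fun do rewrite -EFinB; apply/measurable_EFinP.
  exact: measurable_realfun.measurable_funB.
have : \int[Q]_w `|(g w)%:E - (g (Mp w))%:E| = 0.
  rewrite -[RHS]eqI; apply: ae_eq_integral => //; first exact: measurableT_comp.
  by apply: filterS u0 => w u0w _; rewrite gee0_abs// -EFinB lee_fin.
move/(ae_eq_integral_abs _ measurableT mu) => ae0.
apply: filterS (filterI ae0 grow) => w [/(_ Logic.I)/= e [fY fYM h]].
move: e; rewrite -EFinB => -[/eqP]; rewrite subr_eq0 => /eqP/invr_inj/addrI e.
apply/eqP; rewrite eq_le measure_ge0 andbT.
move: h; rewrite -(fineK fYM) -e (fineK fY) -{2}[Y w]adde0 leeD2lE//.
Qed.

End growth.

(** * Properties of the law of the measure *)

Section consequences.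
Context {R : realType} {p : nat} {hp : (1 < p)%N} (Q : probability (Omega R hp) R).
Local Notation Omega := (Omega R hp).
Local Notation X := (borel (Mstar R)).
Local Notation past := (@past R p hp).
Local Notation cell := (@cell R p).
Implicit Types (w : Omega) (j : 'I_p) (x : X).
Local Open Scope ereal_scope.

Hypothesis Qinv : invariant_distribution Q.
Hypothesis Qadapted : adapted Q.
Hypothesis ndQ : ~ deterministic Q.
Hypothesis Qerg : ergodic Q.

(** The parts of the unit interval that the magnification along [j] sends to
    the right and to the left of the unit interval. *)
Definition above j : set R := `[((nat_of_ord j).+1%:R / p%:R)%R, 1%R[.
Definition below j : set R := `[0%R, ((nat_of_ord j)%:R / p%:R)%R[.

Lemma cell_above (i j : 'I_p) : (i < j)%N -> cell 1 j `<=` above i.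
Proof.
move=> ij z; rewrite /cell /above expr1 /= !in_itv/= => /andP[h1 h2].
have [_ _ h3] := cell1_bounds (R := R) (hp := hp) j.
rewrite (lt_le_trans h2 h3) andbT; apply: le_trans h1.
by rewrite ler_pM2r ?ler_nat// invr_gt0 ltr0n ltnW.
Qed.

Lemma cell_below (i j : 'I_p) : (i < j)%N -> cell 1 i `<=` below j.
Proof.
move=> ij z; rewrite /cell /below expr1 /= !in_itv/= => /andP[h1 h2].
have [h3 _ _] := cell1_bounds (R := R) (hp := hp) i.
rewrite (le_trans h3 h1) /=; apply: (lt_le_trans h2).
by rewrite ler_pM2r ?ler_nat// invr_gt0 ltr0n ltnW.
Qed.

Lemma above_charged :
  ~ {ae Q, forall w, (nuhat w : Mstar R) (above (ihat 1 w : 'I_p)) = 0}.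
Proof.
apply: contra_not ndQ; apply: deterministic_of => //.
  by move=> j; exact: measurable_itv.
move=> i j; rewrite neq_ltn => /orP[ij|ji]; [right|left]; exact: cell_above.
Qed.

Lemma below_charged :
  ~ {ae Q, forall w, (nuhat w : Mstar R) (below (ihat 1 w : 'I_p)) = 0}.
Proof.
apply: contra_not ndQ; apply: deterministic_of => //.
  by move=> j; exact: measurable_itv.
move=> i j; rewrite neq_ltn => /orP[ij|ji]; [left|right]; exact: cell_below.
Qed.

Let pp : (0 < p%:R :> R)%R. Proof. exact: p_gt0. Qed.

Lemma infinite_right :
  {ae Q, forall w, (nuhat w : Mstar R) `[1%R, +oo[%classic = +oo}.
Proof.
apply: (infinite_mass Qinv Qadapted Qerg (C := above)); last exact: above_charged.
- exact: (measurable_itv `[1%R, +oo[).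
- by move=> j; exact: measurable_itv.
- move=> j; apply/seteqP; split => // z; rewrite /above/= !in_itv/= andbT => -[/andP[_ h1] h2].
  by move: h1; rewrite ltNge h2.
- move=> j z; have [h1 h2 _] := cell1_bounds (R := R) (hp := hp) j.
  by rewrite /above/= !in_itv/= => /andP[h3 ->]; rewrite (le_trans h1 (le_trans h2 h3)).
- move=> j; apply/seteqP; split => z; rewrite /above/= /affine !in_itv/= !andbT => h.
    have [z1|z1] := ltP z 1%R; [left|by right].
    by rewrite andbT ler_pdivrMr// -natr1 mulrC addrC -lerBrDr.
  rewrite lerBrDr addrC natr1 mulrC -ler_pdivrMr//.
  have [_ _ h3] := cell1_bounds (R := R) (hp := hp) j.
  by case: h => [/andP[]//|]; exact: le_trans.
Qed.

Lemma infinite_left :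
  {ae Q, forall w, (nuhat w : Mstar R) `]-oo, 0%R[%classic = +oo}.
Proof.
apply: (infinite_mass Qinv Qadapted Qerg (C := below)); last exact: below_charged.
- exact: (measurable_itv `]-oo, 0%R[).
- by move=> j; exact: measurable_itv.
- move=> j; apply/seteqP; split => // z; rewrite /below/= !in_itv/= => -[/andP[h1 _] h2].
  by move: h1; rewrite leNgt h2.
- move=> j z; have [_ h2 h3] := cell1_bounds (R := R) (hp := hp) j.
  by rewrite /below/= !in_itv/= => /andP[-> h]; rewrite (lt_le_trans h (le_trans h2 h3)).
- move=> j; have [h1 _ _] := cell1_bounds (R := R) (hp := hp) j.
  apply/seteqP; split => z; rewrite /below/= /affine !in_itv/= => h.
    have [z1|z1] := ltP z 0%R; [by right|left].
    by rewrite /= ltr_pdivlMr// mulrC -subr_lt0.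
  rewrite subr_lt0 mulrC -ltr_pdivlMr//.
  by case: h => [/andP[]//|h]; exact: lt_le_trans h h1.
Qed.

Lemma itv_mass_unbounded (x : Mstar R) (F : nat -> set R) (B : set R) :
  (forall n, measurable (F n)) -> measurable B -> nondecreasing_seq F ->
  B `<=` \bigcup_n F n -> x B = +oo -> (forall n, x (F n) \is a fin_num) ->
  forall M : R, exists n, (M < fine (x (F n)))%R.
Proof.
move=> mF mB ndF BF xB fF M; apply: contrapT => /forallNP h.
have mU : measurable (\bigcup_n F n) by exact: bigcupT_measurable.
have : x B <= M%:E.
  apply: (@le_trans _ _ (x (\bigcup_n F n))).
    by apply: le_measure; rewrite ?inE.
  have /cvg_lim <- // := @nondecreasing_cvg_mu _ _ R x F mF mU ndF.
  apply: lime_le.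
    by apply: cvgP; exact: (@nondecreasing_cvg_mu _ _ R x F mF mU ndF).
  apply: nearW => n /=; rewrite -(fineK (fF n)) lee_fin leNgt; apply/negP; exact: h.
by rewrite xB.
Qed.

Definition last_from (N : nat) : set Omega :=
  [set w | forall n, (N <= n)%N -> (digit_nat (ihat (- n%:Z) w)).+1 = p].

Let measurable_last_from N : measurable (last_from N).
Proof.
rewrite (_ : last_from N = \bigcap_n (if (N <= n)%N
    then [set w : Omega | (digit_nat (ihat (- n%:Z) w)).+1 = p] else setT)).
  apply: bigcapT_measurable => n; case: ifP => // _.
  rewrite (_ : [set _ | _] = \bigcup_(j : 'I_p)
      (if (nat_of_ord j).+1 == p then digit_event (- n%:Z) j else set0)).
    apply: countable_bigcupT_measurable => // j; case: ifP => // _.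
    exact: measurable_digit_event.
  apply/seteqP; split => [w /= wp|w [j _]].
    by exists (ihat (- n%:Z) w : 'I_p) => //; rewrite (introT eqP wp).
  by case: ifP => // /eqP jp; rewrite /digit_event /digit_nat/= => ->.
apply/seteqP; split => [w h n _|w h n Nn]; first by case: ifP => // Nn; exact: h.
by have := h n Logic.I; rewrite Nn.
Qed.

(** The event that only finitely many past digits differ from [p - 1] is
    invariant; were it almost sure, so would be the event that all the past
    digits are equal to [p - 1], and then also the next one, which would contradict
    [above_charged]. *)
Lemma last_from_null : {ae Q, forall w, forall N, ~ last_from N w}.
Proof.
have mU : measurable (\bigcup_N last_from N).
  by apply: bigcupT_measurable => N; exact: measurable_last_from.
have ndF : nondecreasing_seq last_from.
  apply/nondecreasing_seqP => N; apply/subsetPset => w h n Nn; apply: h; exact: ltnW.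
have shiftE N : @Mp R p hp @^-1` (last_from N.+1) = last_from N.
  apply/seteqP; split => w h n Nn.
    by have := h n.+1 Nn; rewrite ihat_Mp intS opprD addrAC addNr add0r.
  case: n Nn => // n Nn; rewrite ihat_Mp intS opprD addrAC addNr add0r; exact: h.
have UM : @Mp R p hp @^-1` (\bigcup_N last_from N) = \bigcup_N last_from N.
  apply/seteqP; split => w.
    move=> [N _ wN]; exists N => //; rewrite -shiftE.
    by have /subsetPset := ndF _ _ (leqnSn N); apply.
  by move=> [N _ wN]; exists N.+1 => //; rewrite -shiftE in wN.
have QN N : Q (last_from N) = Q (last_from 0).
  by elim: N => // N <-; rewrite -(shiftE N) Qinv.
have [U0|U1] := Qerg mU UM.
  move: U0 => /(proj2 (negligibleP _ mU)); apply: negligibleS => w /= h.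
  apply: contrapT => hn; apply: h => N wN; apply: hn; by exists N.
exfalso; apply: above_charged.
have Q0 : Q (last_from 0) = 1.
  have := @nondecreasing_cvg_mu _ _ R Q _ measurable_last_from mU ndF.
  rewrite (_ : Q \o last_from = cst (Q (last_from 0))); last exact/funext.
  by move=> /(cvg_lim (@ereal_hausdorff R)); rewrite lim_cst// => ->.
have jp : (p.-1 < p)%N by rewrite ltn_predL ltnW.
pose j := Ordinal jp.
have QE0 : Q (digit_event 0 j) = 1.
  apply/eqP; rewrite eq_le; apply/andP; split.
    by apply: probability_le1; exact: measurable_digit_event.
  rewrite -Q0; apply: le_measure; rewrite ?inE.
  - exact: measurable_last_from.
  - exact: measurable_digit_event.
  - move=> w /(_ 0%N (leqnn 0)); rewrite oppr0 /digit_event/= => e.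
    by apply: val_inj; apply: succn_inj; rewrite /= prednK//; exact: ltnW.
have QE1 : Q (digit_event 1 j) = 1.
  by rewrite -QE0 -[RHS]Qinv//; exact: measurable_digit_event.
apply: filterS (ae_full (measurable_digit_event 1 j) QE1) => w.
rewrite /digit_event/= => ->.
rewrite /above /= prednK; last exact: ltnW.
rewrite divff ?lt0r_neq0// set_itv_ge ?measure0//=.
by rewrite bnd_simp ltxx.
Qed.

Lemma last_digits_lt n w : (last_digits n w < p ^ n)%N.
Proof.
elim: n => [|n ih]; first by rewrite /last_digits big_ord0.
rewrite /last_digits big_ord_recr/= expnS; set L := (\sum_(i < n) _)%N.
apply: (@leq_trans (p ^ n * (digit_nat (ihat (- n%:Z) w)).+1)%N).
  by rewrite mulnS ltn_add2r.
by rewrite mulnC leq_mul2r; apply/orP; right; exact: (ltn_ord (ihat (- n%:Z) w : 'I_p)).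
Qed.

Lemma last_digits_stay n k w : (last_digits n w + k < p ^ n)%N ->
  (last_digits n.+1 w + k < p ^ n.+1)%N.
Proof.
move=> h; rewrite /last_digits big_ord_recr/= -/(last_digits n w) addnAC expnS.
apply: (@leq_trans (p ^ n * (digit_nat (ihat (- n%:Z) w)).+1)%N).
  by rewrite mulnS ltn_add2r.
by rewrite mulnC leq_mul2r; apply/orP; right; exact: (ltn_ord (ihat (- n%:Z) w : 'I_p)).
Qed.

(** Each digit other than [p - 1] increases the room between the last digits and
    [p ^ n] by at least one. *)
Lemma last_digits_room w : (forall N, ~ last_from N w) ->
  forall k, exists n, (last_digits n w + k < p ^ n)%N.
Proof.
move=> h; elim=> [|k [n nk]]; first by exists 0%N; rewrite addn0 last_digits_lt.
have [m nm mp] : exists2 m, (n <= m)%N & (digit_nat (ihat (- m%:Z) w)).+1 != p.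
  apply: contrapT => hn; apply: (h n) => m nm; apply/eqP; apply: contrapT => mp.
  by apply: hn; exists m => //; exact/negP.
have {nk nm} mk : (last_digits m w + k < p ^ m)%N.
  elim: m nm {mp} => [|m ih]; first by rewrite leqn0 => /eqP <-.
  by rewrite leq_eqVlt => /orP[/eqP <-//|nm]; apply: last_digits_stay; exact: ih.
exists m.+1; rewrite /last_digits big_ord_recr/= -/(last_digits m w) addnS addnAC -addSn.
have mp' : ((digit_nat (ihat (- m%:Z) w)).+1 < p)%N.
  by rewrite ltn_neqAle mp; exact: (ltn_ord (ihat (- m%:Z) w : 'I_p)).
rewrite expnS; apply: (@leq_trans (p ^ m * (digit_nat (ihat (- m%:Z) w)).+2)%N).
  rewrite !mulnS addnA ltn_add2r; apply: (leq_ltn_trans mk).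
  by rewrite -[ltnLHS]addn0 ltn_add2l expn_gt0 ltnW.
by rewrite mulnC leq_mul2r; apply/orP; right.
Qed.

Lemma sum_shift_le N k (a : nat -> \bar R) : (forall i, 0 <= a i) ->
  \sum_(J < N) (if (J + k < N)%N then a (J + k)%N else 0) <= \sum_(J < N) a J.
Proof.
move=> a0; rewrite -(big_mkord xpredT (fun J => if (J + k < N)%N then a (J + k)%N else 0)).
rewrite -(big_mkord xpredT a).
have [kN|Nk] := leqP k N; last first.
  rewrite big_nat big1 ?sume_ge0// => J _.
  by rewrite ltnNge (leq_trans (ltnW Nk))// leq_addl.
rewrite (big_cat_nat (n := (N - k)%N))//=; last exact: leq_subr.
rewrite [X in _ + X]big_nat [X in _ + X]big1 ?adde0; last first.
  by move=> J /andP[h _]; rewrite ltnNge addnC -leq_subLR h.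
rewrite [leRHS](big_cat_nat (n := k))//=.
rewrite (_ : \sum_(0 <= i < N - k) _ = \sum_(k <= i < N) a i).
  by apply: leeDr; exact: sume_ge0.
rewrite -[in RHS](add0n k) big_addn; apply: eq_big_nat => J /andP[_ h].
by rewrite {1}addnC -ltn_subRL h.
Qed.

(** In the formula for the law of the last digits, a translation by [k] permutes
    the cells of generation [n], up to the last [k] ones. These are avoided by
    the last digits when [n] is large, and monotone convergence applies. *)
Lemma transport_digits k (h : X -> \bar R) : measurable_fun setT h ->
  (forall x, 0 <= h x) ->
  \int[Q]_w ((mass k (nuhat w))%:E * h (tstar k%:R (nuhat w))) <=
  \int[Q]_w h (nuhat w).
Proof.
move=> mh h0; pose G (x : X) := (mass k x)%:E * h (tstar k%:R x).
have mG : measurable_fun [set: X] G.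
  apply: emeasurable_funM; first by apply/measurable_EFinP; exact: measurable_mass_cell.
  exact: (measurableT_comp mh (measurable_tstar k%:R)).
have G0 x : 0 <= G x by rewrite mule_ge0// lee_fin mass_ge0.
pose psi n (d : nat) (x : X) := if (d + k < p ^ n)%N then G x else 0.
have mpsi n d : measurable_fun [set: X] (psi n d).
  by rewrite /psi; case: (_ < _)%N.
have psi0 n d x : 0 <= psi n d x by rewrite /psi; case: ifP.
pose g n (w : Omega) := psi n (last_digits n w) (nuhat w).
have mg n : measurable_fun setT (g n).
  apply: (measurable_glue (idx := @last_digits R p hp n) (g := fun d w => psi n d (nuhat w))).
    by move=> d; apply: past_measurable; exact: last_digits_past.
  by move=> d; exact: (measurableT_comp (mpsi n d) (@measurable_nuhat R p hp)).
have gh n : \int[Q]_w g n w <= \int[Q]_w h (nuhat w).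
  rewrite (last_digits_integral Qinv Qadapted n (mpsi n) (psi0 n)).
  rewrite [leRHS](last_digits_integral Qinv Qadapted n (psi := fun _ => h))//.
  apply: ge0_le_integral => //.
  - by move=> w _; apply: sume_ge0 => J _; exact: mule_ge0.
  - apply: emeasurable_sum => J _; apply: emeasurable_funM => //; first exact: measurable_nuhat_cell.
    exact: (measurableT_comp (mpsi n J)
      (measurableT_comp (measurable_magnify n J) (@measurable_nuhat R p hp))).
  - apply: emeasurable_sum => J _; apply: emeasurable_funM => //; first exact: measurable_nuhat_cell.
    exact: (measurableT_comp mh
      (measurableT_comp (measurable_magnify n J) (@measurable_nuhat R p hp))).
  - move=> w _; pose a J := (nuhat w : Mstar R) (cell n J) * h (magnify (hp := hp) n J (nuhat w)).
    apply: (le_trans _ (sum_shift_le (p ^ n) k (a := a) _)); last first.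
      by move=> i; exact: mule_ge0.
    apply: lee_sum => J _; rewrite /psi; case: ifP => _; last by rewrite mule0.
    rewrite /G muleA tstar_magnify /a lee_wpmul2r// EFin_mass.
    have -> : `[k%:R, k.+1%:R[%classic = cell 0 k by rewrite /cell expr0 invr1 !mulr1.
    by rewrite magnify_cell addn0 expn0 mul1n addnC; case: ifP.
have ndg w : {homo (fun n => g n w) : m n / (m <= n)%N >-> m <= n}.
  apply/nondecreasing_seqP => n; rewrite /g /psi; case: ifP => [hn|_].
    by rewrite last_digits_stay.
  by case: ifP.
have -> : \int[Q]_w G (nuhat w) = \int[Q]_w limn (fun n => g n w).
  apply: ge0_ae_eq_integral => //.
  - exact: (measurableT_comp mG (@measurable_nuhat R p hp)).
  - apply: (emeasurable_fun_cvg g) => // w _.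
    by apply: ereal_nondecreasing_is_cvgn; exact: ndg.
  - move=> w _; apply: lime_ge; first by apply: ereal_nondecreasing_is_cvgn; exact: ndg.
    by apply: nearW => n; exact: psi0.
  - apply: filterS last_from_null => w hw _; apply/esym/cvg_lim => //.
    have [N Nk] := last_digits_room hw k.
    apply: cvg_near_cst; exists N => // n /= Nn; apply/eqP.
    rewrite /g /psi; suff -> : (last_digits n w + k < p ^ n)%N by [].
    elim: n Nn => [|n ih]; first by rewrite leqn0 => /eqP <-.
    by rewrite leq_eqVlt => /orP[/eqP <-//|nm]; apply: last_digits_stay; exact: ih.
have cg := @cvg_monotone_convergence _ _ R Q setT measurableT g mg (fun n w _ => psi0 _ _ _)
  (fun w _ => ndg w).
rewrite -(cvg_lim _ cg)//; apply: lime_le; first by apply: cvgP; exact: cg.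
by apply: nearW => n; exact: gh.
Qed.

Local Notation P := (nuhatQ Q).

Lemma ae_nuhatQ (A : set X) : measurable A -> {ae Q, forall w, A (nuhat w)} ->
  {ae P, forall x : X, A x}.
Proof.
move=> mA h; apply/(negligibleP _ (measurableC mA)).
have mN : measurable (~` (@nuhat R p hp @^-1` A)).
  by apply: measurableC; rewrite -[X in measurable X]setTI; exact: measurable_nuhat.
exact: (negligibleP _ mN).1 h.
Qed.

Lemma ae_mass (A : set R) (c : \bar R) : measurable A ->
  {ae Q, forall w, (nuhat w : Mstar R) A = c} ->
  {ae P, forall x : X, (x : Mstar R) A = c}.
Proof.
move=> mA; apply: (@ae_nuhatQ [set x : X | (x : Mstar R) A = c]).
rewrite -[X in measurable X]setTI.
exact: (measurable_Mstar_mass mA measurableT (emeasurable_set1 c)).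
Qed.

Lemma nuhatQ_mass0 : {ae P, forall x : X, mass 0 x = 1%R}.
Proof.
apply: filterS (ae_mass (measurable_itv _) (nuhat_unit Qadapted)) => x h.
by rewrite /mass h.
Qed.

Lemma nuhatQ_transport k (h : X -> \bar R) : measurable_fun setT h ->
  (forall x, 0 <= h x) ->
  \int[P]_x ((mass k x)%:E * h (tstar k%:R x)) <= \int[P]_x h x.
Proof.
move=> mh h0; rewrite !ge0_integral_distribution//.
- exact: transport_digits.
- apply: emeasurable_funM; first by apply/measurable_EFinP; exact: measurable_mass_cell.
  exact: (measurableT_comp mh (measurable_tstar k%:R)).
- by move=> x; rewrite mule_ge0// lee_fin mass_ge0.
Qed.

Lemma nuhatQ_right_infinite : {ae P, forall x : X, right_infinite x}.
Proof.
apply: filterS (ae_mass (measurable_itv _) infinite_right) => x h M.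
have [n Mn] : exists n, (M < fine ((x : Mstar R) `[0%R, n%:R[%classic))%R.
  apply: (@itv_mass_unbounded x _ _ _ _ _ _ h).
  - by move=> n; exact: measurable_itv.
  - exact: measurable_itv.
  - apply/nondecreasing_seqP => n; apply/subsetPset => z; rewrite /= !in_itv/=.
    by move=> /andP[-> zn]; rewrite (lt_le_trans zn)// ler_nat.
  - move=> z; rewrite /= in_itv/= andbT => z1; exists (Num.truncn z).+1 => //.
    by rewrite /= in_itv/= (le_trans ler01 z1) truncnS_gt.
  - by move=> n; exact: radon_itv_fin_num.
exists n; rewrite orbit_sum1; apply: (lt_le_trans Mn).
have := radon_itv_mass (x : Mstar R) 0 n; rewrite !add0n => -> /=.
by rewrite big_mkord.
Qed.

Lemma nuhatQ_left_infinite :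
  {ae P, forall x : X, forall M : R, exists m, (M < left_mass m x)%R}.
Proof.
apply: filterS (ae_mass (measurable_itv _) infinite_left) => x h.
apply: (@itv_mass_unbounded x _ _ _ _ _ _ h).
- by move=> n; exact: measurable_itv.
- exact: measurable_itv.
- apply/nondecreasing_seqP => n; apply/subsetPset => z; rewrite /= !in_itv/=.
  by move=> /andP[zn ->]; rewrite andbT (le_trans _ zn)// lerN2 ler_nat.
- move=> z; rewrite /= in_itv/= => z0; exists (Num.truncn (- z)).+1 => //.
  by rewrite /= in_itv/= z0 andbT lerNl ltW// truncnS_gt.
- by move=> n; exact: radon_itv_fin_num.
Qed.

End consequences.

(** * Averages over real windows *)

Section bounded_integrals.
Context {R : realType}.
Implicit Types (nu : radon R) (phi : R -> R) (B : R).

Lemma integrable_bounded_itv nu phi B (a b : R) : measurable_fun setT phi ->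
  (forall t, `|phi t| <= B) -> nu.-integrable `[a, b[ (EFin \o phi).
Proof.
move=> mphi phiB; apply: measurable_bounded_integrable.
- exact: measurable_itv.
- by rewrite -ge0_fin_numE//; exact: radon_itv_fin_num.
- exact: measurable_funTS.
- exists B; split; first exact: num_real.
  by move=> M BM t _ /=; rewrite (le_trans (phiB t))// ltW.
Qed.

Lemma Rintegral_itv_split nu phi B (a b c : R) : measurable_fun setT phi ->
  (forall t, `|phi t| <= B) -> a <= b -> b <= c ->
  \int[nu]_(t in `[a, c[) phi t = \int[nu]_(t in `[a, b[) phi t + \int[nu]_(t in `[b, c[) phi t.
Proof.
move=> mphi phiB ab bc.
have e : `[a, b[%classic `|` `[b, c[%classic = `[a, c[%classic.
  apply/seteqP; split => z; rewrite /= !in_itv/=; last first.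
    by move=> /andP[az zc]; have [zb|bz] := ltP z b; [left|right]; rewrite ?az.
  by move=> [|] /andP[h1 h2]; rewrite ?h1 ?h2 ?(le_trans ab)//= (lt_le_trans h2).
rewrite -e Rintegral_setU//.
- by rewrite e; exact: integrable_bounded_itv phiB.
- rewrite disj_set2E; apply/eqP/seteqP; split => // z.
  rewrite /= !in_itv/= => -[/andP[_ h1] /andP[h2 _]].
  by move: h1; rewrite ltNge h2.
Qed.

Lemma Rintegral_itv_bound nu phi B (a b : R) : measurable_fun setT phi ->
  (forall t, `|phi t| <= B) ->
  `|\int[nu]_(t in `[a, b[) phi t| <= B * fine (nu `[a, b[%classic).
Proof.
move=> mphi phiB.
have ip := integrable_bounded_itv nu a b mphi phiB.
apply: (le_trans (le_normr_Rintegral (measurable_itv _) ip)).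
rewrite -Rintegral_cst; last exact: measurable_itv.
apply: le_Rintegral => //.
- exact: integrable_norm.
- have B0 : forall t : R, `|B| <= `|B| by [].
  exact: (@integrable_bounded_itv nu (cst B) `|B| a b (measurable_cst _) B0).
Qed.

Lemma ge0_integral_tstar_nat k (x : Mstar R) (h : R -> \bar R) : 0 < mass k x ->
  measurable_fun setT h -> (forall t, 0 <= h t)%E ->
  (\int[tstar k%:R x]_(t in `[0%R, 1%R[) h t =
  ((mass k x)^-1)%:E * \int[x]_(t in `[k%:R, k.+1%:R[) h (t - k%:R)%R)%E.
Proof.
move=> k0 mh h0.
have ma : measurable_fun [set: R] (affine 1 (- k%:R) : R -> R).
  by apply: measurable_realfun.continuous_measurable_fun; exact: continuous_affine.
pose theta : R -> R := affine 1 (- k%:R).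
have c0 : 0 <= (mass k x)^-1 by rewrite invr_ge0 ltW.
apply: (@etrans _ _ (\int[mscale (NngNum c0) (pushforward x theta)]_(t in `[0%R, 1%R[) h t)%E) => //.
  apply: eq_measure_integral => A mA _; rewrite (tstar_charged k0 mA).
  by rewrite -[RHS]/(((mass k x)^-1)%:E * x (theta @^-1` A))%E.
rewrite ge0_integral_mscale//; last exact: measurable_funTS.
congr (_ * _)%E; rewrite ge0_integral_pushforward//; last exact: measurable_funTS.
rewrite -[theta @^-1` _]/(affine 1 (- k%:R) @^-1` `[0%R, 1%R[%classic).
rewrite preimage_affine_itv// !opprK !divr1 add0r nat1r.
by apply: eq_integral => t _; rewrite /= /theta /affine mul1r.
Qed.

End bounded_integrals.

Section real_averages.
Context {R : realType} (f : borel (Mstar R) -> R) (B : R).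
Hypotheses (mf : measurable_fun setT f) (fB : forall x, `|f x| <= B).
Local Notation X := (borel (Mstar R)).

Definition unit_average (x : X) : R := \int[x : Mstar R]_(t in `[0%R, 1%R[) f (tstar t x).

Let B0 : 0 <= B.
Proof. by apply: le_trans (fB (Nstar (radon0 R))); exact: normr_ge0. Qed.

Lemma measurable_unit_average : measurable_fun setT unit_average.
Proof. by apply: measurable_integral_tstar => //; exact: measurable_itv. Qed.

Let mft (x : Mstar R) : measurable_fun setT (fun t => f (tstar t x)).
Proof. exact: (measurableT_comp mf (measurable_tstar_l x)). Qed.

Lemma bounded_unit_average : bounded_by B unit_average.
Proof.
move=> x; apply: le_trans (Rintegral_itv_bound (x : Mstar R) 0 1 (mft x) (fun t => fB _)) _.
by case: (Mstar_unit (x : Mstar R)) => h; rewrite [X in fine X]h /= ?mulr0 ?mulr1.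
Qed.

(** Up to the weight [mass k x], the translate by [k] sees on [[0, 1[] what the
    measure sees on [[k, k + 1[]. *)
Lemma integral_cell k (x : Mstar R) :
  \int[x]_(t in `[k%:R, k.+1%:R[) f (tstar t x) = mass k x * unit_average (tstar k%:R x).
Proof.
have [k0|k0] := ltP 0 (mass k x); last first.
  have {}k0 : mass k x = 0 by apply/eqP; rewrite eq_le k0 mass_ge0.
  rewrite k0 mul0r /Rintegral null_set_integral//.
    by apply/measurable_EFinP; exact: measurable_funTS.
  by rewrite -EFin_mass k0.
have k0' : mass k x != 0 by rewrite gt_eqF.
have mphi : measurable_fun setT (fun t => f (tstar t (tstar k%:R x))) by exact: mft.
have i1 := integrable_bounded_itv x k%:R k.+1%:R (mft x) (fun t => fB _).
have i2 := integrable_bounded_itv (tstar k%:R x) 0 1 mphi (fun t => fB _).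
have shiftE t : tstar (t - k%:R) (tstar k%:R x) = tstar t x.
  by rewrite tstar_tstar addrC subrK.
(* The change of variables, for both signed parts of the integrand. *)
have part (u : X -> \bar R) : measurable_fun setT u -> (forall y, 0 <= u y)%E ->
    (\int[x]_(t in `[k%:R, k.+1%:R[) u (tstar t x) =
     (mass k x)%:E * \int[tstar k%:R x]_(t in `[0%R, 1%R[) u (tstar t (tstar k%:R x)))%E.
  move=> mu u0; rewrite ge0_integral_tstar_nat//.
    rewrite muleA -EFinM divff// mul1e.
    by apply: eq_integral => t _; rewrite shiftE.
  exact: (measurableT_comp mu (measurable_tstar_l (tstar k%:R x))).
rewrite /unit_average /Rintegral -[mass k x]/(fine (mass k x)%:E) -fineM//; last first.
  exact: integrable_fin_num.
congr fine; rewrite integralE [in RHS]integralE muleBr//; last first.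
  by apply: integrable_add_def.
congr (_ - _)%E.
- have mu : measurable_fun setT (fun y : X => ((EFin \o f)^\+)%E y).
    by apply: measurable_funepos; exact/measurable_EFinP.
  rewrite (eq_integral (fun t => (((EFin \o f)^\+) (tstar t x))%E)); last first.
    by move=> t _; rewrite !funeposE.
  rewrite [in RHS](eq_integral (fun t =>
      (((EFin \o f)^\+) (tstar t (tstar k%:R x)))%E)); last first.
    by move=> t _; rewrite !funeposE.
  by apply: (part (fun y => (((EFin \o f)^\+) y)%E)) => // y; exact: funepos_ge0.
- have mu : measurable_fun setT (fun y : X => ((EFin \o f)^\-)%E y).
    by apply: measurable_funeneg; exact/measurable_EFinP.
  rewrite (eq_integral (fun t => (((EFin \o f)^\-) (tstar t x))%E)); last first.
    by move=> t _; rewrite !funenegE.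
  rewrite [in RHS](eq_integral (fun t =>
      (((EFin \o f)^\-) (tstar t (tstar k%:R x)))%E)); last first.
    by move=> t _; rewrite !funenegE.
  by apply: (part (fun y => (((EFin \o f)^\-) y)%E)) => // y; exact: funeneg_ge0.
Qed.

Lemma integral_orbit_sum n (x : Mstar R) :
  \int[x]_(t in `[0, n%:R[) f (tstar t x) = orbit_sum n unit_average x.
Proof.
elim: n => [|n ih].
  by rewrite /orbit_sum big_ord0 set_itv_ge ?Rintegral_set0//= bnd_simp ltxx.
rewrite (@Rintegral_itv_split _ x _ B 0 n%:R n.+1%:R (mft x) (fun t => fB _))//.
- by rewrite ih integral_cell /orbit_sum big_ord_recr.
- by rewrite ler_nat.
Qed.

Definition real_average (x : Mstar R) (T : R) : R :=
  (fine (x `[0, T[%classic))^-1 * \int[x]_(t in `[0, T[) f (tstar t x).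

(** Numerator and denominator change by at most the mass of the last cell,
    relatively to [B] for the numerator. *)
Lemma real_average_near n (x : Mstar R) (T : R) : n%:R <= T -> T <= n.+1%:R ->
  0 < orbit_sum n (cst 1) x ->
  `|orbit_sum n unit_average x / orbit_sum n (cst 1) x - real_average x T| <=
  2 * B * (mass n x / orbit_sum n (cst 1) x).
Proof.
move=> nT Tn V0; rewrite /real_average.
rewrite (@Rintegral_itv_split _ x _ B 0 n%:R T (mft x) (fun t => fB _))//.
rewrite integral_orbit_sum.
have sB := Rintegral_itv_bound x n%:R T (mft x) (fun t => fB _).
have VE : fine (x `[0, n%:R[%classic) = orbit_sum n (cst 1) x.
  rewrite orbit_sum1; have := radon_itv_mass x 0 n; rewrite !add0n => -> /=.
  by rewrite big_mkord.
rewrite (@radon_itv_split _ x 0 n%:R T)// fineD ?radon_itv_fin_num// VE.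
have UB : `|orbit_sum n unit_average x| <= B * orbit_sum n (cst 1) x.
  rewrite -integral_orbit_sum -VE; exact: Rintegral_itv_bound (mft x) (fun t => fB _).
have r0 : 0 <= fine (x `[n%:R, T[%classic) by exact: fine_ge0.
have rm : fine (x `[n%:R, T[%classic) <= mass n x.
  apply: fine_le; rewrite ?radon_itv_fin_num//.
  apply: le_measure; rewrite ?inE; [exact: measurable_itv|exact: measurable_itv|].
  by move=> z; rewrite /= !in_itv/= => /andP[-> h]; exact: lt_le_trans h Tn.
move: V0 sB UB r0 rm; set V := orbit_sum n (cst 1) x; set U := orbit_sum n unit_average x.
set r := fine (x `[n%:R, T[%classic); set s := (\int[x]_(t in _) _).
set m := mass n x => V0 sB UB r0 rm.
have Vr : 0 < V + r by rewrite ltr_pwDl.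
have -> : U / V - (V + r)^-1 * (U + s) = (U / V * r - s) / (V + r).
  by field; rewrite !gt_eqF.
rewrite normrM normfV (gtr0_norm Vr) ler_pdivrMr//.
have h1 : `|U / V * r| <= B * m.
  rewrite !normrM normfV (gtr0_norm V0) (ger0_norm r0).
  apply: ler_pM => //; first by rewrite divr_ge0// ltW.
  by rewrite ler_pdivrMr.
have h2 : `|s| <= B * m by apply: le_trans sB _; exact: ler_wpM2l.
apply: (le_trans (ler_normB _ _)); apply: (le_trans (lerD h1 h2)).
have -> : B * m + B * m = 2 * B * (m / V) * V by field; rewrite gt_eqF.
apply: ler_wpM2l; last by rewrite lerDl.
by rewrite !mulr_ge0 ?invr_ge0 ?(ltW V0)// mass_ge0.
Qed.

Lemma cvg_real_average (x : Mstar R) (l : R) : right_infinite x ->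
  (forall e, 0 < e -> exists N, forall n, (N <= n)%N ->
    mass n x <= e * orbit_sum n (cst 1) x) ->
  orbit_sum n unit_average x / orbit_sum n (cst 1) x @[n --> \oo] --> l ->
  real_average x T @[T --> +oo] --> l.
Proof.
move=> xoo xm /cvgrPdist_lt cl; apply/cvgrPdist_lt => e e0.
have e2 : 0 < e / 2 by rewrite divr_gt0.
have C0 : 0 < 2 * B + 1 by rewrite ltr_wpDl// mulr_ge0.
have d0 : 0 < e / 2 / (2 * B + 1) by rewrite divr_gt0.
have [N1 _ h1] := cl _ e2; have [N2 h2] := xm _ d0; have [N3 h3] := xoo 0.
pose N := maxn N1 (maxn N2 N3).
exists N%:R; split; first exact: num_real.
move=> T NT.
have T0 : 0 <= T by apply: le_trans (ltW NT).
have /andP[nT Tn] := truncn_itv T0.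
set n := Num.truncn T in nT Tn.
have Nn : (N <= n)%N by rewrite -ltnS -(ltr_nat R); exact: lt_trans NT Tn.
have [n1 n2 n3] : [/\ (N1 <= n)%N, (N2 <= n)%N & (N3 <= n)%N].
  by move: Nn; rewrite /N !geq_max => /and3P[].
have V0 : 0 < orbit_sum n (cst 1) x by apply: lt_le_trans h3 _; exact: orbit_sum1_nd.
have near := real_average_near nT (ltW Tn) V0.
have := h1 n n1 => /= h.
rewrite -(subrK (orbit_sum n unit_average x / orbit_sum n (cst 1) x) l) -addrA.
apply: (le_lt_trans (ler_normD _ _)).
rewrite [ltRHS](splitr e); apply: ltr_leD => //.
apply: (le_trans near).
apply: (@le_trans _ _ (2 * B * (e / 2 / (2 * B + 1)))).
  by apply: ler_wpM2l; [rewrite mulr_ge0|rewrite ler_pdivrMr//; exact: h2].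
by rewrite mulrA ler_pdivrMr// mulrC ler_wpM2l ?(ltW e2)// lerDl.
Qed.

End real_averages.

(** * Real and imaginary parts *)

Section complex_values.
Context {R : realType}.
Local Open Scope complex_scope.

Lemma normc_le_components (z : R[i]) : `|z| <= (`|complex.Re z| + `|complex.Im z|)%:C.
Proof.
rewrite normc_def lecR -[leRHS]ger0_norm ?addr_ge0// -sqrtr_sqr ler_wsqrtr//.
rewrite sqrrD !real_normK ?num_real// lerD2r lerDl.
by rewrite mulrn_wge0// mulr_ge0.
Qed.

Lemma normc_ge_Im (z : R[i]) : `|complex.Im z|%:C <= `|z|.
Proof. by rewrite normc_def lecR -sqrtr_sqr ler_wsqrtr// lerDr sqr_ge0. Qed.

Lemma cvg_components (a b : R -> R) (l m : R) :
  a T @[T --> +oo] --> l -> b T @[T --> +oo] --> m ->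
  Complex (a T) (b T) @[T --> +oo] --> (Complex l m : R[i]^o).
Proof.
move=> /cvgrPdist_lt al /cvgrPdist_lt bm; apply/(@cvgrPdist_lt _ R[i]^o) => e e0.
have eE : (complex.Re e)%:C = e by apply: RRe_real; exact: gtr0_real.
have r0 : 0 < complex.Re e by rewrite -ltcR eE.
have r2 : 0 < complex.Re e / 2 by rewrite divr_gt0.
move: (al _ r2) (bm _ r2); apply: filterS2 => T h1 h2.
apply: (le_lt_trans (normc_le_components _)).
by rewrite -eE ltcR [ltRHS]splitr ltrD.
Qed.

(** Real and imaginary parts are contractions; the preimages of half-lines are
    open. *)
Lemma measurable_component d (T : measurableType d) (f : T -> borel (R[i]^o)) (g : R[i] -> R) :
  (forall z w, `|g z - g w|%:C <= `|z - w|) ->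
  measurable_fun setT f -> measurable_fun setT (g \o f).
Proof.
move=> gL mf.
have og x : open (g @^-1` `]x, +oo[%classic : set R[i]^o).
  rewrite openE => z /=; rewrite in_itv/= andbT => xz; apply/nbhs_ballP.
  exists (g z - x)%:C; first by rewrite /= ltcR subr_gt0.
  move=> w /= zw; rewrite in_itv/= andbT.
  have := le_lt_trans (gL z w) zw; rewrite ltcR => /(le_lt_trans (ler_norm _)).
  by rewrite ltrD2l ltrN2.
apply: (measurability _ (RGenOInfty.measurableE R)) => _ [_ [x ->] <-].
rewrite setTI comp_preimage -[X in measurable X]setTI; apply: mf => //.
exact: sub_sigma_algebra.
Qed.

End complex_values.

Theorem theorem1p14 (R : realType) (p : nat) (hp : (1 < p)%N)
    (Q : probability (Omega R hp) R) (hQ : extended_ECPD Q)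
    (ndQ : ~ deterministic Q)
    (f : Mstar R -> R[i]) (hf : bounded_measurable f) :
  {ae nuhatQ Q, forall nu : Mstar R,
    translate_average f nu T @[T --> +oo] -->
    (cond_expC (nuhatQ Q) (t_invariant (nuhatQ Q)) (integral01 f) nu : R[i]^o)}.
Proof.
have [Qadapted Qinv Qerg] := hQ; have [mf [B fB]] := hf.
pose re (x : borel (Mstar R)) := complex.Re (f x).
pose im (x : borel (Mstar R)) := complex.Im (f x).
have mre : measurable_fun setT re.
  have lip (z w : R[i]) : (`|complex.Re z - complex.Re w|%:C <= `|z - w|)%C.
    by rewrite -raddfB; exact: normc_ge_Re.
  exact: (measurable_component lip mf).
have mim : measurable_fun setT im.
  have lip (z w : R[i]) : (`|complex.Im z - complex.Im w|%:C <= `|z - w|)%C.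
    by rewrite -raddfB; exact: normc_ge_Im.
  exact: (measurable_component lip mf).
have reB x : `|re x| <= B.
  by rewrite -lecR; apply: le_trans (normc_ge_Re _) (fB x).
have imB x : `|im x| <= B.
  by rewrite -lecR; apply: le_trans (normc_ge_Im _) (fB x).
have mass0 := nuhatQ_mass0 Qadapted.
have transport := nuhatQ_transport Qinv Qadapted ndQ Qerg.
have growth := nuhatQ_right_infinite Qinv Qadapted ndQ Qerg.
have left_growth := nuhatQ_left_infinite Qinv Qadapted ndQ Qerg.
have small := mass_negligible mass0 transport growth left_growth.
have ratio (g : borel (Mstar R) -> R) (mg : measurable_fun setT g) (gB : forall x, `|g x| <= B) :=
  ratio_ergodic mass0 transport growth
    (measurable_unit_average mg) (bounded_unit_average mg gB).
have FF : Filter (nbhs (almost_everywhere (nuhatQ Q))).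
  exact: ae_filter_ringOfSetsType.
apply: filterS (filterI (filterI growth small) (filterI (ratio re mre reB) (ratio im mim imB))).
move=> x [[xoo xm] [cre cim]].
have {}cre := cvg_real_average mre reB xoo xm cre.
have {}cim := cvg_real_average mim imB xoo xm cim.
have := cvg_components cre cim.
rewrite (_ : (fun T => Complex _ _) = translate_average f x)//.
apply/funext => T; rewrite /translate_average /RintegralC.
by simpc.
Qed.
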